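(* Consider the random variable $X=\prod_{j=1}^{N}X_j$ in which $X_j$, $j=1,\dots,N$, are independent generalized gamma random variables, $X_j$ having parameters $\alpha_j,\beta_j,\gamma_j>0$ and shift parameter $\mu_j$, i.e. density $\frac{\gamma_j\beta_j^{\alpha_j/\gamma_j}}{\Gamma(\alpha_j/\gamma_j)}(x-\mu_j)^{\alpha_j-1}e^{-\beta_j(x-\mu_j)^{\gamma_j}}$ for $x>\mu_j$. Then the probability density function of $X$ is given by $$f_X(x)=\prod_{j=1}^{N}\left(\gamma_j\beta_j^{\alpha_j/\gamma_j}\mu_j^{\alpha_j-1}\right)\;\widehat{I}_{N}\left[x\;\bigg|\begin{array}{c}(1-\alpha_1,0,\gamma_1),\left(\frac{\alpha_1}{\gamma_1},0,0\right),(1,-1,0)\\(0,0,1),(1-\alpha_1,-1,\gamma_1)\\\left(\beta_1\mu_1^{\gamma_1},0,1,0,0,1\right)\\\left(0,\mu_1,1,0,0,0\right)\end{array};\dots;\begin{array}{c}(1-\alpha_N,0,\gamma_N),\left(\frac{\alpha_N}{\gamma_N},0,0\right),(1,-1,0)\\(0,0,1),(1-\alpha_N,-1,\gamma_N)\\\left(\beta_N\mu_N^{\gamma_N},0,1,0,0,1\right)\\\left(0,\mu_N,1,0,0,0\right)\end{array}\right],$$ where $\widehat I_N$ is the case $m=N$ of the generalized H function $\widehat I_m$ defined in the context.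
   Context: **The H function.** $$H_{3,2}^{2,1}\left[z\,\bigg|\begin{array}{c}(a_1,A_1),(a_2,A_2),(a_3,A_3)\\(b_1,B_1),(b_2,B_2)\end{array}\right]=\frac{1}{2\pi i}\int_{L}\frac{\Gamma(b_1+B_1t)\,\Gamma(b_2+B_2t)\,\Gamma(1-a_1-A_1t)}{\Gamma(a_2+A_2t)\,\Gamma(a_3+A_3t)}\,z^{-t}\,dt,$$ where the $A_k,B_k$ are nonnegative, all the $a_k,b_k$ may be complex, and the contour $L$ runs from $c-i\infty$ to $c+i\infty$ such that the poles of $\Gamma(b_j+B_jt)$, $j=1,2$, lie to the left of $L$ and the poles of $\Gamma(1-a_1-A_1t)$ lie to the right of $L$. **The generalized H function $\widehat I_m$.** For each $j=1,\dots,m$ there is a block of parameters $$\begin{array}{c}(\overline a_{j,1},\hat a_{j,1},\overline A_{j,1}),(\overline a_{j,2},\hat a_{j,2},\overline A_{j,2}),(\overline a_{j,3},\hat a_{j,3},\overline A_{j,3})\\ (\overline b_{j,1},\hat b_{j,1},\overline B_{j,1}),(\overline b_{j,2},\hat b_{j,2},\overline B_{j,2})\\ (\overline\gamma_j,\overline\Gamma_j,\overline\pi_j,\overline\Pi_j,\overline\rho_j,\overline\sigma_j)\\ (\overline\alpha_j,\overline\beta_j,\overline\Lambda_j,\overline\Theta_j,\overline\zeta_j,\overline\eta_j)\end{array}$$ in which the $\overline A_{j,k},\overline B_{j,k}$ are nonnegative real quantities and all the other entries are real numbers. The function is $$\widehat I_m[z\,|\,\text{block }1;\dots;\text{block }m]=\frac{1}{2\pi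 i}\int_{L}\Upsilon(s)\,z^{-s}\,ds,$$ $$\Upsilon(s)=\prod_{j=1}^{m}(\overline\alpha_js+\overline\beta_j)^{\overline\Lambda_js+\overline\Theta_j}e^{\overline\zeta_js+\overline\eta_j}\left(H_{3,2}^{2,1}\left[(\overline\gamma_j+\overline\Gamma_js)^{\overline\pi_j+\overline\Pi_js}\,\bigg|\begin{array}{c}(\overline a_{j,1}+\hat a_{j,1}s,\overline A_{j,1}),(\overline a_{j,2}+\hat a_{j,2}s,\overline A_{j,2}),(\overline a_{j,3}+\hat a_{j,3}s,\overline A_{j,3})\\(\overline b_{j,1}+\hat b_{j,1}s,\overline B_{j,1}),(\overline b_{j,2}+\hat b_{j,2}s,\overline B_{j,2})\end{array}\right]\right)^{\overline\rho_js+\overline\sigma_j}.$$ The product over $j$ extends over all the factors displayed. The contour $L$ in this integral runs from $c-i\infty$ to $c+i\infty$, where $c$ is a real number, and exists in accordance with the Mellin inversion theorem, taking into account all the singularities.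
   Formalization: The shift parameters are taken positive (μ_j > 0), since the formula is undefined or false for μ_j ≤ 0; N ≥ 1; and the formula is asserted for every x > 0 except the endpoint x = ∏μ_j of the support, where the integral may diverge. *)

(* Defs.v *)
From HB Require Import structures.
From mathcomp Require Export all_boot all_order all_algebra.
From mathcomp Require Export all_classical all_reals all_analysis.
Set Implicit Arguments.
Unset Strict Implicit.
Unset Printing Implicit Defensive.
Export Order.TTheory GRing.Theory Num.Theory.
Export numFieldNormedType.Exports.
From mathcomp Require Export complex.

Global Open Scope classical_set_scope.
Global Open Scope ring_scope.
Global Open Scope complex_scope.

Section ComplexFunctions.
Variable R : realType.
Implicit Types (z w s t : R[i]) (D : set R) (f : R -> R[i]).

Definition cexp z : R[i] :=
  (expR (Re z) * cos (Im z)) +i* (expR (Re z) * sin (Im z)).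

Definition cabs z : R := Num.sqrt (Re z ^+ 2 + Im z ^+ 2).

(* principal argument, with values in ]-pi, pi] (irrelevant value at 0) *)
Definition carg z : R :=
  if 0 <= Im z then acos (Re z / cabs z) else - acos (Re z / cabs z).

Definition clog z : R[i] := ln (cabs z) +i* carg z.

(* principal power; 0 ^ 0 = 1 and 0 ^ w = 0 for w != 0, so that z ^ 1 = z for
   every z, the value 0 included *)
Definition cpow z w : R[i] :=
  if z == 0 then (w == 0)%:R else cexp (w * clog z).

Definition cintegrable D f : Prop :=
  (@lebesgue_measure R).-integrable D (EFin \o (fun y => Re (f y))) /\
  (@lebesgue_measure R).-integrable D (EFin \o (fun y => Im (f y))).

Definition cintegral D f : R[i] :=
  Rintegral (@lebesgue_measure R) D (fun y => Re (f y)) +i*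
  Rintegral (@lebesgue_measure R) D (fun y => Im (f y)).

Definition Euler_Gamma z : R[i] :=
  cintegral `]0, +oo[ (fun u => cpow u%:C (z - 1) * (expR (- u))%:C).

(* Euler's integral for 0 < Re z, continued to Re z <= 0 by means of
   Gamma z = Gamma (z + n) / (z (z + 1) ... (z + n - 1)), where n is the least
   natural number such that 0 < Re z + n.  At the poles 0, -1, -2, ... the
   value is 0; as 0^-1 = 0, 1 / Gamma has there its correct value 0. *)
Definition cGamma z : R[i] :=
  let n := Num.truncn (1 - Re z) in
  Euler_Gamma (z + n%:R) / \prod_(k < n) (z + k%:R).

Definition cGamma_pole z : Prop := exists n : nat, z = - n%:R.

(* v is the value of 1 / (2 pi i) times the integral of F over the vertical line
   from c - i oo to c + i oo, that is, the limit of the integrals from c - i T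
   to c + i T.  With s = c + i y one has ds = i dy, so the factor i cancels. *)
Definition is_line_integral (F : R[i] -> R[i]) (c : R) (v : R[i]) : Prop :=
  (forall T : R, cintegrable `[- T, T] (fun y => F (c +i* y))) /\
  ((2 * pi)^-1)%:C * cintegral `[- T, T] (fun y => F (c +i* y))
    @[T --> +oo] --> (v : R[i]^o).

End ComplexFunctions.

(* upper parameters (a_k, A_k) and lower parameters (b_k, B_k) of H^{2,1}_{3,2} *)
Record Hparams (R : realType) := MkHparams {
  H_a1 : R[i]; H_A1 : R; H_a2 : R[i]; H_A2 : R; H_a3 : R[i]; H_A3 : R;
  H_b1 : R[i]; H_B1 : R; H_b2 : R[i]; H_B2 : R }.

Section FoxH.
Variable R : realType.
Implicit Types (p : Hparams R) (z t v : R[i]) (c : R).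

Definition foxH_integrand p z t : R[i] :=
  cGamma (H_b1 p + (H_B1 p)%:C * t) * cGamma (H_b2 p + (H_B2 p)%:C * t) *
  cGamma (1 - H_a1 p - (H_A1 p)%:C * t) /
  (cGamma (H_a2 p + (H_A2 p)%:C * t) * cGamma (H_a3 p + (H_A3 p)%:C * t)) *
  cpow z (- t).

Definition foxH_nneg p : Prop :=
  [/\ 0 <= H_A1 p, 0 <= H_A2 p, 0 <= H_A3 p, 0 <= H_B1 p & 0 <= H_B2 p].

Definition foxH_contour p c : Prop :=
  [/\ forall t, cGamma_pole (H_b1 p + (H_B1 p)%:C * t) -> Re t < c,
      forall t, cGamma_pole (H_b2 p + (H_B2 p)%:C * t) -> Re t < c
    & forall t, cGamma_pole (1 - H_a1 p - (H_A1 p)%:C * t) -> c < Re t].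

(* v = H^{2,1}_{3,2}[z | p]: there is a separating line, and the integral over
   every separating line converges to v *)
Definition is_foxH p z v : Prop :=
  [/\ foxH_nneg p, exists c, foxH_contour p c
    & forall c, foxH_contour p c -> is_line_integral (foxH_integrand p z) c v].

End FoxH.

(* gp_bar, gp_hat, gp_slope are the entries of a triple (a-bar, a-hat, A-bar) *)
Record gparam (R : realType) :=
  GParam { gp_bar : R; gp_hat : R; gp_slope : R }.

Record block (R : realType) := Block {
  bl_a1 : gparam R; bl_a2 : gparam R; bl_a3 : gparam R;
  bl_b1 : gparam R; bl_b2 : gparam R;
  bl_gamma : R; bl_Gamma : R; bl_pi : R; bl_Pi : R; bl_rho : R; bl_sigma : R;
  bl_alpha : R; bl_beta : R; bl_Lambda : R; bl_Theta : R;
  bl_zeta : R; bl_eta : R }.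

Section GeneralizedH.
Variable R : realType.
Implicit Types (g : gparam R) (b : block R) (s z v : R[i]) (c : R).

Definition affine (p q : R) s : R[i] := p%:C * s + q%:C.

Definition block_H b s : Hparams R :=
  let shift g := affine (gp_hat g) (gp_bar g) s in
  MkHparams (shift (bl_a1 b)) (gp_slope (bl_a1 b))
            (shift (bl_a2 b)) (gp_slope (bl_a2 b))
            (shift (bl_a3 b)) (gp_slope (bl_a3 b))
            (shift (bl_b1 b)) (gp_slope (bl_b1 b))
            (shift (bl_b2 b)) (gp_slope (bl_b2 b)).

Definition block_arg b s : R[i] :=
  cpow (affine (bl_Gamma b) (bl_gamma b) s) (affine (bl_Pi b) (bl_pi b) s).

(* h j stands for the value of the j-th H function at s *)
Definition Upsilon m (B : 'I_m -> block R) (h : 'I_m -> R[i]) s : R[i] :=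
  \prod_(j < m)
    (cpow (affine (bl_alpha (B j)) (bl_beta (B j)) s)
          (affine (bl_Lambda (B j)) (bl_Theta (B j)) s) *
     cexp (affine (bl_zeta (B j)) (bl_eta (B j)) s) *
     cpow (h j) (affine (bl_rho (B j)) (bl_sigma (B j)) s)).

(* the line Re s = c avoids the singularities of Upsilon: no base of a power
   vanishes on it, and for each s on it every H function in Upsilon has a
   separating line *)
Definition Ihat_contour m (B : 'I_m -> block R) c : Prop :=
  forall (j : 'I_m) s, Re s = c ->
    [/\ affine (bl_alpha (B j)) (bl_beta (B j)) s != 0,
        affine (bl_Gamma (B j)) (bl_gamma (B j)) s != 0
      & exists c', foxH_contour (block_H (B j) s) c'].

(* v = \hat I_m[z | B] computed along the line Re s = c *)
Definition is_Ihat m (B : 'I_m -> block R) c z v : Prop :=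
  exists h : 'I_m -> R[i] -> R[i],
    (forall j s, Re s = c ->
       is_foxH (block_H (B j) s) (block_arg (B j) s) (h j s)) /\
    is_line_integral (fun s => Upsilon B (h^~ s) s * cpow z (- s)) c v.

End GeneralizedH.

Section Probability.
Variables (R : realType) (d : measure_display) (T : measurableType d).
Variable P : probability T R.

Definition is_pdf (X : T -> R) (f : R -> R) : Prop :=
  [/\ measurable_fun setT f, forall x, 0 <= f x
    & forall A : set R, measurable A ->
        P (X @^-1` A) = (\int[lebesgue_measure]_(x in A) (f x)%:E)%E].

Definition mutually_independent n (X : 'I_n -> {RV P >-> R}) : Prop :=
  forall (J : {set 'I_n}) (A : 'I_n -> set R), (forall j, measurable (A j)) ->
    P (\bigcap_(j in [set j : 'I_n | j \in J]) (X j @^-1` A j)) =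
    (\prod_(j in J) P (X j @^-1` A j))%E.

End Probability.

Definition gengamma_pdf (R : realType) (alpha beta gamma mu x : R) : R :=
  if mu < x then
    gamma * beta `^ (alpha / gamma) / Re (cGamma (alpha / gamma)%:C) *
    (x - mu) `^ (alpha - 1) * expR (- (beta * (x - mu) `^ gamma))
  else 0.

Definition gengamma_block (R : realType) (alpha beta gamma mu : R) : block R :=
  Block
    (GParam (1 - alpha) 0 gamma) (GParam (alpha / gamma) 0 0) (GParam 1 (-1) 0)
    (GParam 0 0 1) (GParam (1 - alpha) (-1) gamma)
    (beta * mu `^ gamma) 0 1 0 0 1
    0 mu 1 0 0 0.

(* Main.v *)
Require Import Defs.
From mathcomp Require Import measurable_realfun.
From mathcomp Require Import ring lra.
Set Implicit Arguments.
Unset Strict Implicit.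
Unset Printing Implicit Defensive.

(* Each integral is a Mellin transform inverted at a point of local Lipschitz
   continuity.  Inversion reduces, after the substitution x = e^r, to the limit
   of Dirichlet integrals: a reference density with an explicit transform is
   subtracted, and the rest is handled by the Riemann-Lebesgue lemma.

   Substituting x = mu (1 + v) in E X_j^(s-1) gives K_j mu_j^s h_j(s), where
     h_j(s) = 1 / Gamma(alpha/gamma) *
       int_0^oo v^(alpha-1) (1+v)^(s-1) exp(-beta mu^gamma v^gamma) dv.
   As a function of z = beta mu^gamma, h_j(s) has by Euler's Gamma and Beta
   integrals the Mellin transform displayed in the definition of H, hence
   equals the H function.  The density of the product is the iterated
   multiplicative convolution, its Mellin transform is the product of the
   K_j mu_j^s h_j(s), and a second inversion gives the formula. *)

(** * Complex powers and integrals *)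

(** No decay of Gamma factors on vertical lines is estimated. Line integrals are symmetric limits,
    and their convergence comes from the inversion theorem itself, which asks only for absolute
    integrability of G(x) x^(c-1) and for Lipschitz regularity off one exceptional point. The
    regularity of the densities must therefore survive convolution, which is why [mdensity] has a
    Lipschitz clause. A generalized gamma density may jump or blow up at its shift, so the left end
    of the support is the excluded point; for the product it is the product of the shifts.

    Positive shifts keep the supports away from 0, so all Mellin transforms converge for Re s <= 1.
    The separating lines of the H function form the strip max(0, (Re s + alpha - 1) / gamma) < c <
    alpha / gamma, non-empty exactly when Re s < 1; hence the admissible outer lines are those with
    c < 1.

    The Beta integral brings in a division by Gamma(1 - s), so Gamma must be shown to have no zero
    in the right half-plane. Independence is given on events, so the induction on the number of
    factors carries an event of the factors still to come. *)

Section ComplexPower.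
Variable R : realType.
Implicit Types (x y a b : R) (z w : R[i]).

Lemma ReD z w : Re (z + w) = Re z + Re w.
Proof. by case: z => a b; case: w. Qed.

Lemma ImD z w : Im (z + w) = Im z + Im w.
Proof. by case: z => a b; case: w. Qed.

Lemma ReN z : Re (- z) = - Re z.
Proof. by case: z. Qed.

Lemma ImN z : Im (- z) = - Im z.
Proof. by case: z. Qed.

Lemma ReM z w : Re (z * w) = Re z * Re w - Im z * Im w.
Proof. by case: z => a b; case: w. Qed.

Lemma ImM z w : Im (z * w) = Re z * Im w + Im z * Re w.
Proof. by case: z => a b; case: w. Qed.

Definition ReImE := (ReD, ImD, ReN, ImN, ReM, ImM).

Lemma complexP z w : Re z = Re w -> Im z = Im w -> z = w.
Proof. by case: z => a b; case: w => c e /= -> ->. Qed.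

Lemma cabs_normc z : `|z| = (cabs z)%:C.
Proof. by rewrite normc_def. Qed.

Lemma cabs_ge0 z : 0 <= cabs z.
Proof. exact: sqrtr_ge0. Qed.

Lemma cabsM z w : cabs (z * w) = cabs z * cabs w.
Proof. by apply: complexI; rewrite rmorphM /= -!cabs_normc normrM. Qed.

Lemma cabs_real x : cabs x%:C = `|x|.
Proof. by rewrite /cabs /= expr0n addr0 sqrtr_sqr. Qed.

Lemma Re_le_cabs z : `|Re z| <= cabs z.
Proof. by rewrite -sqrtr_sqr ler_wsqrtr // lerDl sqr_ge0. Qed.

Lemma Im_le_cabs z : `|Im z| <= cabs z.
Proof. by rewrite -sqrtr_sqr ler_wsqrtr // lerDr sqr_ge0. Qed.

Lemma cabs_le_ReIm z : cabs z <= `|Re z| + `|Im z|.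
Proof.
rewrite -[leRHS]ger0_norm ?addr_ge0 // -sqrtr_sqr ler_wsqrtr //.
rewrite sqrrD !real_normK ?num_real // lerD2r lerDl.
by rewrite mulrn_wge0 // mulr_ge0.
Qed.

Lemma cexpD z w : cexp (z + w) = cexp z * cexp w.
Proof. by apply: complexP; rewrite !ReImE /= ReD ImD expRD ?cosD ?sinD; ring. Qed.

Lemma cexp0 : cexp 0 = 1 :> R[i].
Proof. by apply: complexP; rewrite /= expR0 ?cos0 ?sin0 ?mulr1 ?mulr0. Qed.

Lemma cexpN z : cexp (- z) * cexp z = 1.
Proof. by rewrite -cexpD addNr cexp0. Qed.

Lemma cexp_neq0 z : cexp z != 0.
Proof.
by apply/eqP => z0; have := cexpN z; rewrite z0 mulr0 => /esym/eqP; rewrite oner_eq0.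
Qed.

Lemma cexp_real x : cexp x%:C = (expR x)%:C.
Proof. by apply: complexP; rewrite /= ?cos0 ?sin0 ?mulr1 ?mulr0. Qed.

Lemma cabs_cexp z : cabs (cexp z) = expR (Re z).
Proof.
by rewrite /cabs /= !exprMn -mulrDr cos2Dsin2 mulr1 sqrtr_sqr ger0_norm // expR_ge0.
Qed.

(** The power of a positive base, free of the case distinction and of the argument function in
    [cpow]: its algebra is that of [cexp], and its measurability that of [ln]. *)
Definition rcpow x w : R[i] := cexp (w * (ln x)%:C).

Lemma cpow_real x w : 0 < x -> cpow x%:C w = rcpow x w.
Proof.
move=> x0; rewrite /cpow; have -> : (x%:C == 0) = false.
  by apply/eqP => -[/eqP]; rewrite gt_eqF.
congr (cexp (_ * _)).
by rewrite /clog cabs_real /carg lexx /= cabs_real gtr0_norm // divff ?gt_eqF // acos1.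
Qed.

Lemma rcpowD x z w : rcpow x (z + w) = rcpow x z * rcpow x w.
Proof. by rewrite /rcpow mulrDl cexpD. Qed.

Lemma rcpowM x y w : 0 < x -> 0 < y -> rcpow (x * y) w = rcpow x w * rcpow y w.
Proof. by move=> x0 y0; rewrite /rcpow lnM ?posrE // rmorphD mulrDr cexpD. Qed.

Lemma rcpow0 x : rcpow x 0 = 1.
Proof. by rewrite /rcpow mul0r cexp0. Qed.

Lemma rcpow1 x : 0 < x -> rcpow x 1 = x%:C.
Proof. by move=> x0; rewrite /rcpow mul1r cexp_real lnK. Qed.

Lemma rcpow_neq0 x w : rcpow x w != 0.
Proof. exact: cexp_neq0. Qed.

Lemma rcpowN x w : rcpow x (- w) = (rcpow x w)^-1.
Proof.
apply: (mulIf (rcpow_neq0 x w)).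
by rewrite mulVf ?rcpow_neq0 // -rcpowD addNr rcpow0.
Qed.

Lemma rcpow_real x a : 0 < x -> rcpow x a%:C = (x `^ a)%:C.
Proof. by move=> x0; rewrite /rcpow -rmorphM cexp_real /powR gt_eqF. Qed.

Lemma rcpow_powR x a w : 0 < x -> rcpow (x `^ a) w = rcpow x (a%:C * w).
Proof. by move=> x0; rewrite /rcpow ln_powR rmorphM mulrA (mulrC w). Qed.

Lemma rcpowV x w : 0 < x -> rcpow x^-1 w = rcpow x (- w).
Proof. by move=> x0; rewrite /rcpow lnV ?posrE // rmorphN mulrN mulNr. Qed.

Lemma rcpow_div x y w : 0 < x -> 0 < y -> rcpow (x / y) w = rcpow x w * rcpow y (- w).
Proof. by move=> x0 y0; rewrite rcpowM ?invr_gt0 // rcpowV. Qed.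

Lemma cabs_rcpow x w : 0 < x -> cabs (rcpow x w) = x `^ Re w.
Proof. by move=> x0; rewrite cabs_cexp /powR gt_eqF // ReM /= mulr0 subr0. Qed.

End ComplexPower.

(** * Fubini and Tonelli on rectangles *)

Section Fubini.
Variable R : realType.
Local Notation mu := (@lebesgue_measure R).
Implicit Types (D : set R).

(** Extending the kernel by 0 off the rectangle D1 x D2 reduces iterated integrals over D1 and D2 to
    iterated integrals over the whole line. *)
Let integral_patchXl D1 D2 (k : R * R -> \bar R) x :
  (\int[mu]_y (k \_ (D1 `*` D2)) (x, y) =
   ((fun x => \int[mu]_(y in D2) k (x, y)) \_ D1) x)%E.
Proof.
rewrite [RHS]/patch; case: ifPn => xD.
  by rewrite [RHS]integral_mkcond; apply: eq_integral => y _; rewrite /patch in_setX /= xD.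
by rewrite integral0_eq // => y _; rewrite /patch in_setX /= (negbTE xD).
Qed.

Let integral_patchXr D1 D2 (k : R * R -> \bar R) y :
  (\int[mu]_x (k \_ (D1 `*` D2)) (x, y) =
   ((fun y => \int[mu]_(x in D1) k (x, y)) \_ D2) y)%E.
Proof.
rewrite [RHS]/patch; case: ifPn => yD.
  rewrite [RHS]integral_mkcond; apply: eq_integral => x _.
  by rewrite /patch in_setX /= yD andbT.
by rewrite integral0_eq // => x _; rewrite /patch in_setX /= (negbTE yD) andbF.
Qed.

Let measurable_patchX D1 D2 (k : R * R -> \bar R) :
  measurable D1 -> measurable D2 -> measurable_fun setT k ->
  measurable_fun setT (k \_ (D1 `*` D2)).
Proof.
move=> mD1 mD2 mk; have := (measurable_restrictT k (measurableX mD1 mD2)).1.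
apply; exact: measurable_funTS mk.
Qed.

Lemma tonelli_on D1 D2 (k : R * R -> \bar R) :
  measurable D1 -> measurable D2 -> measurable_fun setT k ->
  (forall x y, D1 x -> D2 y -> (0 <= k (x, y))%E) ->
  (\int[mu]_(x in D1) \int[mu]_(y in D2) k (x, y) =
   \int[mu]_(y in D2) \int[mu]_(x in D1) k (x, y))%E.
Proof.
move=> mD1 mD2 mk k0.
have f0 z : (0 <= (k \_ (D1 `*` D2)) z)%E.
  by apply: erestrict_ge0 => -[x y] [] /=; exact: k0.
have := @fubini_tonelli _ _ _ _ _ mu mu _ (measurable_patchX mD1 mD2 mk) f0.
under eq_integral do rewrite integral_patchXl.
under [in X in _ = X -> _]eq_integral do rewrite integral_patchXr.
by rewrite -!integral_mkcond.
Qed.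

Lemma measurable_tonelli_on D1 D2 (k : R * R -> \bar R) :
  measurable D1 -> measurable D2 -> measurable_fun setT k ->
  (forall x y, D1 x -> D2 y -> (0 <= k (x, y))%E) ->
  measurable_fun D1 (fun x => \int[mu]_(y in D2) k (x, y))%E.
Proof.
move=> mD1 mD2 mk k0.
have f0 z : (0 <= (k \_ (D1 `*` D2)) z)%E.
  by apply: erestrict_ge0 => -[x y] [] /=; exact: k0.
have := measurable_fun_fubini_tonelli_F (m2 := mu) _ (measurable_patchX mD1 mD2 mk) f0.
rewrite /fubini_F; under eq_fun do rewrite integral_patchXl.
by move/(measurable_restrictT _ mD1).2.
Qed.

Let le_fine (x : \bar R) : (`|(fine x)%:E| <= `|x|)%E.
Proof. by case: x => //= [|]; rewrite ?leey // normr0 leey. Qed.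

(** An integrable function is finite almost everywhere, so [fine] alters it on a null set only. This
    lets the inner integral of an iterated one be the real-valued [Rintegral]. *)
Let integrable_fine D (F : R -> \bar R) : measurable D -> mu.-integrable D F ->
  mu.-integrable D (EFin \o (fine \o F)) /\
  \int[mu]_(x in D) fine (F x) = fine (\int[mu]_(x in D) F x)%E.
Proof.
move=> mD iF; have mF := measurable_int _ iF.
have mfF : measurable_fun D (EFin \o (fine \o F)).
  by apply/measurable_EFinP; exact: measurableT_comp.
split; first by apply: le_integrable iF => // x _; exact: le_fine.
congr fine; apply: ae_eq_integral => //.
move/integrable_ae : iF => /(_ mD); apply: filterS => x /= h Dx.
by rewrite fineK // h.
Qed.

Let fubini_half D1 D2 (k : R * R -> R) :
  measurable D1 -> measurable D2 -> measurable_fun setT k ->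
  (\int[mu]_(x in D1) \int[mu]_(y in D2) `|(k (x, y))%:E| < +oo)%E ->
  [/\ mu.-integrable D1 (EFin \o (fun x => \int[mu]_(y in D2) k (x, y))),
      \int[mu]_(x in D1) (\int[mu]_(y in D2) k (x, y)) =
      fine (\int[mu]_(x in D1) \int[mu]_(y in D2) (k (x, y))%:E)%E
    & (\int[mu]_(x in D1) \int[mu]_(y in D2) (k (x, y))%:E =
      \int[mu]_(y in D2) \int[mu]_(x in D1) (k (x, y))%:E)%E].
Proof.
move=> mD1 mD2 mk kfin.
have mEk : measurable_fun setT (EFin \o k) by exact/measurable_EFinP.
have mf := measurable_patchX mD1 mD2 mEk.
set f := (EFin \o k) \_ (D1 `*` D2) in mf *.
have fint : (mu \x mu)%E.-integrable setT f.
  apply: (integrable12ltyP mu mu mf).2; apply: le_lt_trans kfin.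
  rewrite [leRHS]integral_mkcond le_eqVlt; apply/orP; left; apply/eqP.
  apply: eq_integral => x _.
  rewrite -(integral_patchXl D1 D2 (fun z => `|(k z)%:E|)%E).
  by apply: eq_integral => y _; rewrite /f /patch; case: ifPn => //; rewrite abse0.
have i1 := integrable_fubini_F fint.
have E := @Fubini _ _ _ _ _ _ _ _ fint.
have {}i1 : mu.-integrable D1 (fun x => \int[mu]_(y in D2) (k (x, y))%:E)%E.
  apply/integrable_mkcond => //; apply: eq_integrable i1 => // x _.
  by rewrite /fubini_F integral_patchXl.
have [j1 e1] := integrable_fine mD1 i1.
split; [exact: j1|exact: e1|move: E].
under eq_integral do rewrite integral_patchXl.
under [in X in _ = X -> _]eq_integral do rewrite integral_patchXr.
by rewrite -!integral_mkcond.
Qed.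

Lemma Rintegral_fubini D1 D2 (k : R * R -> R) :
  measurable D1 -> measurable D2 -> measurable_fun setT k ->
  (\int[mu]_(x in D1) \int[mu]_(y in D2) `|(k (x, y))%:E| < +oo)%E ->
  [/\ mu.-integrable D1 (EFin \o (fun x => \int[mu]_(y in D2) k (x, y))),
      mu.-integrable D2 (EFin \o (fun y => \int[mu]_(x in D1) k (x, y)))
    & \int[mu]_(x in D1) (\int[mu]_(y in D2) k (x, y)) =
      \int[mu]_(y in D2) (\int[mu]_(x in D1) k (x, y))].
Proof.
move=> mD1 mD2 mk kfin.
have [i1 e1 E] := fubini_half mD1 mD2 mk kfin.
(* The statements about the other order of integration are those of [fubini_half] for the transposed
   kernel. *)
have mk' : measurable_fun setT (fun z : R * R => k (z.2, z.1)).
  by apply: measurableT_comp => //; exact: measurable_fun_pair.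
have [|i2 e2 _] := fubini_half mD2 mD1 mk'.
  apply: le_lt_trans kfin; rewrite le_eqVlt; apply/orP; left; apply/eqP/esym.
  apply: (tonelli_on (k := fun z => `|(k z)%:E|)%E) => //.
  by apply: measurableT_comp => //; exact/measurable_EFinP.
by split; [exact: i1|exact: i2|rewrite e1 E -e2].
Qed.

End Fubini.

(** * Measurability and integrals of complex-valued functions *)

Section ComplexIntegral.
Variable R : realType.
Local Notation mu := (@lebesgue_measure R).

Definition cmeasurable d (T : measurableType d) (D : set T) (f : T -> R[i]) :=
  measurable_fun D (fun x => Re (f x)) /\ measurable_fun D (fun x => Im (f x)).

Section Cmeasurable.
Context d (T : measurableType d).
Implicit Types (D : set T) (f g : T -> R[i]).

Lemma cmeasurableM D f g :
  cmeasurable D f -> cmeasurable D g -> cmeasurable D (fun x => f x * g x).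
Proof.
move=> [fR fI] [gR gI]; split.
  under eq_fun do rewrite ReM.
  by apply: measurable_funB; apply: measurable_funM.
under eq_fun do rewrite ImM.
by apply: measurable_funD; apply: measurable_funM.
Qed.

Lemma cmeasurable_real D (f : T -> R) :
  measurable_fun D f -> cmeasurable D (fun x => (f x)%:C).
Proof. by move=> mf; split=> //=; exact: measurable_cst. Qed.

Lemma cmeasurable_cst D (z : R[i]) : cmeasurable D (fun=> z).
Proof. by split; exact: measurable_cst. Qed.

Lemma cmeasurable_rcpow D (f : T -> R) (w : T -> R[i]) :
  measurable_fun D f -> cmeasurable D w -> cmeasurable D (fun x => rcpow (f x) (w x)).
Proof.
move=> mf mw.
have [mR mI] : cmeasurable D (fun x => w x * (ln (f x))%:C).
  apply: cmeasurableM => //; apply: cmeasurable_real.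
  exact: measurableT_comp (@measurable_ln R) mf.
have mE := measurableT_comp (@measurable_expR R) mR.
split; rewrite /rcpow /cexp /=; apply: measurable_funM => //.
  exact: measurableT_comp (continuous_measurable_fun (@continuous_cos R)) mI.
exact: measurableT_comp (continuous_measurable_fun (@continuous_sin R)) mI.
Qed.

Lemma cmeasurableS D E f : measurable E -> D `<=` E -> cmeasurable E f -> cmeasurable D f.
Proof. by move=> mE DE [mR mI]; split; apply: measurable_funS DE _. Qed.

End Cmeasurable.

Implicit Types (D : set R) (f g : R -> R[i]).

Lemma cintegrable_le D f (h : R -> R) : measurable D -> cmeasurable D f ->
  mu.-integrable D (EFin \o h) -> (forall x, D x -> cabs (f x) <= h x) ->
  cintegrable D f.
Proof.
move=> mD [mR mI] ih fh; split; apply: le_integrable ih => //.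
- exact/measurable_EFinP.
- move=> x Dx; rewrite !abse_EFin lee_fin; apply: le_trans (Re_le_cabs _) _.
  exact: le_trans (fh x Dx) (ler_norm _).
- exact/measurable_EFinP.
- move=> x Dx; rewrite !abse_EFin lee_fin; apply: le_trans (Im_le_cabs _) _.
  exact: le_trans (fh x Dx) (ler_norm _).
Qed.

Lemma eq_cintegral D f g : {in D, f =1 g} -> cintegral D f = cintegral D g.
Proof.
by move=> fg; congr (_ +i* _); apply: eq_Rintegral => x xD; rewrite fg.
Qed.

Lemma eq_cintegrable D f g : measurable D -> {in D, f =1 g} ->
  cintegrable D f -> cintegrable D g.
Proof.
by move=> mD fg [iR iI]; split; [apply: eq_integrable iR|apply: eq_integrable iI] => //
  x xD /=; rewrite fg.
Qed.

Lemma cintegralZl D (a : R[i]) f : measurable D -> cintegrable D f ->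
  cintegral D (fun x => a * f x) = a * cintegral D f.
Proof.
move=> mD [iR iI]; have aR b := @integrableZl _ _ _ mu D mD b _ iR.
have aI b := @integrableZl _ _ _ mu D mD b _ iI.
apply: complexP; rewrite !ReImE /=.
  under eq_Rintegral do rewrite ReM.
  rewrite (@RintegralB _ _ _ mu _ (fun x => Re a * Re (f x)) (fun x => Im a * Im (f x))) //.
  + by rewrite !RintegralZl.
  + exact: aR.
  + exact: aI.
under eq_Rintegral do rewrite ImM.
rewrite (@RintegralD _ _ _ mu _ (fun x => Re a * Im (f x)) (fun x => Im a * Re (f x))) //.
+ by rewrite !RintegralZl.
+ exact: aI.
+ exact: aR.
Qed.

Lemma cintegrableZl D (a : R[i]) f : measurable D -> cintegrable D f ->
  cintegrable D (fun x => a * f x).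
Proof.
move=> mD [iR iI]; have aR b := @integrableZl _ _ _ mu D mD b _ iR.
have aI b := @integrableZl _ _ _ mu D mD b _ iI.
split.
  apply: eq_integrable (@integrableB _ _ _ mu D mD _ _ (aR (Re a)) (aI (Im a))) => // x _.
  by rewrite /= ReM EFinB !EFinM.
apply: eq_integrable (@integrableD _ _ _ mu D mD _ _ (aI (Re a)) (aR (Im a))) => // x _.
by rewrite /= ImM EFinD !EFinM.
Qed.

Lemma cintegralZr D (a : R[i]) f : measurable D -> cintegrable D f ->
  cintegral D (fun x => f x * a) = cintegral D f * a.
Proof.
move=> mD fi; rewrite mulrC -cintegralZl //.
by apply: eq_cintegral => x _; rewrite mulrC.
Qed.

Lemma cintegral_real D (h : R -> R) :
  cintegral D (fun x => (h x)%:C) = (Rintegral mu D h)%:C.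
Proof.
by apply: complexP => //=; rewrite /Rintegral /= integral0.
Qed.

Lemma cintegral_fubini D1 D2 (k : R * R -> R[i]) :
  measurable D1 -> measurable D2 -> cmeasurable setT k ->
  (\int[mu]_(x in D1) \int[mu]_(y in D2) (cabs (k (x, y)))%:E < +oo)%E ->
  [/\ cintegrable D1 (fun x => cintegral D2 (fun y => k (x, y))),
      cintegrable D2 (fun y => cintegral D1 (fun x => k (x, y)))
    & cintegral D1 (fun x => cintegral D2 (fun y => k (x, y))) =
      cintegral D2 (fun y => cintegral D1 (fun x => k (x, y)))].
Proof.
move=> mD1 mD2 [mR mI] kfin.
have mN : measurable_fun setT (fun z => (cabs (k z))%:E).
  apply/measurable_EFinP; apply: measurableT_comp.
    exact: (continuous_measurable_fun (@sqrt_continuous R)).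
  by apply: measurable_funD; apply: measurable_funX.
(* Real and imaginary parts are both dominated by the modulus, so a single finiteness assumption
   serves both applications of the real theorem. *)
have fin (h : R * R -> R) : measurable_fun setT h ->
    (forall z, `|h z| <= cabs (k z)) ->
    (\int[mu]_(x in D1) \int[mu]_(y in D2) `|(h (x, y))%:E| < +oo)%E.
  move=> mh hk; apply: le_lt_trans kfin.
  have mhE : measurable_fun setT (fun z => `|(h z)%:E|)%E.
    by apply: measurableT_comp => //; exact/measurable_EFinP.
  have m2 (f : R * R -> \bar R) x : measurable_fun setT f ->
      measurable_fun D2 (fun y => f (x, y)).
    move=> mf; apply: measurable_funTS.
    by apply: (measurableT_comp mf); exact: measurable_fun_pair.
  apply: ge0_le_integral => //.
  - by move=> x _; exact: integral_ge0.
  - exact: (measurable_tonelli_on (k := fun z => `|(h z)%:E|)%E).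
  - apply: (measurable_tonelli_on (k := fun z => (cabs (k z))%:E)) => // x y _ _.
    by rewrite lee_fin cabs_ge0.
  - move=> x _; apply: ge0_le_integral => //.
    + exact: (m2 (fun z => `|(h z)%:E|)%E).
    + exact: (m2 (fun z => (cabs (k z))%:E)).
    + by move=> y _; rewrite abse_EFin lee_fin.
have [iR1 iR2 eR] := Rintegral_fubini mD1 mD2 mR (fin _ mR (fun z => Re_le_cabs (k z))).
have [iI1 iI2 eI] := Rintegral_fubini mD1 mD2 mI (fin _ mI (fun z => Im_le_cabs (k z))).
by split; [exact: conj iR1 iI1|exact: conj iR2 iI2|rewrite /cintegral eR eI].
Qed.

End ComplexIntegral.

(** * Mellin inversion *)

Section AffineChange.
Variable R : realType.
Local Notation mu := (@lebesgue_measure R).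
Variables (a b : R).
Hypothesis a_gt0 : 0 < a.

Let phi (x : measurableTypeR R) : measurableTypeR R := a * x + b.

Let mphi : measurable_fun setT phi.
Proof. by apply: measurable_funD => //; exact: measurable_funM. Qed.

Let phi_preimage : phi @^-1` `]b, +oo[ = `]0, +oo[%classic.
Proof.
apply/seteqP; split=> x /=; by rewrite !in_itv /= !andbT /phi ltrDr pmulr_rgt0.
Qed.

Let nu : {measure set (measurableTypeR R) -> \bar R} :=
  measure_function_pushforward__canonical__measure_function_Measure mu mphi.

(** Lebesgue measure is determined by its values on the intervals ]c, d], and on these the scaled
    pushforward under x -> a x + b is computed directly. *)
Let lebesgue_affine (A : set (measurableTypeR R)) : measurable A ->
  mscale (NngNum (ltW a_gt0)) nu A = mu A.
Proof.
move=> mA; apply/esym/lebesgue_measure_unique => // _ [[c d] _ <-].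
change (mu `]c, d] = a%:E * mu (phi @^-1` `]c, d]))%E.
have -> : phi @^-1` `]c, d] = `](c - b) / a, (d - b) / a]%classic.
  by apply/seteqP; split=> x /=; rewrite !in_itv /= ltr_pdivrMr // ler_pdivlMr //
    ltrBlDr lerBrDr mulrC.
rewrite !lebesgue_measure_itv /= !lte_fin ltr_pM2r ?invr_gt0 // ltrD2r.
case: ifPn => _; last by rewrite mule0.
by rewrite -!EFinB -EFinM; congr EFin; field; rewrite gt_eqF.
Qed.

Lemma ge0_integral_affine (F : R -> \bar R) :
  measurable_fun `]b, +oo[ F -> (forall x, (b < x)%R -> 0 <= F x)%E ->
  (a%:E * \int[mu]_(x in `]0%R, +oo[) F (a * x + b)%R = \int[mu]_(x in `]b, +oo[) F x)%E.
Proof.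
move=> mF F0.
have F0' : {in `]b, +oo[%classic, forall y, (0 <= F y)%E}.
  by move=> x; rewrite inE /= in_itv /= andbT; exact: F0.
rewrite -phi_preimage -(ge0_integral_pushforward mphi mu _ mF F0') //.
rewrite -(ge0_integral_mscale nu (measurable_itv _) (NngNum (ltW a_gt0)) mF); last first.
  by move=> x bx; apply: F0'; rewrite inE.
apply: eq_measure_integral => A mA _; exact: lebesgue_affine.
Qed.

(** A positive real factor also respects the conventional value of oo - oo, so [integral_affine] can
    treat positive and negative parts separately without any integrability assumption. *)
Let muleB_real (x y : \bar R) : (a%:E * (x - y) = a%:E * x - a%:E * y)%E.
Proof.
have a0 : (0 < a%:E)%E by rewrite lte_fin.
case: x => [x||]; case: y => [y||] //=;
  rewrite ?(gt0_muley a0) ?(gt0_muleNy a0) //=.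
by rewrite -EFinB -!EFinM mulrBr.
Qed.

Lemma integral_affine (F : R -> \bar R) : measurable_fun `]b, +oo[ F ->
  (a%:E * \int[mu]_(x in `]0%R, +oo[) F (a * x + b)%R = \int[mu]_(x in `]b, +oo[) F x)%E.
Proof.
move=> mF; rewrite [in RHS]integralE [in LHS]integralE muleB_real.
rewrite -(ge0_integral_affine (F := F^\+%E)) //; last exact: measurable_funepos.
rewrite -(ge0_integral_affine (F := F^\-%E)) //; last exact: measurable_funeneg.
rewrite -/(F \o phi) funepos_comp funeneg_comp.
by [].
Qed.

Lemma Rintegral_affine (f : R -> R) : measurable_fun `]b, +oo[ f ->
  a * \int[mu]_(x in `]0, +oo[) f (a * x + b) = \int[mu]_(x in `]b, +oo[) f x.
Proof.
move=> /measurable_EFinP mf; rewrite /Rintegral -integral_affine //.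
set x := integral _ _ _; case: x => [x||] //=; rewrite ?mulr0.
  by rewrite gt0_muley ?lte_fin.
by rewrite gt0_muleNy ?lte_fin.
Qed.

Lemma integrable_affine (F : R -> \bar R) :
  mu.-integrable `]b, +oo[ F ->
  mu.-integrable `]0, +oo[ (fun x => F (a * x + b)%R).
Proof.
move=> iF; have mF := measurable_int _ iF.
apply/integrableP; split.
  move: mF; rewrite -phi_preimage => mF; rewrite -[X in measurable_fun X]setTI.
  apply: (measurable_comp (F := `]b, +oo[) (measurable_itv _) _ mF).
    by move=> _ [x] [_ xb] <-.
  exact: measurable_funTS.
have /integrableP[_] := iF.
have mN : measurable_fun `]b, +oo[ (fun x => `|F x|)%E by apply: measurableT_comp mF.
rewrite -(ge0_integral_affine mN) //.
move=> fin; rewrite ltey; apply: contraL fin => /eqP ->.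
by rewrite gt0_muley ?lte_fin // ltxx.
Qed.

Lemma cintegrable_affine (f : R -> R[i]) :
  cintegrable `]b, +oo[ f -> cintegrable `]0, +oo[ (fun x => f (a * x + b)).
Proof. by case=> fR fI; split; [have := integrable_affine fR|have := integrable_affine fI]. Qed.

Lemma cintegral_affine (f : R -> R[i]) : cmeasurable `]b, +oo[ f ->
  a%:C * cintegral `]0, +oo[ (fun x => f (a * x + b)) = cintegral `]b, +oo[ f.
Proof.
move=> [mR mI]; apply: complexP; rewrite !ReImE /= !mul0r ?subr0 ?addr0;
  exact: Rintegral_affine.
Qed.

End AffineChange.

(** * The Riemann-Lebesgue lemma on the multiplicative half-line *)

Section RiemannLebesgue.
Variable R : realType.
Local Notation mu := (@lebesgue_measure R).
Local Notation D := (`]0%R, +oo[%classic : set R).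

Lemma integrable_mulr_bounded (A : set R) (f h : R -> R) (C : R) : measurable A ->
  mu.-integrable A (EFin \o f) -> measurable_fun A h -> (forall x, A x -> `|h x| <= C) ->
  mu.-integrable A (EFin \o (fun x => f x * h x)).
Proof.
move=> mA fi mh hC.
have mf : measurable_fun A f by apply/measurable_EFinP; exact: measurable_int fi.
have Cfi := @integrableZl _ _ _ mu A mA C _ (integrable_norm fi).
apply: le_integrable Cfi => //; first exact/measurable_EFinP/measurable_funM.
move=> x Ax; rewrite -EFinM !abse_EFin lee_fin !normrM normr_id mulrC.
by rewrite ler_wpM2r // (le_trans (hC x Ax)) // ler_norm.
Qed.

Lemma integrable_dilation (f : R -> R) (e : R) : 0 < e -> mu.-integrable D (EFin \o f) ->
  mu.-integrable D (EFin \o (fun x => e * f (e * x))).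
Proof.
move=> e0 fi; have := integrable_affine e0 fi.
move/(@integrableZl _ _ _ mu D (measurable_itv _) e).
by apply: eq_integrable => // x _; rewrite /= addr0 EFinM.
Qed.

Lemma Rintegral_dilation (f : R -> R) (e : R) : 0 < e -> mu.-integrable D (EFin \o f) ->
  \int[mu]_(x in D) (e * f (e * x)) = \int[mu]_(x in D) f x.
Proof.
move=> e0 fi; rewrite RintegralZl //.
  rewrite -[RHS](Rintegral_affine (b := 0) e0) //.
    by congr (_ * _); apply: eq_Rintegral => x _; rewrite addr0.
  by apply/measurable_EFinP; exact: measurable_int fi.
have := integrable_affine e0 fi.
by apply: eq_integrable => // x _; rewrite /= addr0.
Qed.

Variable g : R -> R.
Hypothesis ig : mu.-integrable D (EFin \o g).
Hypothesis cg : {ae mu, forall x, D x -> {for x, continuous g}}.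

(** Continuity of dilations in L^1, by Scheffe's argument. With g_n(x) = e_n g(e_n x), the function
    [h] = |g| + |g_n| - |g - g_n| lies between 0 and 2 |g| and tends to 2 |g| wherever g is
    continuous, so dominated convergence applies. As g_n has the same L^1 norm as g, the integral of
    [h] falls short of 2 times this norm by exactly the distance to be estimated. *)
Lemma cvg_dilation (e : nat -> R) : (forall n, 0 < e n) -> e n @[n --> \oo] --> (1 : R) ->
  \int[mu]_(x in D) `|g x - e n * g (e n * x)| @[n --> \oo] --> (0 : R).
Proof.
move=> e0 e1.
have mD : measurable D by exact: measurable_itv.
have ih n := integrable_dilation (e0 n) ig.
have mg : measurable_fun D g by apply/measurable_EFinP; exact: measurable_int ig.
have mh n : measurable_fun D (fun x => e n * g (e n * x)).
  by apply/measurable_EFinP; exact: measurable_int (ih n).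
pose h n x : R := `|g x| + `|e n * g (e n * x)| - `|g x - e n * g (e n * x)|.
have inorm (f : R -> R) : mu.-integrable D (EFin \o f) ->
  mu.-integrable D (EFin \o (fun x => `|f x|)) by exact: integrable_norm.
have isub n : mu.-integrable D (EFin \o (fun x => g x - e n * g (e n * x))).
  by apply: eq_integrable (@integrableB _ _ _ mu D mD _ _ ig (ih n)).
have iadd n : mu.-integrable D (EFin \o (fun x => `|g x| + `|e n * g (e n * x)|)).
  by apply: eq_integrable (@integrableD _ _ _ mu D mD _ _ (inorm _ ig) (inorm _ (ih n))).
have ihn n : mu.-integrable D (EFin \o h n).
  by apply: eq_integrable (@integrableB _ _ _ mu D mD _ _ (iadd n) (inorm _ (isub n))).
have hint n : \int[mu]_(x in D) h n x =
    2 * \int[mu]_(x in D) `|g x| - \int[mu]_(x in D) `|g x - e n * g (e n * x)|.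
  rewrite (@RintegralB _ _ _ mu D _ _ mD (iadd n) (inorm _ (isub n))).
  rewrite (@RintegralD _ _ _ mu D _ _ mD (inorm _ ig) (inorm _ (ih n))).
  congr (_ - _); rewrite mulr_natl mulr2n; congr (_ + _).
  rewrite -[RHS](Rintegral_dilation (e0 n)).
  - by apply: eq_Rintegral => x _; rewrite normrM gtr0_norm.
  - exact: inorm.
have i2g : mu.-integrable D (EFin \o (fun x => 2 * `|g x|)).
  by apply: eq_integrable (@integrableZl _ _ _ mu D mD 2 _ (inorm _ ig)).
have [] := @dominated_convergence _ _ _ mu D mD (fun n => EFin \o h n)
  (EFin \o (fun x => 2 * `|g x|)) (EFin \o (fun x => 2 * `|g x|)).
- by move=> n; exact: measurable_int (ihn n).
- exact: measurable_int i2g.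
- move: cg; apply: (@filterS _ _ (ae_filter_ringOfSetsType mu)) => x cgx Dx; apply: cvg_EFin;
  first exact: nearW.
  have ex : e n * x @[n --> \oo] --> x by rewrite -[X in _ --> X]mul1r; apply: cvgMl.
  have gx : e n * g (e n * x) @[n --> \oo] --> g x.
    rewrite -[X in _ --> X]mul1r; apply: cvgM => //.
    exact: (cvg_comp _ _ ex (cgx Dx)).
  rewrite (_ : 2 * `|g x| = `|g x| + `|g x| - `|g x - g x|); last first.
    by rewrite subrr normr0 subr0 mulr_natl mulr2n.
  apply: cvgB; first by apply: cvgD; [exact: cvg_cst|exact: cvg_norm].
  by apply: cvg_norm; apply: cvgB => //; exact: cvg_cst.
- exact: i2g.
- apply: aeW => x n Dx; rewrite abse_EFin lee_fin /h.
  have := lerB_normD (g x) (e n * g (e n * x)).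
  set p := e n * _; have p1 := ler_normB (g x) p; have p2 := ler_normB p (g x).
  rewrite (ger0_norm (x := _ + _ - _)) ?subr_ge0 //.
  have : `|p| <= `|g x - p| + `|g x|.
    by rewrite -{1}(subrK (g x) p) (le_trans (ler_normD _ _)) // distrC.
  by move=> *; lra.
move=> _ _ L.
have {}L : \int[mu]_(x in D) h n x @[n --> \oo] --> \int[mu]_(x in D) (2 * `|g x|).
  by apply: fine_cvg; rewrite fineK ?integrable_fin_num.
rewrite RintegralZl // in L; last exact: inorm.
rewrite (_ : (fun n => _) =
    (fun n => 2 * \int[mu]_(x in D) `|g x| - \int[mu]_(x in D) h n x)); last first.
  by apply/funext => n; rewrite hint opprB addrC subrK.
by rewrite -[X in _ --> X](subrr (2 * \int[mu]_(x in D) `|g x|)); apply: cvgB => //;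
  exact: cvg_cst.
Qed.

(* The dilation x -> e^(pi / T) x changes the sign of sin (T ln x). *)
Lemma riemann_lebesgue :
  \int[mu]_(x in D) (g x * sin (T * ln x)) @[T --> +oo] --> (0 : R).
Proof.
apply/cvg_pinftyP => u uoo.
have mD : measurable D by exact: measurable_itv.
pose e n := expR (pi / u n).
have e0 n : 0 < e n by exact: expR_gt0.
have p0 : pi / u n @[n --> \oo] --> (0 : R).
  rewrite -[X in _ --> X](mulr0 (pi : R)); apply: cvgMr.
  apply/(gtr0_cvgV0 _).2 => //; by move/cvgryPgt : uoo; exact.
have e1 : e n @[n --> \oo] --> (1 : R).
  by have := cvg_comp _ _ p0 (@continuous_expR R 0); rewrite expR0; exact.
have J := cvg_dilation e0 e1.
apply/norm_cvg0P; apply: (@squeeze_cvgr _ _ _ _ (fun=> 0) _ _ _ _ (cvg_cst _) J).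
have : \forall n \near \oo, 0 < u n by move/cvgryPgt : uoo; exact.
apply: filterS => n un0; rewrite normr_ge0 /=.
have ms : measurable_fun D (fun x => sin (u n * ln x)).
  apply: measurableT_comp (continuous_measurable_fun (@continuous_sin R)) _.
  by apply: measurable_funM => //; exact: measurable_funTS.
have bs (f : R -> R) : mu.-integrable D (EFin \o f) ->
    mu.-integrable D (EFin \o (fun x => f x * sin (u n * ln x))).
  by move=> fi; apply: (integrable_mulr_bounded (C := 1)) => // x _; exact: sin_max.
have igs := bs _ ig.
have ifs := bs _ (integrable_dilation (e0 n) ig).
have E : \int[mu]_(x in D) (g x * sin (u n * ln x)) =
    - \int[mu]_(x in D) (e n * g (e n * x) * sin (u n * ln x)).
  rewrite -[LHS](Rintegral_dilation (e0 n)) //.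
  rewrite -mulN1r -RintegralZl //; apply: eq_Rintegral => x; rewrite inE /= in_itv /= andbT => x0.
  have -> : u n * ln (e n * x) = u n * ln x + pi.
    by rewrite lnM ?posrE // expRK; field; rewrite gt_eqF.
  rewrite sinD cospi sinpi.
  by ring.
(* The integral equals minus its own dilated version, so twice the integral is that of a difference,
   which the L^1 distance of g to its dilation bounds. *)
have : 2 * \int[mu]_(x in D) (g x * sin (u n * ln x)) =
    \int[mu]_(x in D) ((g x - e n * g (e n * x)) * sin (u n * ln x)).
  rewrite mulr_natl mulr2n {2}E -RintegralB //.
  by apply: eq_Rintegral => x _; rewrite mulrBl.
set I := Rintegral _ _ _ => I2; set J' := Rintegral _ _ _.
have isub : mu.-integrable D (EFin \o (fun x => g x - e n * g (e n * x))).
  by apply: eq_integrable (@integrableB _ _ _ mu D mD _ _ ig (integrable_dilation (e0 n) ig)).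
have : `|2 * I| <= J'.
  rewrite I2; apply: le_trans (@le_normr_Rintegral _ _ _ mu D _ mD (bs _ isub)) _.
  apply: le_Rintegral => //; [exact: integrable_norm (bs _ isub)|exact: integrable_norm isub|].
  by move=> x _; rewrite normrM ler_piMr // sin_max.
by apply: le_trans; rewrite normrM ler_peMl // ger0_norm // ler1n.
Qed.

End RiemannLebesgue.

(** * The measure dx / x and its invariance under inversion *)

Section HaarInversion.
Variable R : realType.
Local Notation mu := (@lebesgue_measure R).
Local Notation D := (`]0%R, +oo[%classic : set R).

(* The inverse is not continuous at 0; as 0^-1 = 0, x^-1 = x exp(- 2 ln |x|)
   holds everywhere. *)
Lemma measurable_inv d (T : measurableType d) (A : set T) (f : T -> R) :
  measurable_fun A f -> measurable_fun A (fun x => (f x)^-1).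
Proof.
move=> mf; have E x : x^-1 = x * expR (- (ln `|x| + ln `|x|)) :> R.
  have [->|x0] := eqVneq x 0; first by rewrite invr0 mul0r.
  rewrite expRN expRD lnK ?posrE ?normr_gt0 // -expr2 real_normK ?num_real //.
  by rewrite expr2 invfM mulVKf.
under eq_fun do rewrite E.
apply: measurable_funM => //; apply: measurableT_comp => //.
by apply: measurableT_comp => //; apply: measurable_funD; apply: measurableT_comp => //;
  apply: measurableT_comp.
Qed.

Let H (F : R -> \bar R) := (\int[mu]_(x in D) ((x^-1)%:E * F x))%E.

Let mD : measurable D. Proof. exact: measurable_itv. Qed.

Let Dpos x : D x -> 0 < x. Proof. by rewrite /= in_itv /= andbT. Qed.

Let mVF (F : R -> \bar R) : measurable_fun setT F ->
  measurable_fun setT (fun x : R => (x^-1)%:E * F x)%E.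
Proof.
by move=> mF; apply: emeasurable_funM => //; apply/measurable_EFinP; exact: measurable_inv.
Qed.

Lemma haar_scale (F : R -> \bar R) (k : R) : 0 < k -> measurable_fun setT F ->
  (forall x, 0 <= F x)%E ->
  (\int[mu]_(x in D) ((x^-1)%:E * F (k * x)%R) = \int[mu]_(x in D) ((x^-1)%:E * F x))%E.
Proof.
move=> k0 mF F0.
rewrite -(ge0_integral_affine (a := k) (b := 0) k0 (F := fun x => (x^-1)%:E * F x)%E).
- rewrite -ge0_integralZl_EFin //.
  + by apply: eq_integral => x xD; rewrite addr0 muleA -EFinM invfM mulVKf ?gt_eqF.
  + by move=> x /Dpos x0; rewrite mule_ge0 // lee_fin addr0 invr_ge0 mulr_ge0 // ltW.
  + apply: measurable_funTS; apply: (measurableT_comp (mVF mF)).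
    by apply: measurable_funD => //; exact: measurable_funM.
  + exact: ltW.
- exact: measurable_funTS (mVF mF).
- by move=> x x0; rewrite mule_ge0 // lee_fin invr_ge0 ltW.
Qed.

(* Uniqueness of the Haar measure dx / x: the integral is paired with that of the
   indicator of [1, 2] by Tonelli, so that only dilations are substituted. *)
Lemma haar_inv (F : R -> \bar R) : measurable_fun setT F -> (forall x, 0 <= F x)%E ->
  (\int[mu]_(x in D) ((x^-1)%:E * F (x^-1)%R) = \int[mu]_(x in D) ((x^-1)%:E * F x))%E.
Proof.
move=> mF F0.
pose G (x : R) : \bar R := (\1_(`[1, 2] : set R) x)%:E.
have mG : measurable_fun setT G by apply/measurable_EFinP; exact: measurable_indic.
have G0 x : (0 <= G x)%E by rewrite lee_fin.
have mVx x : measurable_fun setT (fun w : R => ((w^-1)%:E * G (x * w)%R)%E).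
  apply: emeasurable_funM; first by apply/measurable_EFinP; exact: measurable_inv.
  by apply: (measurableT_comp mG); exact: measurable_funM.
have V0 x : D x -> (0 <= (x^-1)%:E :> \bar R)%E.
  by move=> /Dpos x0; rewrite lee_fin invr_ge0 ltW.
have IG : (\int[mu]_(x in D) G x = 1)%E.
  rewrite integral_indic // (_ : `[1, 2]%classic `&` D = `[1, 2]%classic).
    change (mu (`[1%R, 2%R]%classic : set R) = 1)%E.
    by rewrite lebesgue_measure_itv /= lte_fin ltr1n -EFinB; congr EFin; ring.
  apply/seteqP; split=> x /=; first by case.
  by rewrite !in_itv /= andbT => x12; split=> //; lra.
(* On [1, 2] the weight 1 / x lies between 1 / 2 and 1; hence [c] is positive and finite and can be
   cancelled at the end. *)
have [c c0 HG] : exists2 c, 0 < c & H G = c%:E.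
  have H1 : (H G <= 1)%E.
    rewrite -IG; apply: ge0_le_integral => //.
    - by move=> x Dx; rewrite mule_ge0 ?V0.
    - exact: measurable_funTS (mVF mG).
    - exact: measurable_funTS.
    - move=> x Dx; rewrite /G indicE -EFinM lee_fin.
      case: (boolP (x \in _)) => [|_]; last by rewrite mulr0.
      by rewrite inE /= in_itv /= mulr1 => /andP[x1 _]; rewrite invf_le1 // Dpos.
  have H2 : ((2^-1)%:E <= H G)%E.
    rewrite -[leLHS]mule1 -IG -ge0_integralZl_EFin //; last exact: measurable_funTS.
    apply: ge0_le_integral => //.
    - by move=> x Dx; rewrite mule_ge0 // lee_fin.
    - by apply: measurable_funTS; apply: emeasurable_funM.
    - exact: measurable_funTS (mVF mG).
    - move=> x Dx; rewrite /G indicE -!EFinM lee_fin.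
      case: (boolP (x \in _)) => [|_]; last by rewrite !mulr0.
      rewrite inE /= in_itv /= !mulr1 => /andP[x1 x2].
      by rewrite lef_pV2 ?posrE // Dpos.
  move: H1 H2; case: (H G) => [r||] //; rewrite !lee_fin => _ r2.
  by exists r => //; apply: lt_le_trans r2.
suff : (H (fun x => F (x^-1)%R) * H G = H F * H G)%E.
  move/(congr1 (fun z => z * (c^-1)%:E)%E).
  by rewrite HG -!muleA -EFinM mulfV ?gt_eqF // !mule1.
(* For each x, dilation invariance replaces the constant H G by the integral of G(x w) in dw / w,
   which couples the two variables. *)
transitivity (\int[mu]_(x in D) \int[mu]_(w in D)
    ((x^-1)%:E * F (x^-1)%R * ((w^-1)%:E * G (x * w)%R)))%E.
  rewrite -ge0_integralZr //; last 3 first.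
  - by apply: measurable_funTS; apply: mVF; apply: (measurableT_comp mF); exact: measurable_inv.
  - by move=> x Dx; rewrite mule_ge0 ?V0.
  - by rewrite HG lee_fin ltW.
  apply: eq_integral => x; rewrite inE => Dx.
  rewrite ge0_integralZl //; last 3 first.
  - exact: measurable_funTS (mVx x).
  - by move=> w Dw; rewrite mule_ge0 ?V0.
  - by rewrite mule_ge0 ?V0.
  by congr (_ * _)%E; rewrite haar_scale // Dpos.
rewrite (tonelli_on (k := fun z => ((z.1^-1)%:E * F (z.1^-1)%R * ((z.2^-1)%:E * G (z.1 * z.2)%R)))%E) //=; last 2 first.
- apply: emeasurable_funM; apply: emeasurable_funM.
  + by apply/measurable_EFinP; exact: measurable_inv.
  + by apply: (measurableT_comp mF); exact: measurable_inv.
  + by apply/measurable_EFinP; exact: measurable_inv.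
  + by apply: (measurableT_comp mG); exact: measurable_funM.
- by move=> x w Dx Dw; rewrite !mule_ge0 ?V0.
(* For fixed w, replacing x by x / w frees G from w and turns F(1 / x) into F(w / x). After the
   orders are exchanged once more, the integral in w is a mere dilation and gives H F. *)
transitivity (\int[mu]_(w in D) \int[mu]_(x in D)
    ((w^-1)%:E * F (w / x)%R * ((x^-1)%:E * G x)))%E.
  apply: eq_integral => w; rewrite inE => Dw; have w0 := Dpos Dw.
  transitivity ((w^-1)%:E * \int[mu]_(x in D) ((x^-1)%:E * (F (x^-1)%R * G (x * w)%R)))%E.
    rewrite -ge0_integralZl //; last 3 first.
    + apply: measurable_funTS; apply: mVF; apply: emeasurable_funM.
        by apply: (measurableT_comp mF); exact: measurable_inv.
      by apply: (measurableT_comp mG); exact: measurable_funM.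
    + by move=> x Dx; rewrite !mule_ge0 ?V0.
    + exact: V0.
    by apply: eq_integral => x _; rewrite !muleA; congr (_ * _)%E; rewrite -muleA muleC.
  rewrite -(@haar_scale (fun x => F (x^-1)%R * G (x * w)%R)%E (w^-1)%R); last 3 first.
  - by rewrite invr_gt0.
  - apply: emeasurable_funM.
      by apply: (measurableT_comp mF); exact: measurable_inv.
    by apply: (measurableT_comp mG); exact: measurable_funM.
  - by move=> x; rewrite mule_ge0.
  rewrite -ge0_integralZl //; last 3 first.
  - apply: measurable_funTS; apply: mVF; apply: emeasurable_funM.
      by apply: (measurableT_comp mF); apply: measurable_inv; exact: measurable_funM.
    by apply: (measurableT_comp mG); apply: measurable_funM => //; exact: measurable_funM.
  - by move=> x Dx; rewrite !mule_ge0 ?V0.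
  - exact: V0.
  apply: eq_integral => x _; rewrite invfM invrK mulrAC mulVf ?gt_eqF // mul1r.
  by rewrite !muleA; congr (_ * _)%E; rewrite -!muleA; congr (_ * _)%E; rewrite muleC.
rewrite (tonelli_on (k := fun z => ((z.1^-1)%:E * F (z.1 / z.2)%R * ((z.2^-1)%:E * G z.2)))%E) //=; last 2 first.
- apply: emeasurable_funM; apply: emeasurable_funM.
  + by apply/measurable_EFinP; exact: measurable_inv.
  + by apply: (measurableT_comp mF); apply: measurable_funM => //; exact: measurable_inv.
  + by apply/measurable_EFinP; exact: measurable_inv.
  + exact: measurableT_comp.
- by move=> x w Dx Dw; rewrite !mule_ge0 ?V0.
rewrite -ge0_integralZl //; last 3 first.
- exact: measurable_funTS (mVF mG).
- by move=> x Dx; rewrite mule_ge0 ?V0.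
- by apply: integral_ge0 => x Dx; rewrite mule_ge0 ?V0.
apply: eq_integral => x; rewrite inE => Dx; have x0 := Dpos Dx.
rewrite ge0_integralZr //; last 3 first.
- apply: measurable_funTS; apply: mVF; apply: (measurableT_comp mF).
  by apply: measurable_funM.
- by move=> w Dw; rewrite mule_ge0 ?V0.
- by rewrite mule_ge0 ?V0.
congr (_ * _)%E; rewrite -[RHS](@haar_scale F (x^-1)%R) ?invr_gt0 //.
by apply: eq_integral => w _; rewrite mulrC.
Qed.

End HaarInversion.

Section DeriveRules.
Variable R : realType.
Implicit Types (f g : R -> R) (x a b c : R).

(** These rules are stated on explicit abstractions and ordinary products, so that the derivative of
    a concrete function is built as a term and brought to the desired form by [isd_eq]. *)
Lemma isd_cst x c : is_derive x 1 (fun=> c) 0.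
Proof. exact: is_derive_cst. Qed.

Lemma isd_id x : is_derive x 1 (fun x => x) 1.
Proof. exact: is_derive_id. Qed.

Lemma isdD f g x a b : is_derive x 1 f a -> is_derive x 1 g b ->
  is_derive x 1 (fun x => f x + g x) (a + b).
Proof. by move=> df dg; exact: is_deriveD. Qed.

Lemma isdB f g x a b : is_derive x 1 f a -> is_derive x 1 g b ->
  is_derive x 1 (fun x => f x - g x) (a - b).
Proof. by move=> df dg; exact: is_deriveB. Qed.

Lemma isdM f g x a b : is_derive x 1 f a -> is_derive x 1 g b ->
  is_derive x 1 (fun x => f x * g x) (a * g x + f x * b).
Proof.
move=> df dg; have := is_deriveM df dg.
by rewrite /GRing.scale /= addrC (mulrC a).
Qed.

Lemma isdMl f x a c : is_derive x 1 f a -> is_derive x 1 (fun x => c * f x) (c * a).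
Proof. by move=> df; have := isdM (isd_cst x c) df; rewrite mul0r add0r. Qed.

Lemma isd_comp f g x a b : is_derive (g x) 1 f a -> is_derive x 1 g b ->
  is_derive x 1 (fun x => f (g x)) (a * b).
Proof. by move=> df dg; exact: (@is_derive1_comp _ f g). Qed.

Lemma isd_inv x : x != 0 -> is_derive x 1 (fun x => x^-1) (- x ^- 2).
Proof. by move=> x0; have := is_deriveV x0 (isd_id x); rewrite /GRing.scale /= mulr1. Qed.

Lemma isd_sin g x b : is_derive x 1 g b ->
  is_derive x 1 (fun x => sin (g x)) (cos (g x) * b).
Proof. exact: isd_comp. Qed.

Lemma isd_cos g x b : is_derive x 1 g b ->
  is_derive x 1 (fun x => cos (g x)) (- sin (g x) * b).
Proof. exact: isd_comp. Qed.

Lemma isd_expR g x b : is_derive x 1 g b ->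
  is_derive x 1 (fun x => expR (g x)) (expR (g x) * b).
Proof. exact: isd_comp. Qed.

Lemma isd_continuous f x a : is_derive x 1 f a -> {for x, continuous f}.
Proof. by case=> /derivable1_diffP df _; exact: differentiable_continuous. Qed.

Lemma isd_eq f x a b : is_derive x 1 f a -> a = b -> is_derive x 1 f b.
Proof. by move=> df <-. Qed.

End DeriveRules.

(** * The reference density and its cosine transform *)

Section FourierReference.
Variable R : realType.
Local Notation mu := (@lebesgue_measure R).
Local Notation D := (`]0%R, +oo[%classic : set R).
Implicit Types (x y l T : R).

(** An antiderivative of [f y]. The 1 added to the cosine makes the integrand non-negative, as the
    fundamental theorem on a half-line requires; [fourier_laplace_ref] removes its contribution by
    comparison with the case y = 0. *)
Let F y x : R := x^-1 * ((y * sin (y * ln x) - cos (y * ln x)) * (1 + y ^+ 2)^-1 - 1).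
Let f y x : R := x ^- 2 * (1 + cos (y * ln x)).

Let y2_neq0 y : 1 + y ^+ 2 != 0 :> R.
Proof. by rewrite gt_eqF // ltr_pwDl // sqr_ge0. Qed.

Let dF y x : 0 < x -> is_derive x 1 (F y) (f y x).
Proof.
move=> x0; have xn : x != 0 by rewrite gt_eqF.
have dl := isdMl y (is_derive1_ln x0).
have ds := isd_sin dl.
have dc := isd_cos dl.
have d1 := isdM (isdB (isdMl y ds) dc) (isd_cst x (1 + y ^+ 2)^-1).
apply: isd_eq (isdM (isd_inv xn) (isdB d1 (isd_cst x 1))) _; rewrite /f; have := y2_neq0 y => yn.
by field; rewrite xn yn.
Qed.

Let f_ge0 y x : 0 <= f y x.
Proof.
by rewrite mulr_ge0 ?invr_ge0 ?sqr_ge0.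
Qed.

Let cvF y : F y x @[x --> +oo] --> (0 : R).
Proof.
pose C : R := (`|y| + 1) * (1 + y ^+ 2)^-1 + 1.
have gt0 : \forall x \near +oo%R, 0 < x :> R by exact: nbhs_pinfty_gt.
have V : x^-1 @[x --> +oo] --> (0 : R) by apply: (gtr0_cvgV0 (f := id) gt0).2; exact: cvg_id.
apply/norm_cvg0P.
have VC : x^-1 * C @[x --> +oo] --> (0 : R).
  by rewrite -[X in _ --> X](mul0r C); apply: cvgMl.
apply: (@squeeze_cvgr _ _ _ _ (fun=> 0) _ _ _ _ (cvg_cst _) VC).
move: gt0; apply: filterS => x x0; rewrite normr_ge0 /= normrM.
have vx : 0 < x^-1 by rewrite invr_gt0.
rewrite (gtr0_norm vx) ler_pM2l // /C.
apply: le_trans (ler_normB _ _) _; rewrite normr1 lerD2r normrM.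
have y0 : 0 < 1 + y ^+ 2 by rewrite ltr_pwDl // sqr_ge0.
rewrite (@gtr0_norm _ (1 + y ^+ 2)^-1) ?invr_gt0 // ler_pM2r ?invr_gt0 //.
apply: le_trans (ler_normB _ _) _; apply: lerD; last exact: cos_max.
by rewrite normrM ler_piMr // sin_max.
Qed.

Let int_f y : (\int[mu]_(x in `[1%R, +oo[) (f y x)%:E = (1 + (1 + y ^+ 2)^-1)%:E)%E.
Proof.
have dF1 x : 1 <= x -> is_derive x 1 (F y) (f y x).
  by move=> x1; apply: dF; apply: lt_le_trans x1.
rewrite (ge0_continuous_FTC2y (F := F y) (l := 0)) //.
- rewrite -EFinB; congr EFin; rewrite /F ln1 mulr0 sin0 cos0 invr1.
  by have := y2_neq0 y => yn; field.
- apply: derivable_within_continuous => x; rewrite in_itv /= andbT => x1.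
  have x0 : 0 < x by apply: lt_le_trans x1.
  have xn : x != 0 by rewrite gt_eqF.
  have dl := isd_cos (isdMl y (is_derive1_ln x0)).
  have x2n : x * x != 0 by rewrite mulf_neq0.
  have d2 := @is_deriveV _ (fun x => x * x) _ _ _ x2n (isdM (isd_id x) (isd_id x)).
  have [d _] := isdM d2 (isdD (isd_cst x 1) dl).
  exact: d.
- by move=> x /ltW /dF1 [].
- by apply: cvg_at_right_filter; exact: isd_continuous (dF1 _ (lexx _)).
- move=> x; rewrite in_itv /= andbT => /ltW x1; rewrite derive1E.
  by have [_ ->] := dF1 x x1.
Qed.

(* The log-scale Laplace density [e^{-|r|}] at [x = e^r], divided by [x]. *)
Definition laplace_ref x : R := (Num.max 1 x) ^- 2.

Lemma measurable_laplace_ref : measurable_fun setT laplace_ref.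
Proof.
by apply: measurable_inv; apply: measurable_funX; apply: measurable_maxr.
Qed.

Let measurable_cos_ln y : measurable_fun [set: R] (fun x => cos (y * ln x)).
Proof.
apply: measurableT_comp (continuous_measurable_fun (@continuous_cos R)) _.
exact: measurable_funM.
Qed.

Let measurable_1cos y : measurable_fun [set: R] (fun x => 1 + cos (y * ln x)).
Proof. exact: measurable_funD. Qed.

Let int_ref_ge0 y : (\int[mu]_(x in D) (laplace_ref x * (1 + cos (y * ln x)))%:E =
  (2 * (1 + (1 + y ^+ 2)^-1))%:E)%E.
Proof.
have mc := measurable_1cos y.
have c0 x : 0 <= 1 + cos (y * ln x) by have := cos_geN1 (y * ln x); lra.
have ref0 x : 0 <= laplace_ref x by rewrite invr_ge0 sqr_ge0.
have DU : D = `]0, 1[%classic `|` `[1, +oo[%classic.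
  apply/seteqP; split=> x /=; rewrite !in_itv /= !andbT.
    by move=> x0; have [x1|x1] := ltP x 1; [left; rewrite x0|right].
  by move=> [/andP[]//|]; exact: lt_le_trans.
rewrite DU ge0_integral_setU //; last 3 first.
- apply: measurable_funTS; apply/measurable_EFinP; apply: measurable_funM => //.
  exact: measurable_laplace_ref.
- by move=> x _; rewrite lee_fin mulr_ge0.
- apply/disj_setPS => x [] /=; rewrite !in_itv /= => /andP[_ x1].
  by rewrite andbT leNgt x1.
have E2 : (\int[mu]_(x in `[1%R, +oo[) (laplace_ref x * (1 + cos (y * ln x)))%:E =
    \int[mu]_(x in `[1%R, +oo[) (f y x)%:E)%E.
  apply: eq_integral => x; rewrite inE /= in_itv /= andbT => x1.
  by rewrite /laplace_ref max_r.
(* In dx / x the reference density has weight e^(-|ln x|), and the cosine is even in ln x: inversion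
   x -> 1 / x carries the part over ]0, 1[ to the part over ]1, oo[. *)
suff -> : (\int[mu]_(x in `]0%R, 1%R[) (laplace_ref x * (1 + cos (y * ln x)))%:E =
    \int[mu]_(x in `]1%R, +oo[) (f y x)%:E)%E.
  rewrite E2 integral_itv_obnd_cbnd; last first.
    apply: measurable_funTS; apply/measurable_EFinP; apply: measurable_funM => //.
    by apply: measurable_inv; apply: measurable_funX.
  by rewrite int_f -EFinD; congr EFin; ring.
pose G x : \bar R := (\1_(`]0, 1[%classic : set R) x * (x * (1 + cos (y * ln x))))%:E.
have mG : measurable_fun setT G.
  apply/measurable_EFinP; apply: measurable_funM; first exact: measurable_indic.
  exact: measurable_funM.
have G0 x : (0 <= G x)%E.
  rewrite lee_fin indicE; case: (boolP (x \in _)) => [|_]; last by rewrite mul0r.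
  by rewrite inE /= in_itv /= => /andP[x0 _]; rewrite mul1r mulr_ge0 // ltW.
transitivity (\int[mu]_(x in D) ((x^-1)%:E * G x))%E.
  rewrite [LHS]integral_mkcond [RHS]integral_mkcond; apply: eq_integral => x _.
  rewrite /patch /G indicE !mem_setE !in_itv /= andbT.
  have [x0|x0] //= := ltP 0 x; have [x1|x1] /= := ltP x 1; last by rewrite mul0r mule0.
  rewrite -EFinM mul1r mulKf ?gt_eqF // /laplace_ref max_l ?ltW //.
  by rewrite expr1n invr1 mul1r.
rewrite -haar_inv // [LHS]integral_mkcond [RHS]integral_mkcond; apply: eq_integral => x _.
rewrite /patch /G indicE !mem_setE !in_itv /= !andbT.
have [x0|x0] := ltP 0 x; last by rewrite ltNge (le_trans x0).
rewrite invr_gt0 x0 invf_lt1 //=; case: ifPn => _; last by rewrite mul0r mule0.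
by rewrite -EFinM mul1r mulrA -invfM lnV ?posrE // mulrN cosN.
Qed.

Lemma integrable_laplace_ref : mu.-integrable D (EFin \o laplace_ref).
Proof.
apply/integrableP; split.
  by apply/measurable_EFinP; exact: measurable_funTS measurable_laplace_ref.
have : (\int[mu]_(x in D) (laplace_ref x * (1 + cos (0 * ln x)))%:E < +oo)%E.
  by rewrite int_ref_ge0 ltry.
apply: le_lt_trans; apply: ge0_le_integral => //.
- apply: measurableT_comp => //; apply/measurable_EFinP.
  exact: measurable_funTS measurable_laplace_ref.
- apply/measurable_EFinP; apply: measurable_funTS.
  by apply: measurable_funM; [exact: measurable_laplace_ref|exact: measurable_1cos].
- move=> x _; have ref0 : 0 <= laplace_ref x by rewrite invr_ge0 sqr_ge0.
  by rewrite /= lee_fin ger0_norm // mul0r cos0 ler_peMr // lerDl.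
Qed.

Lemma fourier_laplace_ref y :
  \int[mu]_(x in D) (laplace_ref x * cos (y * ln x)) = 2 * (1 + y ^+ 2)^-1.
Proof.
have mD : measurable D by exact: measurable_itv.
have ic z : mu.-integrable D (EFin \o (fun x => laplace_ref x * cos (z * ln x))).
  apply: (integrable_mulr_bounded (C := 1)) => //; first exact: integrable_laplace_ref.
    exact: measurable_funTS.
  by move=> x _; exact: cos_max.
have E z : \int[mu]_(x in D) laplace_ref x + \int[mu]_(x in D) (laplace_ref x * cos (z * ln x)) =
    2 * (1 + (1 + z ^+ 2)^-1).
  rewrite -(@RintegralD _ _ _ mu D _ _ mD integrable_laplace_ref (ic z)).
  under eq_Rintegral do rewrite -[X in X + _]mulr1 -mulrDr.
  by rewrite /Rintegral int_ref_ge0.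
have aux (a b c : R) : a + b = 2 * (1 + c) -> a + a = 2 * (1 + 1) -> b = 2 * c.
  by move=> *; lra.
apply: aux (E y) _; have := E 0; under [X in _ + X]eq_Rintegral do rewrite mul0r cos0 mulr1.
by rewrite expr0n addr0 invr1.
Qed.

End FourierReference.

(** * Limits of Dirichlet integrals *)

Section Dirichlet.
Variable R : realType.
Local Notation mu := (@lebesgue_measure R).
Local Notation D := (`]0%R, +oo[%classic : set R).
Implicit Types (x y l T : R).

Let mD : measurable D. Proof. exact: measurable_itv. Qed.

Let ftc (f F : R -> R) T : 0 < T -> (forall y, is_derive y 1 F (f y)) ->
  continuous f -> \int[mu]_(y in `[- T, T]) f y = F T - F (- T).
Proof.
move=> T0 dF cf; rewrite /Rintegral (continuous_FTC2 (F := F)) //.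
- by lra.
- exact: continuous_subspaceT.
- have cF x : {for x, continuous F} by exact: isd_continuous (dF x).
  split; first by move=> x _; case: (dF x).
  + by apply: cvg_at_right_filter; exact: cF.
  + by apply: cvg_at_left_filter; exact: cF.
- by move=> x _; rewrite derive1E; have [_ ->] := dF x.
Qed.

Lemma Rintegral_cos_sym l T : 0 < T -> l != 0 ->
  \int[mu]_(y in `[- T, T]) cos (y * l) = sin (T * l) * (2 / l).
Proof.
move=> T0 l0.
have dF y : is_derive y 1 (fun y => sin (y * l) * l^-1) (cos (y * l)).
  apply: isd_eq (isdM (isd_sin (isdM (isd_id y) (isd_cst y l))) (isd_cst y l^-1)) _.
  by field.
rewrite (ftc T0 dF); first by rewrite mulNr sinN; field.
by move=> y; exact: isd_continuous (isd_cos (isdM (isd_id y) (isd_cst y l))).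
Qed.

Lemma Rintegral_sin_sym l T : 0 < T -> \int[mu]_(y in `[- T, T]) sin (y * l) = 0.
Proof.
move=> T0; have [->|l0] := eqVneq l 0.
  under eq_Rintegral do rewrite mulr0 sin0.
  by rewrite /Rintegral integral0.
have dF y : is_derive y 1 (fun y => -1 * cos (y * l) * l^-1) (sin (y * l)).
  apply: isd_eq (isdM (isdMl (-1) (isd_cos (isdM (isd_id y) (isd_cst y l)))) (isd_cst y l^-1)) _.
  by field.
rewrite (ftc T0 dF); first by rewrite (mulNr T) cosN; ring.
by move=> y; exact: isd_continuous (isd_sin (isdM (isd_id y) (isd_cst y l))).
Qed.

Lemma Rintegral_cauchy_sym T : 0 < T ->
  \int[mu]_(y in `[- T, T]) (2 * (1 + y ^+ 2)^-1) = 4 * atan T.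
Proof.
move=> T0.
have dF y : is_derive y 1 (fun y => 2 * atan y) (2 * (1 + y ^+ 2)^-1).
  exact: isdMl (is_derive1_atan y).
rewrite (ftc T0 dF); first by rewrite atanN; ring.
move=> y; have y2 : 1 + y * y != 0 by rewrite gt_eqF // ltr_pwDl // -expr2 sqr_ge0.
exact: isd_continuous (isdMl 2 (@is_deriveV _ (fun y => 1 + y * y) _ _ _ y2
  (isdD (isd_cst y 1) (isdM (isd_id y) (isd_id y))))).
Qed.

Let m_cos2 : measurable_fun setT (fun z : R * R => cos (z.2 * ln z.1)).
Proof.
apply: measurableT_comp (continuous_measurable_fun (@continuous_cos R)) _.
by apply: measurable_funM => //; exact: measurableT_comp.
Qed.

Let mu_itv_lty T : (mu `[(- T)%R, T]%classic < +oo)%E.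
Proof. by rewrite lebesgue_measure_itv /=; case: ifPn => _; rewrite ?ltry // -EFinB ltry. Qed.

(** Supplies the finiteness hypothesis of Fubini for truncated line integrals: the majorant depends
    on x only, and the interval of y has finite length. *)
Lemma kernel_fin (b : R -> R) (k : R * R -> R) T : mu.-integrable D (EFin \o b) ->
  measurable_fun setT k -> (forall x y, D x -> 0 <= k (x, y) <= b x) ->
  (\int[mu]_(x in D) \int[mu]_(y in `[(- T)%R, T]) (k (x, y))%:E < +oo)%E.
Proof.
move=> ib mk kb; have mT : measurable (`[- T, T]%classic : set R) by exact: measurable_itv.
have b0 x : D x -> 0 <= b x.
  by move=> Dx; case/andP: (kb x 0 Dx); exact: le_trans.
have mb : measurable_fun D b by apply/measurable_EFinP; exact: measurable_int ib.
have : (\int[mu]_(x in D) ((b x)%:E * mu `[(- T)%R, T]%classic) < +oo)%E;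
  last (apply: le_lt_trans).
  rewrite ge0_integralZr //; [|exact/measurable_EFinP].
  have : (\int[mu]_(x in D) (b x)%:E < +oo)%E.
    have /integrableP[_] := ib; apply: le_lt_trans; apply: ge0_le_integral => //.
    - exact/measurable_EFinP.
    - by apply: measurableT_comp => //; exact/measurable_EFinP.
    - by move=> x Dx /=; rewrite lee_fin ler_norm.
  move=> bfin; apply: lte_mul_pinfty => //; first by apply: integral_ge0 => x Dx;
    rewrite lee_fin b0.
    by rewrite ge0_fin_numE // integral_ge0 // => x Dx; rewrite lee_fin b0.
apply: ge0_le_integral => //.
- by move=> x Dx; apply: integral_ge0 => y _; rewrite lee_fin; case/andP: (kb x y Dx).
- have mk' : measurable_fun setT (EFin \o k) by exact/measurable_EFinP.
  apply: (measurable_tonelli_on mD mT mk') => x y Dx _.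
  by rewrite lee_fin; case/andP: (kb x y Dx).
- by apply: emeasurable_funM => //; exact/measurable_EFinP.
- move=> x Dx; rewrite -integral_cst //; apply: ge0_le_integral => //.
  + by move=> y _; rewrite lee_fin; case/andP: (kb x y Dx).
  + apply/measurable_EFinP; apply: measurable_funTS; apply: (measurableT_comp mk).
    exact: measurable_fun_pair.
  + by move=> y _; rewrite lee_fin; case/andP: (kb x y Dx).
Qed.

(** For x != 1 and T > 0 this is 2 sin(T ln x) / ln x, the Dirichlet kernel in the variable ln x.
    The integral form is also meaningful at x = 1 and is what Fubini produces. *)
Definition dirichlet T x : R := \int[mu]_(y in `[- T, T]) cos (y * ln x).

Section DirichletFubini.
Variable g : R -> R.
Hypotheses (mg : measurable_fun setT g) (ig : mu.-integrable D (EFin \o g)).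

Let mk : measurable_fun setT (fun z : R * R => g z.1 * cos (z.2 * ln z.1)).
Proof. by apply: measurable_funM => //; exact: measurableT_comp. Qed.

Let Rcos_int T x : mu.-integrable `[- T, T] (EFin \o (fun y => cos (y * ln x))).
Proof.
apply: measurable_bounded_integrable => //.
- exact: mu_itv_lty.
- apply: measurable_funTS; apply: continuous_measurable_fun => y.
  exact: isd_continuous (isd_cos (isdM (isd_id y) (isd_cst y _))).
- exists 1; split; first exact: num_real.
  by move=> M M1 y _ /=; rewrite (le_trans (cos_max _)) // ltW.
Qed.

Lemma dirichlet_fubini T :
  [/\ mu.-integrable D (EFin \o (fun x => g x * dirichlet T x)),
      mu.-integrable `[- T, T]
        (EFin \o (fun y => \int[mu]_(x in D) (g x * cos (y * ln x))))
    & \int[mu]_(x in D) (g x * dirichlet T x) =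
      \int[mu]_(y in `[- T, T]) \int[mu]_(x in D) (g x * cos (y * ln x))].
Proof.
have mT : measurable (`[- T, T]%classic : set R) by exact: measurable_itv.
have [|i1 i2 e] := Rintegral_fubini mD mT mk.
  apply: (kernel_fin (b := fun x => `|g x|) (k := fun z => `|g z.1 * cos (z.2 * ln z.1)|)).
  - exact: integrable_norm ig.
  - exact: measurableT_comp.
  - by move=> x y _ /=; rewrite normr_ge0 normrM ler_piMr // cos_max.
have E x : \int[mu]_(y in `[- T, T]) (g x * cos (y * ln x)) = g x * dirichlet T x.
  by rewrite RintegralZl.
split.
- by move: i1; congr (_.-integrable _ (EFin \o _)); apply/funext => x; rewrite E.
- exact: i2.
- by rewrite -e; apply: eq_Rintegral => x _; rewrite E.
Qed.

End DirichletFubini.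

(** By Fubini and the explicit cosine transform 2 / (1 + y^2), the integral up to T is 4 atan T. The
    constant 2 pi is the limit of this, so no direct evaluation of the integral of sin r / r is
    required. *)
Lemma dirichlet_laplace_ref :
  \int[mu]_(x in D) (laplace_ref x * dirichlet T x) @[T --> +oo] --> (2 * pi : R).
Proof.
have -> : 2 * pi = 4 * (pi / 2) :> R by field.
have /cvgMr := @cvgy_atan R => /(_ 4).
apply: cvg_trans; apply: near_eq_cvg.
have : \forall T \near +oo%R, 0 < T :> R by exact: nbhs_pinfty_gt.
apply: filterS => T T0.
have [_ _ ->] := dirichlet_fubini (@measurable_laplace_ref R) (@integrable_laplace_ref R) T.
rewrite -Rintegral_cauchy_sym //; apply: eq_Rintegral => y _.
by rewrite fourier_laplace_ref.
Qed.

(** A condition at one point: values are compared with the value at the centre only. This is the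
    form of Dini's condition that keeps a difference divided by a vanishing logarithm bounded. *)
Definition locally_lipschitz (g : R -> R) x :=
  exists L d : R, 0 < d /\ forall y, `|y - x| < d -> `|g y - g x| <= L * `|y - x|.

Lemma locally_lipschitz_continuous (g : R -> R) x :
  locally_lipschitz g x -> {for x, continuous g}.
Proof.
move=> [L [d [d0 gL]]]; apply/cvgrPdist_le => e e0.
have [L1 L1L L10] : exists2 L1, L <= L1 & 0 < L1.
  by exists (`|L| + 1); [rewrite ler_wpDr // ler_norm|rewrite ltr_wpDl].
have E0 : 0 < Num.min d (e / L1) by rewrite lt_min d0 divr_gt0.
near=> y.
have : `|y - x| < Num.min d (e / L1).
  by rewrite distrC; near: y; exact: cvgr_dist_lt.
rewrite lt_min => /andP[yd ye]; rewrite distrC; apply: le_trans (gL y yd) _.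
apply: (@le_trans _ _ (L1 * `|y - x|)); first by rewrite ler_wpM2r.
by rewrite mulrC -ler_pdivlMr // ltW.
Unshelve. all: by end_near. Qed.

(** Follows from ln z <= z - 1, taken at 1 / x for x >= 1 and at x for x < 1. It bounds |ln x| below
    in both regimes: comparable to |x - 1| near 1, and at least d / 2 once |x - 1| >= d with d <=
    1. *)
Let abs_ln x : 0 < x -> `|x - 1| <= `|ln x| * (1 + `|x - 1|).
Proof.
have lnle z : 0 < z -> ln z <= z - 1 :> R.
  move=> z0; have := @le_ln1Dx R (z - 1); have -> : 1 + (z - 1) = z by ring.
  by apply; lra.
move=> x0; have [x1|x1] := leP 1 x.
  have l0 : 0 <= ln x by exact: ln_ge0.
  rewrite !ger0_norm ?subr_ge0 //; have -> : 1 + (x - 1) = x by ring.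
  have := lnle x^-1; rewrite invr_gt0 lnV ?posrE // => /(_ x0) h;
    have {}h : 1 - x^-1 <= ln x by lra.
  apply: le_trans (ler_wpM2r (ltW x0) h); by rewrite mulrBl mul1r mulVf ?gt_eqF.
have l0 : ln x < 0 by apply: ln_lt0; rewrite x0.
rewrite ler0_norm ?subr_le0 1?ltW // (ler0_norm (ltW l0)).
have := lnle x x0; move: (ln x) l0 => l l0 h.
by nra.
Qed.

Section DirichletInversion.
Variables (g : R -> R) (m : R).
Hypotheses (mg : measurable_fun setT g) (ig : mu.-integrable D (EFin \o g)).
Hypotheses (m1 : m != 1) (lg : forall x, 0 < x -> x != m -> locally_lipschitz g x).

Let k x := g x - g 1 * laplace_ref x.
Let q x := k x * (2 / ln x).

Let ref1 : laplace_ref (1 : R) = 1.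
Proof. by rewrite /laplace_ref max_l // expr1n invr1. Qed.

Let k1 : k 1 = 0. Proof. by rewrite /k ref1 mulr1 subrr. Qed.

Let ik : mu.-integrable D (EFin \o k).
Proof.
have := @integrableB _ _ _ mu D mD _ _ ig (@integrableZl _ _ _ mu D mD (g 1) _ (@integrable_laplace_ref R)).
by apply: eq_integrable => // x _ /=; rewrite EFinB EFinM.
Qed.

Let mk : measurable_fun setT k.
Proof.
apply: measurable_funB => //; apply: measurable_funM => //.
exact: measurable_laplace_ref.
Qed.

Let mq : measurable_fun setT q.
Proof.
apply: measurable_funM => //; apply: measurable_funM => //.
exact: measurable_inv.
Qed.

Let kL : exists L d, [/\ 0 <= L, 0 < d, d <= 1 &
  forall x, 0 < x -> `|x - 1| < d -> `|k x| <= L * `|x - 1|].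
Proof.
have [L [d [d0 gL]]] : locally_lipschitz g 1 by apply: lg => //; rewrite eq_sym.
exists (`|L| + 2 * `|g 1|), (Num.min d 1); split.
- by rewrite addr_ge0 // mulr_ge0.
- by rewrite lt_min d0 ltr01.
- by rewrite ge_min lexx orbT.
move=> x x0; rewrite lt_min => /andP[xd _].
(* [laplace_ref] is constant to the left of 1 and has slope -2 just to the right, whence the factor
   2. *)
have ref2 : `|laplace_ref x - 1| <= 2 * `|x - 1|.
  rewrite /laplace_ref; have [x1|x1] := leP x 1.
    by rewrite expr1n invr1 subrr normr0 mulr_ge0.
  have x2 : x ^- 2 <= 1 by rewrite invf_le1 ?exprn_gt0 // expr_ge1 // ltW.
  rewrite ler0_norm ?subr_le0 // ger0_norm ?subr_ge0 ?(ltW x1) //.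
  rewrite -subr_ge0 (_ : _ - _ = (x - 1) * (x - 1) * (2 * x + 1) / x ^+ 2); last first.
    by field; rewrite gt_eqF.
  by rewrite !mulr_ge0 ?invr_ge0 ?sqr_ge0 ?subr_ge0 ?(ltW x1) // addr_ge0 // mulr_ge0 // ltW.
rewrite /k (_ : _ - _ = (g x - g 1) - g 1 * (laplace_ref x - 1)); last by ring.
apply: le_trans (ler_normB _ _) _; rewrite mulrDl; apply: lerD.
  by apply: le_trans (gL x xd) _; rewrite ler_wpM2r // ler_norm.
by rewrite normrM (mulrC 2) -mulrA ler_wpM2l.
Qed.

Let iq : mu.-integrable D (EFin \o q).
Proof.
have [L [d [L0 d0 d1 hk]]] := kL.
(* Where |x - 1| < d, a range inside [0, 2], [abs_ln] gives |x - 1| <= 2 |ln x| and so |q| <= 4 L.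
   Elsewhere |ln x| >= d / 2, and so |q| <= (4 / d) |k|. *)
pose h x := 4 * L * \1_(`[0, 2]%classic : set R) x + 4 / d * `|k x|.
have ih : mu.-integrable D (EFin \o h).
  have i2 : mu.-integrable D (EFin \o (\1_(`[0, 2]%classic : set R) : R -> R)).
    by apply: (@integrableS _ _ _ mu setT) => //; exact: (@integrable_indic_itv R 0 2 true false).
  have := @integrableD _ _ _ mu D mD _ _ (@integrableZl _ _ _ mu D mD (4 * L) _ i2)
    (@integrableZl _ _ _ mu D mD (4 / d) _ (integrable_norm ik)).
  by apply: eq_integrable => // x _; rewrite /= EFinD !EFinM.
apply: le_integrable ih => //; first by apply/measurable_EFinP; exact: measurable_funTS.
move=> x; rewrite /= in_itv /= andbT => x0; rewrite lee_fin.
apply: le_trans (ler_norm _); rewrite /q normrM normrM (ger0_norm (ler0n _ 2)) normfV.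
have H := abs_ln x0.
have [->|x1] := eqVneq x 1.
  by rewrite k1 normr0 mul0r /h k1 normr0 mulr0 addr0 mulr_ge0 // mulr_ge0.
have t0 : 0 < `|x - 1| by rewrite normr_gt0 subr_eq0.
have l0 : 0 < `|ln x|.
  by rewrite normr_gt0 ln_eq0.
rewrite mulrA ler_pdivrMr //.
have [xd|dx] := ltP `|x - 1| d.
  have := hk x x0 xd; rewrite /h indicE mem_set /=; last first.
    by rewrite in_itv /=; move: xd; rewrite ltr_distl => /andP[_ ?]; lra.
  move=> hkx; rewrite mulr1.
  have kd : 0 <= 4 / d * `|k x| * `|ln x| by rewrite !mulr_ge0 // invr_ge0 ltW.
  have : `|x - 1| <= 2 * `|ln x| by nra.
  by nra.
have i0 : 0 <= 4 * L * \1_(`[0, 2]%classic : set R) x * `|ln x| by rewrite !mulr_ge0.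
rewrite mulrDl; apply: ler_wpDl => //.
rewrite (_ : 4 / d * _ * _ = 4 * `|k x| * `|ln x| / d); last by ring.
rewrite ler_pdivlMr //.
have : d <= 2 * `|ln x| by nra.
by have := normr_ge0 (k x); nra.
Qed.

Let cq : {ae mu, forall x, D x -> {for x, continuous q}}.
Proof.
(* The two exceptional points: 1, where the logarithm in the denominator vanishes, and m, where g
   may be irregular. *)
exists ([set 1] `|` [set m]); split.
- by apply: measurableU; exact: measurable_set1.
- by apply: null_set_setU => //; [exact: lebesgue_measure_set1|exact: lebesgue_measure_set1].
move=> x /= H; apply: contrapT => /not_orP[/eqP x1 /eqP xm]; apply: H.
rewrite in_itv /= andbT => x0.
have cg := locally_lipschitz_continuous (lg x0 xm).
have cr : {for x, continuous (@laplace_ref R)}.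
  apply: continuousV; first by rewrite sqrf_eq0 gt_eqF // lt_max ltr01.
  have cm : {for x, continuous (Num.max 1 : R -> R)}.
    by apply: (@continuous_max R R (fun=> 1) id); [exact: cst_continuous|exact: cvg_id].
  by apply: continuousM; exact: cm.
apply: continuousM.
  apply: continuousB => //; apply: continuousM => //; exact: cst_continuous.
apply: continuousM; first exact: cst_continuous.
apply: continuousV; first by rewrite ln_eq0.
exact: continuous_ln.
Qed.

(* k vanishes at 1 to first order, so that q = 2 k / ln is integrable. *)
Lemma dirichlet_cvg :
  \int[mu]_(x in D) (g x * dirichlet T x) @[T --> +oo] --> (2 * pi * g 1 : R).
Proof.
have RL := riemann_lebesgue iq cq.
have L : \int[mu]_(x in D) (q x * sin (T * ln x)) +
    g 1 * \int[mu]_(x in D) (laplace_ref x * dirichlet T x) @[T --> +oo] -->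
    0 + g 1 * (2 * pi).
  by apply: cvgD => //; apply: cvgMr; exact: dirichlet_laplace_ref.
have -> : 2 * pi * g 1 = 0 + g 1 * (2 * pi) by rewrite add0r mulrC.
apply: cvg_trans L; apply: near_eq_cvg.
have : \forall T \near +oo%R, 0 < T :> R by exact: nbhs_pinfty_gt.
apply: filterS => T T0.
have [iref _ _] := dirichlet_fubini (@measurable_laplace_ref R) (@integrable_laplace_ref R) T.
have [ikd _ _] := dirichlet_fubini mk ik T.
have igref := @integrableZl _ _ _ mu D mD (g 1) _ iref.
rewrite -RintegralZl //.
transitivity (\int[mu]_(x in D) (k x * dirichlet T x + g 1 * (laplace_ref x * dirichlet T x))).
  rewrite RintegralD //; congr (_ + _); apply: eq_Rintegral => x;
    rewrite inE /= in_itv /= andbT => x0.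
  have [->|x1] := eqVneq x 1; first by rewrite /q k1 !mul0r.
  by rewrite /dirichlet Rintegral_cos_sym ?ln_eq0 // /q -mulrA (mulrC (2 / _)).
by apply: eq_Rintegral => x _; rewrite mulrA -mulrDl /k subrK.
Qed.

End DirichletInversion.

End Dirichlet.

(** * The inversion theorem *)

Section MellinInversion.
Variable R : realType.
Local Notation mu := (@lebesgue_measure R).
Local Notation D := (`]0%R, +oo[%classic : set R).
Implicit Types (x y T c : R).

Lemma cvg_complex (f g : R -> R) (a b : R) :
  f T @[T --> +oo] --> a -> g T @[T --> +oo] --> b ->
  (f T +i* g T : R[i]^o) @[T --> +oo] --> (a +i* b : R[i]^o).
Proof.
move=> fa gb; apply/cvgrPdist_le => e e0.
have [r er r0] : exists2 r, e = r%:C & 0 < r.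
  by case: e e0 => r i; rewrite ltcE /= => /andP[/eqP -> r0]; exists r.
have r2 : 0 < r / 2 by rewrite divr_gt0.
near=> T; rewrite er cabs_normc lecR.
apply: le_trans (cabs_le_ReIm _) _ => /=; rewrite [leRHS](splitr r) lerD //; near: T.
  by move/cvgrPdist_le : fa; exact.
by move/cvgrPdist_le : gb; exact.
Unshelve. all: by end_near. Qed.

Lemma locally_lipschitz_derive (f : R -> R) x a : is_derive x 1 f a -> locally_lipschitz f x.
Proof.
move=> [df _]; have := df; rewrite /derivable => /cvgrPdist_le /(_ 1 ltr01).
rewrite -/(derive f x 1); case=> d /= d0 H; exists (`|'D_1 f x| + 1), d; split=> // y yd.
have [->|yx] := eqVneq y x; first by rewrite !subrr normr0 mulr0.
have yx0 : y - x != 0 by rewrite subr_eq0.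
have := H (y - x); rewrite /= sub0r normrN => /(_ yd yx0).
rewrite /GRing.scale /= mulr1 subrK => h.
have n0 : 0 < `|y - x| by rewrite normr_gt0.
rewrite -ler_pdivrMr // -normfV -normrM mulrC.
rewrite -[X in `|X|](subrK ('D_1 f x)) addrC (le_trans (ler_normD _ _)) // lerD2l distrC.
exact: h.
Qed.

Lemma locally_lipschitzM (f g : R -> R) x : locally_lipschitz f x ->
  locally_lipschitz g x -> locally_lipschitz (fun y => f y * g y) x.
Proof.
move=> [L [d [d0 fL]]] [M [e [e0 gM]]].
exists ((`|f x| + `|L| * d) * `|M| + `|g x| * `|L|), (Num.min d e).
split=> [|y]; first by rewrite lt_min d0.
rewrite lt_min => /andP[yd ye].
have fy := fL y yd; have gy := gM y ye.
rewrite (_ : _ - _ = f y * (g y - g x) + g x * (f y - f x)); last by ring.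
apply: le_trans (ler_normD _ _) _; rewrite !normrM mulrDl; apply: lerD.
  rewrite -mulrA; apply: ler_pM => //.
    rewrite -[f y](subrK (f x)) addrC (le_trans (ler_normD _ _)) // lerD2l.
    apply: le_trans fy _; apply: (@le_trans _ _ (`|L| * `|y - x|)).
      by rewrite ler_wpM2r // ler_norm.
    by rewrite ler_wpM2l // ltW.
  by apply: le_trans gy _; rewrite ler_wpM2r // ler_norm.
rewrite -mulrA ler_wpM2l //.
by apply: le_trans fy _; rewrite ler_wpM2r // ler_norm.
Qed.

Lemma locally_lipschitz_scale (f : R -> R) a x : 0 < a ->
  locally_lipschitz f (a * x) -> locally_lipschitz (fun y => f (a * y)) x.
Proof.
move=> a0 [L [d [d0 fL]]]; exists (L * a), (d / a); split; first by rewrite divr_gt0.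
move=> y; rewrite ltr_pdivlMr // => yd.
have E : `|a * y - a * x| = `|y - x| * a by rewrite -mulrBr normrM gtr0_norm // mulrC.
by have := fL (a * y); rewrite E mulrCA mulrA (mulrC _ L) => /(_ yd); rewrite mulrAC.
Qed.

Let mD : measurable D. Proof. exact: measurable_itv. Qed.

Lemma cabs_cexp_imag x : cabs (cexp (0 +i* x)) = 1.
Proof. by rewrite cabs_cexp /= expR0. Qed.

Lemma rcpow_split x (w : R[i]) : 0 < x ->
  rcpow x w = (x `^ Re w)%:C * cexp (0 +i* (Im w * ln x)).
Proof.
move=> x0; rewrite -rcpow_real // /rcpow -cexpD; congr cexp.
by apply: complexP; rewrite !ReImE /=; ring.
Qed.

Lemma cintegrable_bounded_itv (f : R -> R[i]) (a b C : R) :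
  cmeasurable setT f -> (forall x, cabs (f x) <= C) -> cintegrable `[a, b] f.
Proof.
move=> mf fC; have mab : measurable (`[a, b]%classic : set R) by exact: measurable_itv.
apply: (cintegrable_le (h := fun=> C)) => //; first exact: cmeasurableS mf.
apply: measurable_bounded_integrable => //.
  by rewrite /= lebesgue_measure_itv /=; case: ifPn => _; rewrite ?ltry // -EFinB ltry.
exact: bounded_cst.
Qed.

Lemma cintegral_cexp_sym T x : 0 < T ->
  cintegral `[- T, T] (fun y => cexp (0 +i* (y * ln x))) = (dirichlet T x)%:C.
Proof.
move=> T0; apply: complexP => /=.
  by apply: eq_Rintegral => y _; rewrite expR0 mul1r.
rewrite -[RHS](Rintegral_sin_sym (ln x) T0).
by apply: eq_Rintegral => y _; rewrite expR0 mul1r.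
Qed.

Lemma cmeasurable_cexp_imag d (A : measurableType d) (B : set A) (f : A -> R) :
  measurable_fun B f -> cmeasurable B (fun t => cexp (0 +i* f t)).
Proof.
move=> mf; split; rewrite /= expR0; under eq_fun do rewrite mul1r.
  exact: measurableT_comp (continuous_measurable_fun (@continuous_cos R)) mf.
exact: measurableT_comp (continuous_measurable_fun (@continuous_sin R)) mf.
Qed.

Lemma measurable_cabs d (A : measurableType d) (B : set A) (f : A -> R[i]) :
  cmeasurable B f -> measurable_fun B (fun t => cabs (f t)).
Proof.
move=> [mR mI].
apply: measurableT_comp (continuous_measurable_fun (@sqrt_continuous R)) _.
by apply: measurable_funD; apply: measurable_funX.
Qed.

(** For each finite T, Fubini turns the truncated line integral into a Dirichlet integral of G(x0 u)
    u^(c-1), so only the absolute integrability of G(x) x^(c-1) is used and the transform itself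
    need not be integrable on the line. The point m is the single place where G may be irregular. *)
Theorem mellin_inversion (G : R -> R[i]) c m x0 : 0 < x0 -> m != x0 ->
  cmeasurable setT G ->
  mu.-integrable D (EFin \o (fun x => cabs (G x) * x `^ (c - 1))) ->
  (forall x, 0 < x -> x != m -> locally_lipschitz (fun y => Re (G y)) x /\
                                locally_lipschitz (fun y => Im (G y)) x) ->
  is_line_integral
    (fun s => cintegral D (fun x => G x * rcpow x (s - 1)) * rcpow x0 (- s)) c (G x0).
Proof.
move=> x00 mx0 mG iG lG.
(* The substitution x = x0 u moves the point of inversion to 1, where [dirichlet_cvg] evaluates; the
   exceptional point becomes m / x0. *)
pose g u : R[i] := G (x0 * u) * (u `^ (c - 1))%:C.
pose K (z : R * R) : R[i] := g z.1 * cexp (0 +i* (z.2 * ln z.1)).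
have mpow : measurable_fun setT (fun u : R => u `^ (c - 1)) by exact: measurable_powR.
have mGx : cmeasurable setT (fun u => G (x0 * u)).
  by have [mR mI] := mG; split; [apply: (measurableT_comp mR)|apply: (measurableT_comp mI)];
    exact: measurable_funM.
have mg : cmeasurable setT g by apply: cmeasurableM => //; exact: cmeasurable_real.
have mK : cmeasurable setT K.
  apply: cmeasurableM.
    by have [mR mI] := mg; split; [apply: (measurableT_comp mR)|apply: (measurableT_comp mI)].
  by apply: cmeasurable_cexp_imag; apply: measurable_funM => //; exact: measurableT_comp.
have cK z : cabs (K z) = cabs (g z.1) by rewrite /K cabsM cabs_cexp_imag mulr1.
have ig : mu.-integrable D (EFin \o (fun u => cabs (g u))).
  have := integrable_affine x00 iG.
  move/(@integrableZl _ _ _ mu D mD (x0 `^ (1 - c))); apply: eq_integrable => // u.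
  rewrite inE /= in_itv /= andbT => u0; rewrite addr0 -EFinM; congr EFin.
  rewrite /g cabsM cabs_real ger0_norm ?powR_ge0 // powRM ?ltW //.
  have E1 : x0 `^ (1 - c) * x0 `^ (c - 1) = 1.
    rewrite -powRD ?(lt0r_neq0 x00) ?implybT //.
    by rewrite (_ : _ + _ = 0) ?powRr0 //; ring.
  by rewrite mulrCA; congr (_ * _); rewrite mulrA E1 mul1r.
have igK y : cintegrable D (fun u => K (u, y)).
  apply: cintegrable_le ig _ => //; last by move=> u _; rewrite cK.
  apply: (cmeasurableS measurableT) => //.
  have [mR mI] := mK; have mp : measurable_fun setT (fun u : R => (u, y)).
    exact: measurable_fun_pair.
  by split; [exact: (measurableT_comp mR mp)|exact: (measurableT_comp mI mp)].
have FE y : cintegral D (fun x => G x * rcpow x ((c +i* y) - 1)) * rcpow x0 (- (c +i* y)) =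
    cintegral D (fun u => K (u, y)).
  rewrite -(cintegral_affine (b := 0) x00); last first.
    apply: (cmeasurableS measurableT) => //; apply: cmeasurableM => //.
    by apply: cmeasurable_rcpow => //; exact: cmeasurable_cst.
  transitivity (x0%:C * (rcpow x0 (c +i* y - 1) * cintegral D (fun u => K (u, y))) *
      rcpow x0 (- (c +i* y))).
    congr (_ * _ * _); rewrite -cintegralZl //; apply: eq_cintegral => u.
    rewrite inE /= in_itv /= andbT => u0; rewrite addr0 rcpowM // (rcpow_split _ u0).
    by rewrite mulrCA; congr (_ * _); rewrite /= subr0 /K /g /= mulrA.
  rewrite mulrA mulrAC -rcpow1 // -!rcpowD (_ : 1 + _ + _ = 0) ?rcpow0 ?mul1r //.
  by ring.
have mT T : measurable (`[- T, T]%classic : set R) by exact: measurable_itv.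
have kf T : (\int[mu]_(x in D) \int[mu]_(y in `[(- T)%R, T]) (cabs (K (x, y)))%:E < +oo)%E.
  apply: (kernel_fin (b := fun u => cabs (g u)) (k := fun z => cabs (K z))) => //.
    exact: measurable_cabs.
  by move=> u y _; rewrite cabs_ge0 cK /=.
rewrite /is_line_integral; split=> [T|].
  have [_ i2 _] := cintegral_fubini mD (mT T) mK (kf T).
  by move: i2; congr cintegrable; apply/funext => y; rewrite FE.
have x0m : m / x0 != 1 by rewrite -subr_eq0 -(mulfV (lt0r_neq0 x00)) -mulrBl mulf_neq0 //
  ?subr_eq0 // invr_neq0 // lt0r_neq0.
(* [p] stands for [Re] or [Im]. Compatibility with real factors is what both have in common, so each
   part of the argument is made once. *)
have lg (p : R[i] -> R) : (forall z a, p (z * a%:C) = p z * a) ->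
    (forall x, 0 < x -> x != m -> locally_lipschitz (fun y => p (G y)) x) ->
  forall u, 0 < u -> u != m / x0 -> locally_lipschitz (fun u => p (g u)) u.
  move=> pE lp u u0 um.
  rewrite (_ : (fun u => p (g u)) = (fun u => p (G (x0 * u)) * u `^ (c - 1))); last first.
    by apply/funext => v; rewrite /g pE.
  apply: locally_lipschitzM.
    apply: (locally_lipschitz_scale (f := fun y => p (G y))) => //.
    apply: lp; first by rewrite mulr_gt0.
    by apply: contra um => /eqP <-; rewrite mulrAC mulfV ?mul1r // gt_eqF.
  exact: locally_lipschitz_derive (is_derive1_powR (c - 1) u0).
have lim (p : R[i] -> R) : (forall z a, p (z * a%:C) = p z * a) ->
    measurable_fun setT (fun u => p (g u)) -> (forall z, `|p z| <= cabs z) ->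
    (forall x, 0 < x -> x != m -> locally_lipschitz (fun y => p (G y)) x) ->
  (2 * pi)^-1 * \int[mu]_(u in D) (p (g u) * dirichlet T u) @[T --> +oo] --> p (G x0).
  move=> pE mp pc lp.
  have ip : mu.-integrable D (EFin \o (fun u => p (g u))).
    apply: le_integrable ig => //.
      by apply/measurable_EFinP; exact: measurable_funTS.
    by move=> u _; rewrite !abse_EFin lee_fin (le_trans (pc _)) // ler_norm.
  have := dirichlet_cvg mp ip x0m (lg p pE lp).
  move/(cvgMr (a := (2 * pi)^-1)); rewrite mulKf; last first.
    by rewrite mulf_neq0 // gt_eqF // pi_gt0.
  by rewrite /g mulr1 powR1 pE mulr1.
have [mgR mgI] := mg.
have ReZ z a : Re (z * a%:C) = Re z * a :> R by rewrite ReM /= mulr0 subr0.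
have ImZ z a : Im (z * a%:C) = Im z * a :> R by rewrite ImM /= mulr0 add0r.
have LR := lim (@Re R) ReZ mgR (@Re_le_cabs R) (fun x xp xm => (lG x xp xm).1).
have LI := lim (@Im R) ImZ mgI (@Im_le_cabs R) (fun x xp xm => (lG x xp xm).2).
have := cvg_complex LR LI.
rewrite (_ : Re _ +i* Im _ = G x0); last by case: (G x0).
apply: cvg_trans; apply: near_eq_cvg.
have : \forall T \near +oo%R, 0 < T :> R by exact: nbhs_pinfty_gt.
apply: filterS => T T0.
have [_ _ e] := cintegral_fubini mD (mT T) mK (kf T).
have -> : cintegral `[- T, T] (fun y => cintegral D (fun x => G x * rcpow x (c +i* y - 1)) *
    rcpow x0 (- (c +i* y))) = cintegral D (fun u => g u * (dirichlet T u)%:C).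
  rewrite (_ : (fun y => _ * _) = fun y => cintegral D (fun u => K (u, y))); last first.
    by apply/funext => y; rewrite FE.
  rewrite -e; congr cintegral; apply/funext => u.
  have I : cintegrable `[- T, T] (fun y => cexp (0 +i* (y * ln u))).
    apply: (@cintegrable_bounded_itv _ _ _ 1); last by move=> y; rewrite cabs_cexp_imag.
    by apply: cmeasurable_cexp_imag; exact: measurable_funM.
  by rewrite -(cintegral_cexp_sym u T0) -(cintegralZl (g u) (mT T) I).
apply: complexP; rewrite !ReImE /= !mul0r ?subr0 ?addr0; congr (_ * _);
  by apply: eq_Rintegral => u _; rewrite ?ReZ ?ImZ.
Qed.

End MellinInversion.

(** * Gamma and Beta integrals *)

Section GammaFunction.
Variable R : realType.
Local Notation mu := (@lebesgue_measure R).
Local Notation D := (`]0%R, +oo[%classic : set R).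
Implicit Types (x y p q k : R) (z w : R[i]).

Let mD : measurable D. Proof. exact: measurable_itv. Qed.

(** With the shift by 2 each interval [1 / (n + 2), n + 2] is non-degenerate already at n = 0, as
    the fundamental theorem applied to it in [Rintegral_derive] requires. *)
Lemma cvg_Rintegral_exhaust (f : R -> R) : mu.-integrable D (EFin \o f) ->
  \int[mu]_(x in `[n.+2%:R^-1, n.+2%:R]) f x @[n --> \oo] --> \int[mu]_(x in D) f x.
Proof.
move=> fi.
have mf : measurable_fun D (EFin \o f) by exact: measurable_int fi.
pose I n := (`[n.+2%:R^-1, n.+2%:R]%classic : set R).
have ID n : I n `<=` D.
  by move=> x; rewrite /I /= !in_itv /= andbT => /andP[+ _]; apply: lt_le_trans; rewrite invr_gt0.
have mI n : measurable (I n) by exact: measurable_itv.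
have [] := @dominated_convergence _ _ _ mu D mD (fun n => (EFin \o f) \_ (I n)) (EFin \o f)
  (fun x => `|(f x)%:E|%E).
- move=> n; apply/measurable_restrict => //; first exact: mI.
  by apply: measurable_funS mf => // x [].
- exact: mf.
- apply: aeW => x /=; rewrite in_itv /= andbT => x0.
  apply: cvg_near_cst.
  have : \forall n \near \oo, Num.max x x^-1 <= n%:R :> R by exact: nbhs_infty_ger.
  apply: filterS => n; rewrite ge_max => /andP[xn xVn].
  have n2 : n%:R <= n.+2%:R :> R by rewrite ler_nat -addn2 leq_addr.
  rewrite /patch mem_set // /I /= in_itv /= (le_trans xn n2) andbT.
  by rewrite invf_ple ?posrE // (le_trans xVn).
- by have := integrable_abse fi.
- apply: aeW => x n _; rewrite /patch; case: ifPn => _ //; by rewrite abse0.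
move=> _ _ L.
have {}L : (\int[mu]_(x in D) ((EFin \o f) \_ (I n)) x)%E @[n --> \oo] -->
    (\int[mu]_(x in D) f x)%:E.
  by rewrite fineK // integrable_fin_num.
rewrite (_ : (fun n => _) =
    (fun n => fine (\int[mu]_(x in D) ((EFin \o f) \_ (I n)) x)%E)); first exact: fine_cvg.
by apply/funext => n; rewrite -integral_mkcondr setIC (setIidl (ID n)).
Qed.

(** The fundamental theorem on ]0, oo[ for integrands without a sign: integrability allows passing
    to the limit along an exhaustion, so boundary limits along two sequences suffice. *)
Lemma Rintegral_derive (F f : R -> R) (l0 l : R) :
  (forall x, 0 < x -> is_derive x 1 F (f x)) ->
  (forall x, 0 < x -> {for x, continuous f}) ->
  mu.-integrable D (EFin \o f) ->
  F n.+2%:R^-1 @[n --> \oo] --> l0 -> F n.+2%:R @[n --> \oo] --> l ->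
  \int[mu]_(x in D) f x = l - l0.
Proof.
move=> dF cf fi F0 Foo.
have L := cvg_Rintegral_exhaust fi.
have L' : \int[mu]_(x in `[n.+2%:R^-1, n.+2%:R]) f x @[n --> \oo] --> l - l0.
  rewrite (_ : (fun n => _) = (fun n => F n.+2%:R - F n.+2%:R^-1)); first exact: cvgB.
  apply/funext => n.
  have n0 : 0 < n.+2%:R^-1 :> R by rewrite invr_gt0.
  have pos x : x \in `[n.+2%:R^-1, n.+2%:R] -> 0 < x :> R.
    by rewrite in_itv /= => /andP[+ _]; exact: lt_le_trans.
  have nn : n.+2%:R^-1 < n.+2%:R :> R.
    by rewrite (@lt_trans _ _ 1) ?invf_lt1 // ltr1n.
  rewrite /Rintegral (continuous_FTC2 (F := F)) //.
  - apply: continuous_in_subspaceT => x; rewrite inE /= => xI.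
    exact: cf (pos x xI).
  - split.
    + by move=> x xI; have [] := dF x (pos x (subset_itv_oo_cc xI)).
    + by apply: cvg_at_right_filter; exact: isd_continuous (dF _ n0).
    + by apply: cvg_at_left_filter; apply: isd_continuous (dF _ _); rewrite ltr0n.
  - move=> x xI; rewrite derive1E.
    by have [_ ->] := dF x (pos x (subset_itv_oo_cc xI)).
exact: (cvg_unique _ L L').
Qed.

Lemma powRN_pinfty p : 0 < p -> x `^ (- p) @[x --> +oo] --> (0 : R).
Proof.
move=> p0; apply/cvgrPdist_le => e e0.
have : \forall x \near +oo%R, Num.max 1 (e `^ (- p^-1)) < x :> R by exact: nbhs_pinfty_gt.
apply: filterS => x; rewrite gt_max => /andP[x1 xe].
have x0 : 0 < x by apply: lt_trans x1.
rewrite sub0r normrN ger0_norm ?powR_ge0 // powRN -[leRHS]invrK.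
rewrite lef_pV2 ?posrE ?powR_gt0 ?invr_gt0 //.
have -> : e^-1 = (e `^ (- p^-1)) `^ p.
  by rewrite -powRrM mulNr mulVf ?gt_eqF // powR_inv1 // ltW.
by rewrite ge0_ler_powR ?ltW // nnegrE ?powR_ge0 ?ltW.
Qed.

(** Inversion x -> 1 / x turns the singularity at 0 into the tail of x^(-p-1) on ]1, oo[, which has
    an explicit antiderivative tending to 0. *)
Lemma integrable_powR01 p : 0 < p ->
  mu.-integrable D (EFin \o (fun x => \1_(`]0, 1[%classic : set R) x * x `^ (p - 1))).
Proof.
move=> p0.
pose G x : \bar R := (\1_(`]0, 1[%classic : set R) x * x `^ p)%:E.
have mpow q : measurable_fun setT (fun u : R => u `^ q) by exact: measurable_powR.
have mG : measurable_fun setT G.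
  by apply/measurable_EFinP; apply: measurable_funM => //; exact: measurable_indic.
have G0 x : (0 <= G x)%E by rewrite lee_fin mulr_ge0 // powR_ge0.
apply/integrableP; split.
  apply/measurable_EFinP; apply: measurable_funTS.
  by apply: measurable_funM => //; exact: measurable_indic.
rewrite (_ : (\int[mu]_(x in D) _ = \int[mu]_(x in D) ((x^-1)%:E * G x))%E); last first.
  apply: eq_integral => x; rewrite inE /= in_itv /= andbT => x0.
  rewrite ger0_norm ?mulr_ge0 ?powR_ge0 // -EFinM; congr EFin.
  rewrite mulrCA; congr (_ * _); rewrite powRB ?(lt0r_neq0 x0) ?implybT //.
  by rewrite powRr1 ?(ltW x0) // mulrC.
rewrite -haar_inv //.
have dF x : 1 <= x -> is_derive x 1 (fun x => - p^-1 * x `^ (- p)) (x `^ (- p - 1)).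
  move=> x1; have x0 : 0 < x by apply: lt_le_trans x1.
  apply: isd_eq (isdMl _ (is_derive1_powR (- p) x0)) _.
  by field; rewrite gt_eqF.
apply: (@le_lt_trans _ _ (\int[mu]_(x in `[1%R, +oo[) (x `^ (- p - 1))%:E)%E).
  rewrite [leLHS]integral_mkcond [leRHS]integral_mkcond; apply: ge0_le_integral => //.
  - by move=> x _; apply: erestrict_ge0 => t; rewrite /= in_itv /= andbT => t0;
      rewrite mule_ge0 // lee_fin invr_ge0 ltW.
  - apply/(measurable_restrictT _ _).1 => //; apply: measurable_funTS.
    apply: emeasurable_funM; first by apply/measurable_EFinP; exact: measurable_inv.
    by apply: (measurableT_comp mG); exact: measurable_inv.
  - by apply/(measurable_restrictT _ _).1 => //; apply: measurable_funTS; exact/measurable_EFinP.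
  - move=> x _; rewrite /patch /G indicE !mem_setE !in_itv /= !andbT.
    have [x0|x0] := ltP 0 x; last by case: ifPn => // _; rewrite lee_fin powR_ge0.
    rewrite invr_gt0 x0 invf_lt1 //=; have [x1|x1] := ltP 1 x; last first.
      by rewrite mul0r mule0; case: ifPn => // _; rewrite lee_fin powR_ge0.
    rewrite (ltW x1) -EFinM lee_fin /= mul1r -powR_inv1 ?(ltW x0) // -powRrM mulN1r.
    by rewrite -powRD ?(lt0r_neq0 x0) ?implybT // addrC.
rewrite (ge0_continuous_FTC2y (F := fun x => - p^-1 * x `^ (- p)) (l := 0)) ?ltry //.
- by move=> x _; exact: powR_ge0.
- apply: derivable_within_continuous => x; rewrite in_itv /= andbT => x1.
  by have [] := is_derive1_powR (- p - 1) (lt_le_trans ltr01 x1).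
- by rewrite -[X in _ --> X](mulr0 (- p^-1)); apply: cvgMr; exact: powRN_pinfty.
- by move=> x /ltW /dF [].
- by apply: cvg_at_right_filter; exact: isd_continuous (dF _ (lexx _)).
- move=> x; rewrite in_itv /= andbT => /ltW x1; rewrite derive1E.
  by have [_ ->] := dF x x1.
Qed.

(** From y <= 1 + y <= e^y at y = x / q, raised to the power q. *)
Lemma powR_expRN_le q x : 0 < q -> 0 < x -> x `^ q * expR (- x) <= q `^ q.
Proof.
move=> q0 x0; rewrite expRN ler_pdivrMr ?expR_gt0 //.
have H : x / q <= expR (x / q) by apply: le_trans (expR_ge1Dx _); rewrite lerDr.
have xq : 0 <= x / q by rewrite divr_ge0 // ltW.
have -> : x = q * (x / q) by field; rewrite gt_eqF.
rewrite powRM ?(ltW q0) // ler_wpM2l ?powR_ge0 //.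
by rewrite [q * _]mulrC expRM ge0_ler_powR ?(ltW q0) // nnegrE ?expR_ge0.
Qed.

(** Below 1 the majorant is x^(p-1). From 1 on, [powR_expRN_le] with exponent p + 1 gives a multiple
    of x^(-2), which is the value of [laplace_ref] there. *)
Lemma integrable_gamma p : 0 < p ->
  mu.-integrable D (EFin \o (fun x => x `^ (p - 1) * expR (- x))).
Proof.
move=> p0; have p1 : 0 < p + 1 by rewrite addr_gt0.
have ih := @integrableD _ _ _ mu D mD _ _ (integrable_powR01 p0)
  (@integrableZl _ _ _ mu D mD ((p + 1) `^ (p + 1)) _ (@integrable_laplace_ref R)).
apply: le_integrable ih => //.
  apply/measurable_EFinP; apply: measurable_funTS; apply: measurable_funM.
    exact: measurable_powR.
  by apply: measurableT_comp => //; exact: measurableT_comp.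
move=> x; rewrite /= in_itv /= andbT => x0.
have l0 : 0 <= laplace_ref x by rewrite /laplace_ref invr_ge0 sqr_ge0.
rewrite lee_fin !ger0_norm ?addr_ge0 ?mulr_ge0 ?powR_ge0 ?expR_ge0 //.
rewrite indicE mem_setE in_itv /= x0; have [x1|x1] /= := ltP x 1.
  rewrite mul1r; apply: ler_wpDr; first by rewrite mulr_ge0 // powR_ge0.
  by rewrite ler_piMr ?powR_ge0 // expR_le1 oppr_le0 ltW.
rewrite mul0r add0r /laplace_ref max_r // ler_pdivlMr ?exprn_gt0 //.
apply: le_trans (powR_expRN_le p1 x0); rewrite mulrAC ler_wpM2r ?expR_ge0 //.
rewrite -(powR_mulrn 2) ?(ltW x0) // -powRD ?(lt0r_neq0 x0) ?implybT //.
by rewrite (_ : p - 1 + 2 = p + 1) //; ring.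
Qed.

End GammaFunction.

(** * Euler's Gamma and Beta integrals with complex parameters *)

Section EulerGamma.
Variable R : realType.
Local Notation mu := (@lebesgue_measure R).
Local Notation D := (`]0%R, +oo[%classic : set R).
Implicit Types (x y p q k t : R) (z w : R[i]).

Let mD : measurable D. Proof. exact: measurable_itv. Qed.

Lemma measurable_expRN d (T : measurableType d) (A : set T) (f : T -> R) :
  measurable_fun A f -> measurable_fun A (fun a => expR (- f a)).
Proof. by move=> mf; apply: measurableT_comp => //; exact: measurableT_comp. Qed.

Lemma cmeasurable_int (A : set R) (f : R -> R[i]) : cintegrable A f -> cmeasurable A f.
Proof.
by move=> [/(measurable_int _) iR /(measurable_int _) iI]; split; apply/measurable_EFinP.
Qed.

Lemma cintegrable_gamma_scale z k : 0 < Re z -> 0 < k ->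
  cintegrable D (fun u => rcpow u (z - 1) * (expR (- (k * u)))%:C).
Proof.
move=> z0 k0.
have ig := integrable_affine (b := 0) k0 (integrable_gamma z0).
have ig' := @integrableZl _ _ _ mu D mD (k `^ (1 - Re z)) _ ig.
apply: (cintegrable_le (h := fun x => k `^ (1 - Re z) *
    ((k * x + 0) `^ (Re z - 1) * expR (- (k * x + 0))))) => //.
  apply: cmeasurableM.
    by apply: cmeasurable_rcpow; [exact: measurable_id|exact: cmeasurable_cst].
  by apply: cmeasurable_real; apply: measurable_funTS; apply: measurable_expRN;
    exact: measurable_funM.
move=> u /=; rewrite in_itv /= andbT => u0.
rewrite cabsM cabs_rcpow // cabs_real ger0_norm ?expR_ge0 // addr0 !ReImE /= powRM ?(ltW k0) ?(ltW u0) //.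
rewrite mulrA mulrA -powRD ?(lt0r_neq0 k0) ?implybT // (_ : 1 - _ + _ = 0) ?powRr0 ?mul1r //.
by ring.
Qed.

Lemma Euler_GammaE z :
  Euler_Gamma z = cintegral D (fun u => rcpow u (z - 1) * (expR (- u))%:C).
Proof.
by apply: eq_cintegral => u; rewrite inE /= in_itv /= andbT => u0; rewrite cpow_real.
Qed.

Lemma cintegrable_gamma z : 0 < Re z ->
  cintegrable D (fun u => rcpow u (z - 1) * (expR (- u))%:C).
Proof.
move=> z0; have := cintegrable_gamma_scale z0 ltr01.
by apply: eq_cintegrable => // x _; rewrite mul1r.
Qed.

Lemma gamma_scale z k : 0 < Re z -> 0 < k ->
  cintegral D (fun u => rcpow u (z - 1) * (expR (- (k * u)))%:C) =
  rcpow k (- z) * Euler_Gamma z.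
Proof.
move=> z0 k0; rewrite Euler_GammaE -[in RHS](cintegral_affine (b := 0) k0).
  2: exact: cmeasurable_int (cintegrable_gamma z0).
have E : cintegral D (fun x => rcpow (k * x + 0) (z - 1) * (expR (- (k * x + 0)))%:C) =
    rcpow k (z - 1) * cintegral D (fun u => rcpow u (z - 1) * (expR (- (k * u)))%:C).
  rewrite -(cintegralZl _ mD (cintegrable_gamma_scale z0 k0)); apply: eq_cintegral => u.
  by rewrite inE /= in_itv /= andbT => u0; rewrite addr0 rcpowM // mulrA.
rewrite E.
rewrite !mulrA -[k%:C]rcpow1 // -!rcpowD.
by rewrite (_ : - z + 1 + (z - 1) = 0) ?rcpow0 ?mul1r //; ring.
Qed.

Lemma cGammaE z : 0 < Re z -> cGamma z = Euler_Gamma z.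
Proof.
move=> z0; rewrite /cGamma (_ : Num.truncn _ = 0%N); last first.
  by apply/truncn0Pn; rewrite -ltNge ltrBlDr ltrDl.
by rewrite big_ord0 addr0 divr1.
Qed.

Lemma isd_rcpow z x : 0 < x ->
  is_derive x 1 (fun u => Re (rcpow u z)) (Re (z * rcpow x (z - 1))) /\
  is_derive x 1 (fun u => Im (rcpow u z)) (Im (z * rcpow x (z - 1))).
Proof.
case: z => a b x0; have dl := is_derive1_ln x0; set z := a +i* b.
have x1 : x * x^-1 = 1 by rewrite mulfV // gt_eqF.
have E : rcpow x (z - 1) = rcpow x z * (x^-1)%:C.
  by rewrite rcpowD -rcpowV // rcpow1 // invr_gt0.
have dR : is_derive x 1 (fun u => Re (z * (ln u)%:C)) (Re z * x^-1).
  by apply: isd_eq (isdB (isdMl (Re z) dl) (isd_cst x (Im z * 0))) _; rewrite subr0.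
have dI : is_derive x 1 (fun u => Im (z * (ln u)%:C)) (Im z * x^-1).
  by apply: isd_eq (isdD (isd_cst x (Re z * 0)) (isdMl (Im z) dl)) _; rewrite add0r.
split; rewrite E /rcpow /cexp.
  apply: isd_eq (isdM (isd_expR dR) (isd_cos dI)) _; rewrite !ReImE /=; ring.
apply: isd_eq (isdM (isd_expR dR) (isd_sin dI)) _; rewrite !ReImE /=; ring.
Qed.

Lemma cvg_natSS (f : R -> R) (l : R) :
  f x @[x --> +oo] --> l -> f n.+2%:R @[n --> \oo] --> l.
Proof.
move=> fl; apply: (cvg_comp (fun n : nat => n.+2%:R : R) f _ fl).
apply/cvgryPge => A; have : \forall n \near \oo, A <= n%:R :> R by exact: nbhs_infty_ger.
by apply: filterS => n /le_trans; apply; rewrite ler_nat -addn2 leq_addr.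
Qed.

Lemma cvg0_le (f g : nat -> R) : (forall n, `|f n| <= g n) ->
  g n @[n --> \oo] --> (0 : R) -> f n @[n --> \oo] --> (0 : R).
Proof.
move=> fg g0; apply: (@squeeze_cvgr _ _ _ _ (fun n => - g n) g) => //.
  by apply: nearW => n; rewrite -ler_norml.
by rewrite -[X in _ --> X]oppr0; exact: cvgN.
Qed.

(** Integration by parts: the derivative of u^z e^(-u) is z u^(z-1) e^(-u) - u^z e^(-u), and its
    integral is 0 because u^z e^(-u) vanishes at both ends. [Ezero] performs this for the real and
    the imaginary part alike. *)
Lemma Euler_GammaS z : 0 < Re z -> Euler_Gamma (z + 1) = z * Euler_Gamma z.
Proof.
move=> z0; have z1 : 0 < Re (z + 1) by rewrite !ReImE /= addr_gt0.
have iz := cintegrable_gamma z0; have iz1 := cintegrable_gamma z1.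
rewrite !Euler_GammaE -cintegralZl //.
have [izR izI] := cintegrableZl z mD iz; move: iz1; rewrite addrK => -[iR iI].
have n0 (n : nat) : 0 < n.+2%:R :> R by rewrite ltr0n.
have Ezero (F f g : R -> R) : (forall u : R, 0 < u -> is_derive u 1 F (f u - g u)) ->
    (forall u : R, 0 < u -> {for u, continuous (fun u => f u - g u)}) ->
    mu.-integrable D (EFin \o f) -> mu.-integrable D (EFin \o g) ->
    (forall u : R, 0 < u -> `|F u| <= u `^ Re z * expR (- u)) ->
    \int[mu]_(x in D) g x = \int[mu]_(x in D) f x.
  move=> dF cf fi gi Fle; apply/esym/eqP; rewrite -subr_eq0.
  have := @RintegralB _ _ _ mu D f g mD fi gi; rewrite /= => <-.
  rewrite -[X in _ == X](subr0 (0 : R)); apply/eqP; apply: (Rintegral_derive dF cf).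
  - by have := @integrableB _ _ _ mu D mD _ _ fi gi.
  (* At u = 1 / (n + 2) the boundary term is at most (n + 2)^(- Re z). At u = n + 2 it is at most a
     constant over n + 2, by [powR_expRN_le] with exponent Re z + 1. *)
  - apply: cvg0_le (cvg_natSS (powRN_pinfty z0)) => n.
    apply: le_trans (Fle _ _) _; first by rewrite invr_gt0.
    by rewrite -powR_inv1 ?(ltW (n0 n)) // -powRrM mulN1r ler_piMr ?powR_ge0 // expR_le1 oppr_le0.
  - have L : (Re z + 1) `^ (Re z + 1) * n.+2%:R `^ (- 1) @[n --> \oo] --> (0 : R).
      rewrite -[X in _ --> X](mulr0 ((Re z + 1) `^ (Re z + 1))).
      by apply: cvgMr; exact: cvg_natSS (powRN_pinfty (@ltr01 R)).
    apply: cvg0_le L => n; apply: le_trans (Fle _ (n0 n)) _.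
    have p1 : 0 < Re z + 1 by rewrite addr_gt0.
    rewrite powR_inv1 ?(ltW (n0 n)) // ler_pdivlMr // mulrAC.
    apply: le_trans (powR_expRN_le p1 (n0 n)).
    by rewrite powRD ?(lt0r_neq0 (n0 n)) ?implybT // powRr1 ?(ltW (n0 n)).
have dexp (u : R) : is_derive u 1 (fun u : R => expR (- u)) (- expR (- u)).
  apply: isd_eq (isd_expR (is_deriveN (isd_id u))) _; ring.
have bnd (u a : R) : 0 < u -> `|a| <= cabs (rcpow u z) -> `|a * expR (- u)| <= u `^ Re z * expR (- u).
  by move=> u0; rewrite cabs_rcpow // normrM (ger0_norm (expR_ge0 _)) ler_pM2r ?expR_gt0.
apply: complexP.
- apply: (Ezero (fun u => Re (rcpow u z) * expR (- u))
    (fun u => Re (z * (rcpow u (z - 1) * (expR (- u))%:C)))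
    (fun u => Re (rcpow u z * (expR (- u))%:C))) => // u u0.
  + apply: isd_eq (isdM (isd_rcpow z u0).1 (dexp u)) _; rewrite !ReImE /=; ring.
  + rewrite (_ : (fun u => _) = (fun u => Re z * (Re (rcpow u (z - 1)) * expR (- u)) -
      Im z * (Im (rcpow u (z - 1)) * expR (- u)) - Re (rcpow u z) * expR (- u))).
      have [h1 h2] := isd_rcpow (z - 1) u0; have [h3 _] := isd_rcpow z u0.
      exact: isd_continuous (isdB (isdB (isdMl (Re z) (isdM h1 (dexp u)))
        (isdMl (Im z) (isdM h2 (dexp u)))) (isdM h3 (dexp u))).
    by apply/funext => v; rewrite !ReImE /=; ring.
  + by apply: bnd u0 _; exact: Re_le_cabs.
- apply: (Ezero (fun u => Im (rcpow u z) * expR (- u))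
    (fun u => Im (z * (rcpow u (z - 1) * (expR (- u))%:C)))
    (fun u => Im (rcpow u z * (expR (- u))%:C))) => // u u0.
  + apply: isd_eq (isdM (isd_rcpow z u0).2 (dexp u)) _; rewrite !ReImE /=; ring.
  + rewrite (_ : (fun u => _) = (fun u => Re z * (Im (rcpow u (z - 1)) * expR (- u)) +
      Im z * (Re (rcpow u (z - 1)) * expR (- u)) - Im (rcpow u z) * expR (- u))).
      have [h1 h2] := isd_rcpow (z - 1) u0; have [_ h3] := isd_rcpow z u0.
      exact: isd_continuous (isdB (isdD (isdMl (Re z) (isdM h2 (dexp u)))
        (isdMl (Im z) (isdM h1 (dexp u)))) (isdM h3 (dexp u))).
    by apply/funext => v; rewrite !ReImE /=; ring.
  + by apply: bnd u0 _; exact: Im_le_cabs.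
Qed.

(** With s the square root of y, the bounds ln s <= s - 1 and - ln s <= 1 / s - 1 give |ln s| <= |s
    - 1 / s|, and squaring yields the claim. The right-hand side is chosen as a combination of
    powers of y, so that it integrates against u^q e^(-u) to shifted Gamma values. *)
Lemma ln_sqr_le y : 0 < y -> (ln y) ^+ 2 <= 4 * (y - 2 + y^-1).
Proof.
move=> y0; have s0 : 0 < Num.sqrt y by rewrite sqrtr_gt0.
have -> : ln y = 2 * ln (Num.sqrt y).
  by rewrite -[in LHS](sqr_sqrtr (ltW y0)) lnXn ?mulr_natl.
have -> : y - 2 + y^-1 = (Num.sqrt y - (Num.sqrt y)^-1) ^+ 2.
  rewrite -[in LHS](sqr_sqrtr (ltW y0)); field; rewrite gt_eqF //.
move: (Num.sqrt y) s0 => s s0; rewrite exprMn (_ : 2 ^+ 2 = 4); last by ring.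
rewrite ler_pM2l //.
have h1 : ln s <= s - 1.
  by rewrite lerBrDl; apply: le_trans (expR_ge1Dx _) _; rewrite lnK.
have sV : 0 < s^-1 by rewrite invr_gt0.
have h2 : - ln s <= s^-1 - 1.
  by rewrite -lnV ?posrE // lerBrDl; apply: le_trans (expR_ge1Dx _) _; rewrite lnK.
have sV1 : s * s^-1 = 1 by rewrite mulfV // gt_eqF.
move: (s^-1) sV sV1 h1 h2 => r r0 sr h1 h2.
have [s1|s1] := leP 1 s.
  have r1 : r <= 1 by nra.
  have l0 : 0 <= ln s by exact: ln_ge0.
  by nra.
have r1 : 1 <= r by nra.
have l0 : ln s <= 0 by apply: ln_le0; exact: ltW.
by nra.
Qed.

(** Two steps of monotonicity from cos <= 1: first u - sin u >= 0 for u >= 0, then the claim, whose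
    derivative this is. *)
Lemma cos_ge x : 1 - x ^+ 2 / 2 <= cos x.
Proof.
have H y : 0 <= y -> 1 - y ^+ 2 / 2 <= cos y.
  move=> y0.
  have dF (u : R) : is_derive u 1 (fun u => cos u - 1 + 2^-1 * (u * u)) (u - sin u).
    apply: isd_eq (isdD (isdB (isd_cos (isd_id u)) (isd_cst u 1))
      (isdMl 2^-1 (isdM (isd_id u) (isd_id u)))) _; by field.
  have dG (u : R) : is_derive u 1 (fun u => u - sin u) (1 - cos u).
    by apply: isd_eq (isdB (isd_id u) (isd_sin (isd_id u))) _; rewrite mulr1.
  have incr (F f : R -> R) : (forall u : R, is_derive u 1 F (f u)) ->
      (forall u : R, 0 <= u -> 0 <= f u) -> forall u : R, 0 <= u -> F 0 <= F u.
    move=> dFf f0 u u0.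
    have [c] : exists2 c, c \in `[0, u]%R & F u - F 0 = f c * (u - 0).
      apply: MVT_segment => //; apply: derivable_within_continuous => v _.
      by have [] := dFf v.
    rewrite in_itv /= => /andP[c0 _] E.
    by rewrite -subr_ge0 E subr0 mulr_ge0 // f0.
  have G0 (u : R) : 0 <= u -> 0 <= u - sin u.
    move=> u0; have := incr _ _ dG _ u u0; rewrite sin0 subr0; apply => v _.
    by rewrite subr_ge0 cos_le1.
  have := incr _ _ dF G0 y y0; rewrite /= cos0 subrr mulr0 mulr0 addr0.
  rewrite expr2; lra.
have [x0|x0] := leP 0 x; first exact: H.
by rewrite -(cosN x) -(sqrrN x); apply: H; rewrite oppr_ge0 ltW.
Qed.

Definition rgamma p : R := \int[mu]_(u in D) (u `^ (p - 1) * expR (- u)).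

Lemma Euler_Gamma_real p : Euler_Gamma p%:C = (rgamma p)%:C.
Proof.
rewrite Euler_GammaE -cintegral_real; apply: eq_cintegral => u.
by rewrite inE /= in_itv /= andbT => u0; rewrite -rmorphB rcpow_real // rmorphM.
Qed.

Lemma rgammaS p : 0 < p -> rgamma (p + 1) = p * rgamma p.
Proof.
move=> p0; apply: complexI; rewrite rmorphM /= -!Euler_Gamma_real rmorphD /=.
exact: Euler_GammaS.
Qed.

(** For arguments at least 1 the integrand is at least e^(-2) on [1, 2]; the remaining arguments
    follow from the functional equation. *)
Lemma rgamma_gt0 p : 0 < p -> 0 < rgamma p.
Proof.
have H q : 1 <= q -> 0 < rgamma q.
  move=> q1; have q0 : 0 < q by apply: lt_le_trans q1.
  have mI : measurable (`[1, 2]%classic : set R) by exact: measurable_itv.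
  have ID : (`[1, 2]%classic : set R) `<=` D.
    by move=> u; rewrite /= !in_itv /= andbT => /andP[+ _]; exact: lt_le_trans.
  have ci : mu.-integrable `[1, 2] (EFin \o (fun=> expR (- 2) : R)).
    apply: measurable_bounded_integrable => //; last exact: bounded_cst.
    by change (mu `[1%R, 2%R] < +oo)%E; rewrite lebesgue_measure_itv /= lte_fin ltr1n -EFinB ltry.
  have E : expR (- 2) = \int[mu]_(u in `[1, 2]) (expR (- 2) : R).
    have := @Rintegral_cst _ _ _ mu `[1, 2] mI (expR (- 2)) => ->.
    by change (expR (- 2) = expR (- 2) * fine (lebesgue_measure (`[1, 2]%classic : set R)));
      rewrite lebesgue_measure_itv /= lte_fin ltr1n /= (_ : 2 - 1 = 1 :> R) ?mulr1 //; ring.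
  apply: (@lt_le_trans _ _ (expR (- 2))); first exact: expR_gt0.
  have ig := integrable_gamma q0; 
  have ig' : mu.-integrable `[1, 2] (EFin \o (fun u : R => u `^ (q - 1) * expR (- u))).
    by apply: integrableS ig.
  rewrite E /rgamma; apply: (@le_trans _ _ (\int[mu]_(u in `[1, 2]) (u `^ (q - 1) * expR (- u)))).
    apply: le_Rintegral => //.
    move=> u; rewrite /= in_itv /= => /andP[u1 u2].
    rewrite -[leLHS]mul1r ler_pM ?expR_ge0 //; last by rewrite ler_expR lerN2.
    by rewrite -[leLHS](powRr0 u) ler_powR // subr_ge0.
  rewrite /Rintegral fine_le ?integrable_fin_num //.
  apply: ge0_subset_integral => //; first exact: measurable_int ig.
  by move=> u _; rewrite lee_fin mulr_ge0 ?powR_ge0 ?expR_ge0.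
move=> p0; have : 0 < rgamma (p + 1) by apply: H; rewrite lerDr ltW.
by rewrite rgammaS // pmulr_rgt0.
Qed.

(* cos x >= 1 - x^2 / 2 is applied to x = t ln (u / (q + 1)); the bound is positive
   for large q, so that by the functional equation Gamma has no zero. *)
Lemma Re_Euler_Gamma_ge q t : 0 < q ->
  rgamma (q + 1) * (1 - 2 * t ^+ 2 / q) <=
  Re (rcpow (q + 1) (0 +i* (- t)) * Euler_Gamma ((q + 1) +i* t)).
Proof.
move=> q0; have q1 : 0 < q + 1 by rewrite addr_gt0.
have q2 : 0 < q + 1 + 1 by rewrite addr_gt0.
have z0 : 0 < Re ((q + 1) +i* t) by [].
have iL := (cintegrableZl (rcpow (q + 1) (0 +i* - t)) mD (cintegrable_gamma z0)).1.
rewrite Euler_GammaE -(cintegralZl _ mD (cintegrable_gamma z0)).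
have i0 := integrable_gamma q0; have i1 := integrable_gamma q1; have i2 := integrable_gamma q2.
pose g p u : R := u `^ (p - 1) * expR (- u).
have iA := @integrableZl _ _ _ mu D mD (1 + 4 * t ^+ 2) _ i1.
have iB := @integrableZl _ _ _ mu D mD (2 * t ^+ 2 / (q + 1)) _ i2.
have iC := @integrableZl _ _ _ mu D mD (2 * t ^+ 2 * (q + 1)) _ i0.
have iAB := @integrableB _ _ _ mu D mD _ _ iA iB.
have iABC := @integrableB _ _ _ mu D mD _ _ iAB iC.
(* This is u^q e^(-u) (1 - 2 t^2 (y - 2 + 1 / y)) with y = u / (q + 1), expanded in powers of u; the
   factor 2 is 1 / 2 from [cos_ge] times 4 from [ln_sqr_le]. By the functional equation its integral
   is the Gamma value at q + 1 times 1 + 4 t^2 - 2 t^2 - 2 t^2 (q + 1) / q = 1 - 2 t^2 / q. *)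
apply: (@le_trans _ _ (\int[mu]_(u in D) ((1 + 4 * t ^+ 2) * g (q + 1) u -
    2 * t ^+ 2 / (q + 1) * g (q + 1 + 1) u - 2 * t ^+ 2 * (q + 1) * g q u))).
  have E1 := @RintegralB _ _ _ mu D _ _ mD iAB iC; have E2 := @RintegralB _ _ _ mu D _ _ mD iA iB.
  have Z k p (ip : mu.-integrable D (EFin \o g p)) : \int[mu]_(u in D) (k * g p u) = k * rgamma p.
    exact: (@RintegralZl _ _ _ mu D (g p) k mD ip).
  have -> : \int[mu]_(u in D) ((1 + 4 * t ^+ 2) * g (q + 1) u -
      2 * t ^+ 2 / (q + 1) * g (q + 1 + 1) u - 2 * t ^+ 2 * (q + 1) * g q u) =
      \int[mu]_(u in D) ((1 + 4 * t ^+ 2) * g (q + 1) u) -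
      \int[mu]_(u in D) (2 * t ^+ 2 / (q + 1) * g (q + 1 + 1) u) -
      \int[mu]_(u in D) (2 * t ^+ 2 * (q + 1) * g q u).
    by rewrite -[X in X - _]E2; exact: E1.
  rewrite !Z // (rgammaS q1) (rgammaS q0) le_eqVlt; apply/orP; left; apply/eqP.
  by field; rewrite !gt_eqF.
apply: le_Rintegral => // u uD; cbv beta.
have u0 : 0 < u by move: uD; rewrite /= in_itv /= andbT.
have y0 : 0 < u / (q + 1) by rewrite divr_gt0.
have E : Re (rcpow (q + 1) (0 +i* - t) * (rcpow u (((q + 1) +i* t) - 1) * (expR (- u))%:C)) =
    u `^ q * expR (- u) * cos (t * ln (u / (q + 1))).
  have -> : (q + 1) +i* t - 1 = q%:C + (0 +i* t) by apply: complexP; rewrite !ReImE /=; ring.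
  rewrite (_ : 0 +i* - t = - (0 +i* t)); last by apply: complexP; rewrite !ReImE /= ?oppr0.
  rewrite rcpowD rcpow_real // (_ : _ * _ = (u `^ q * expR (- u))%:C *
    (rcpow u (0 +i* t) * rcpow (q + 1) (- (0 +i* t)))); last by rewrite rmorphM /=; ring.
  by rewrite -rcpow_div // ReM /= !mul0r !mulr0 !subr0 add0r expR0 mul1r.
rewrite E; have W0 : 0 <= u `^ q * expR (- u) by rewrite mulr_ge0 ?powR_ge0 ?expR_ge0.
have -> : g (q + 1) u = u `^ q * expR (- u) by rewrite /g addrK.
have -> : g (q + 1 + 1) u = u * (u `^ q * expR (- u)).
  by rewrite /g addrK powRD ?(lt0r_neq0 u0) ?implybT // powRr1 ?(ltW u0) // [_ * u]mulrC mulrA.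
have -> : g q u = u^-1 * (u `^ q * expR (- u)).
  rewrite /g powRD ?(lt0r_neq0 u0) ?implybT // powR_inv1 ?(ltW u0) //; ring.
move: (_ * expR _) W0 => W W0.
apply: (@le_trans _ _ (W * (1 - 2 * t ^+ 2 * (u / (q + 1) - 2 + (u / (q + 1))^-1)))).
  rewrite le_eqVlt; apply/orP; left; apply/eqP; field.
  by rewrite !gt_eqF.
rewrite ler_wpM2l //; apply: le_trans (cos_ge _).
rewrite exprMn lerD2l lerN2; have := ln_sqr_le y0.
move: (ln _ ^+ 2) (_ - 2 + _) (t ^+ 2) (sqr_ge0 t) => L Y T T0 LY.
have : T * L <= T * (4 * Y) by rewrite ler_wpM2l.
lra.
Qed.

(** A zero at z would be a zero at every z + n, against the lower bound. The result permits the
    divisions by Gamma in [cintegral_beta] and [mellin_hfun]. *)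
Lemma Euler_Gamma_neq0 z : 0 < Re z -> Euler_Gamma z != 0.
Proof.
case: z => p t /= p0; apply/eqP => G0.
have Gn n : Euler_Gamma ((p + n%:R) +i* t) = 0.
  elim: n => [|n IH]; first by rewrite addr0.
  have -> : (p + n.+1%:R) +i* t = ((p + n%:R) +i* t) + 1.
    by apply: complexP; rewrite !ReImE /= ?addr0 // -natr1 addrA.
  by rewrite Euler_GammaS ?IH ?mulr0 //= ltr_pwDl.
pose n := (Num.truncn (2 * t ^+ 2)).+1.
have nt : 2 * t ^+ 2 < n%:R by rewrite truncnS_gt.
have q0 : 0 < p + n%:R :> R by rewrite ltr_pwDl.
have := Re_Euler_Gamma_ge t q0.
have -> : (p + n%:R + 1) +i* t = (p + n.+1%:R) +i* t by rewrite -natr1 addrA.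
rewrite Gn mulr0 /= leNgt mulr_gt0 //; first by rewrite rgamma_gt0 // addr_gt0.
by rewrite subr_gt0 ltr_pdivrMr // mul1r (lt_trans nt) // ltrDr.
Qed.

Lemma mem_pos x : x \in D -> 0 < x.
Proof. by rewrite inE /= in_itv /= andbT. Qed.

Lemma integrable_gamma_scale p k : 0 < p -> 0 < k ->
  mu.-integrable D (EFin \o (fun v => v `^ (p - 1) * expR (- (k * v)))).
Proof.
move=> p0 k0; have [+ _] := @cintegrable_gamma_scale p%:C k p0 k0.
apply: eq_integrable => // v /mem_pos v0; congr EFin.
by rewrite -rmorphB rcpow_real //= mulr0 subr0.
Qed.

Lemma Rintegral_gamma_scale p k : 0 < p -> 0 < k ->
  \int[mu]_(v in D) (v `^ (p - 1) * expR (- (k * v))) = k `^ (- p) * rgamma p.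
Proof.
move=> p0 k0; apply: complexI; rewrite rmorphM /= -[(rgamma p)%:C]Euler_Gamma_real
  -[(k `^ _)%:C]rcpow_real //.
rewrite rmorphN -gamma_scale // -cintegral_real; apply: eq_cintegral => v.
by rewrite inE /= in_itv /= andbT => v0; rewrite rmorphM /= -rcpow_real // rmorphB.
Qed.

(** Fubini for the kernel u^(z+w-1) v^(z-1) e^(-u(1+v)): integrating in u first gives the Beta
    integrand times Gamma(z + w), integrating in v first gives Gamma(z) times the integrand of
    Gamma(w). Integrability also comes out of Fubini, after division by Gamma(z + w). *)
Lemma cintegral_beta z w : 0 < Re z -> 0 < Re w ->
  cintegrable D (fun v => rcpow v (z - 1) * rcpow (1 + v) (- (z + w))) /\
  cintegral D (fun v => rcpow v (z - 1) * rcpow (1 + v) (- (z + w))) * Euler_Gamma (z + w) =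
  Euler_Gamma z * Euler_Gamma w.
Proof.
move=> z0 w0; have zw0 : 0 < Re (z + w) by rewrite !ReImE addr_gt0.
pose k (x : R * R) : R[i] :=
  rcpow x.1 (z + w - 1) * (rcpow x.2 (z - 1) * (expR (- (x.1 * (1 + x.2))))%:C).
have mk : cmeasurable setT k.
  apply: cmeasurableM; first by apply: cmeasurable_rcpow => //; exact: cmeasurable_cst.
  apply: cmeasurableM; first by apply: cmeasurable_rcpow => //; exact: cmeasurable_cst.
  apply: cmeasurable_real; apply: measurable_expRN; apply: measurable_funM => //.
  by apply: measurable_funD.
have kE u v : k (u, v) = rcpow u (z + w - 1) * (expR (- u))%:C * (rcpow v (z - 1) * (expR (- (u * v)))%:C).
  by rewrite /k /= mulrDr mulr1 opprD expRD rmorphM /=; ring.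
have kE' u v : k (u, v) = rcpow v (z - 1) * (rcpow u (z + w - 1) * (expR (- ((1 + v) * u)))%:C).
  by rewrite /k /= (mulrC u); ring.
have inner u : 0 < u -> cintegral D (fun v => k (u, v)) =
    Euler_Gamma z * (rcpow u (w - 1) * (expR (- u))%:C).
  move=> u0; rewrite (eq_cintegral (g := fun v => rcpow u (z + w - 1) * (expR (- u))%:C *
    (rcpow v (z - 1) * (expR (- (u * v)))%:C))); last by move=> v _; exact: kE.
  rewrite (cintegralZl _ mD (cintegrable_gamma_scale z0 u0)) gamma_scale //.
  rewrite (_ : z + w - 1 = (w - 1) + z) ?rcpowD; last by ring.
  rewrite rcpowN; field; exact: rcpow_neq0.
have inner' v : 0 < v -> cintegral D (fun u => k (u, v)) =
    rcpow v (z - 1) * rcpow (1 + v) (- (z + w)) * Euler_Gamma (z + w).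
  move=> v0; have v1 : 0 < 1 + v by rewrite addr_gt0.
  rewrite (eq_cintegral (g := fun u => rcpow v (z - 1) *
    (rcpow u (z + w - 1) * (expR (- ((1 + v) * u)))%:C))); last by move=> u _; exact: kE'.
  by rewrite (cintegralZl _ mD (cintegrable_gamma_scale zw0 v1)) gamma_scale // mulrA.
have fin : (\int[mu]_(u in D) \int[mu]_(v in D) (cabs (k (u, v)))%:E < +oo)%E.
  have ig := @integrableZl _ _ _ mu D mD (rgamma (Re z)) _ (integrable_gamma w0).
  suff -> : (\int[mu]_(u in D) \int[mu]_(v in D) (cabs (k (u, v)))%:E =
      \int[mu]_(u in D) ((rgamma (Re z))%:E * (EFin \o (fun x => x `^ (Re w - 1) * expR (- x))%R) u))%E.
    by have /integrable_fin_num := ig; rewrite fin_numElt => /(_ mD) /andP[].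
  apply: eq_integral => u /mem_pos u0.
  have igu := integrable_gamma_scale z0 u0.
  transitivity (\int[mu]_(v in D) ((u `^ (Re z + Re w - 1) * expR (- u))%:E *
      (EFin \o (fun v => v `^ (Re z - 1) * expR (- (u * v)))%R) v))%E.
    apply: eq_integral => v /mem_pos v0.
    by rewrite kE !cabsM !cabs_rcpow // !cabs_real !(ger0_norm (expR_ge0 _)) -EFinM !ReImE.
  rewrite (@integralZl _ _ _ mu D mD _ igu).
  rewrite -[X in (_ * X)%E]fineK; last exact: integrable_fin_num.
  have := Rintegral_gamma_scale z0 u0; rewrite /Rintegral => ->; rewrite -EFinM; congr EFin.
  rewrite (_ : Re z + Re w - 1 = Re z + (Re w - 1)); last by ring.
  rewrite powRD ?(lt0r_neq0 u0) ?implybT // powRN.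
  by field; rewrite gt_eqF // powR_gt0.
have [_ i2 e] := cintegral_fubini mD mD mk fin.
have ib : cintegrable D (fun v => rcpow v (z - 1) * rcpow (1 + v) (- (z + w))).
  apply: (eq_cintegrable mD _ (cintegrableZl (Euler_Gamma (z + w))^-1 mD i2)) => v /mem_pos v0.
  rewrite (inner' v v0); move: (Euler_Gamma _) (Euler_Gamma_neq0 zw0) => G G0.
  by rewrite mulrC mulfK.
split; first exact: ib.
rewrite -(cintegralZr _ mD ib).
rewrite (eq_cintegral (g := fun v => cintegral D (fun u => k (u, v)))); last first.
  by move=> v /mem_pos v0; rewrite (inner' v v0).
rewrite -e (Euler_GammaE w) -(cintegralZl _ mD (cintegrable_gamma w0)).
by apply: eq_cintegral => u /mem_pos u0; rewrite (inner u u0).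
Qed.

Lemma integrable_beta p q : 0 < p -> 0 < q ->
  mu.-integrable D (EFin \o (fun v => v `^ (p - 1) * (1 + v) `^ (- (p + q)))).
Proof.
move=> p0 q0; have [[+ _] _] := @cintegral_beta p%:C q%:C p0 q0.
apply: eq_integrable => // v /mem_pos v0; congr EFin.
have v1 : 0 < 1 + v by rewrite addr_gt0.
by rewrite -rmorphB -rmorphD -rmorphN !rcpow_real //= mulr0 subr0.
Qed.

End EulerGamma.

(** * The H function *)

Section FoxHValue.
Variable R : realType.
Local Notation mu := (@lebesgue_measure R).
Local Notation D := (`]0%R, +oo[%classic : set R).
Implicit Types (x y p q k c : R) (z w s t : R[i]).

Let mD : measurable D. Proof. exact: measurable_itv. Qed.

Lemma powR_expRN_scale_le q a x : 0 < q -> 0 < a -> 0 < x ->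
  x `^ q * expR (- (a * x)) <= (q / a) `^ q.
Proof.
move=> q0 a0 x0; have ax : 0 < a * x by rewrite mulr_gt0.
have aV : 0 <= a^-1 by rewrite invr_ge0 ltW.
rewrite (powRM _ (ltW q0) aV) (_ : x = (a * x) * a^-1); last by field; rewrite gt_eqF.
rewrite (powRM _ (ltW ax) aV) mulrAC ler_wpM2r ?powR_ge0 //.
rewrite (_ : a * (a * x / a) = a * x); last by field; rewrite gt_eqF.
exact: powR_expRN_le.
Qed.

(** A mean value estimate drawn from 1 + x <= e^x alone; [k] is any common lower bound of the two
    exponents. *)
Lemma expRN_lipschitz a b k : k <= a -> k <= b ->
  `|expR (- a) - expR (- b)| <= `|a - b| * expR (- k).
Proof.
wlog ab : a b / a <= b.
  move=> H ka kb; have [ab|/ltW ab] := leP a b; first exact: H.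
  by rewrite distrC (distrC a); exact: H.
move=> ka kb; have e1 : expR (- b) <= expR (- a) by rewrite ler_expR lerN2.
rewrite ger0_norm ?subr_ge0 // distrC ger0_norm ?subr_ge0 //.
have -> : expR (- b) = expR (- a) * expR (a - b) by rewrite -expRD; congr expR; ring.
have := expR_ge1Dx (a - b) => e2.
have e3 : expR (- a) <= expR (- k) by rewrite ler_expR lerN2.
have e0 := expR_gt0 (- a).
apply: (@le_trans _ _ ((b - a) * expR (- a))); last by rewrite ler_wpM2l // subr_ge0.
nra.
Qed.

Lemma integrable_cabs (A : set R) (f : R -> R[i]) : measurable A -> cintegrable A f ->
  mu.-integrable A (EFin \o (fun x => cabs (f x))).
Proof.
move=> mA fi; have [fR fI] := fi; have mf := cmeasurable_int fi.
have iS := @integrableD _ _ _ mu A mA _ _ (@integrable_abse _ _ _ mu A _ fR) (@integrable_abse _ _ _ mu A _ fI).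
apply: le_integrable iS => //; first by apply/measurable_EFinP; exact: measurable_cabs.
move=> x _; rewrite /= lee_fin ger0_norm ?cabs_ge0 // ger0_norm ?addr_ge0 //.
exact: cabs_le_ReIm.
Qed.

Lemma eq_line_integral (F G : R[i] -> R[i]) c v :
  (forall y, F (c +i* y) = G (c +i* y)) -> is_line_integral F c v -> is_line_integral G c v.
Proof.
move=> FG; rewrite /is_line_integral (_ : (fun y => F (c +i* y)) = (fun y => G (c +i* y))) //.
exact/funext.
Qed.

Section HFun.
Variables (alpha gamma : R) (s : R[i]).
Hypotheses (alpha0 : 0 < alpha) (gamma0 : 0 < gamma).

Definition hweight x : R[i] := rcpow x (alpha%:C - 1) * rcpow (1 + x) (s - 1).

(** The integral h_j of the overview without its factor 1 / Gamma(alpha / gamma), as a function of y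
    in the place of beta mu^gamma, since it is in this variable that the Mellin transform is
    taken. *)
Definition hfun y : R[i] :=
  cintegral D (fun v => hweight v * (expR (- (y * v `^ gamma)))%:C).

(* The separating lines of the H function, see foxH_contourP. *)
Definition hstrip c := [/\ 0 < c, (Re s + alpha - 1) / gamma < c & c < alpha / gamma].

Lemma cmeasurable_hweight : cmeasurable setT hweight.
Proof.
by apply: cmeasurableM; apply: cmeasurable_rcpow;
  do ?[exact: cmeasurable_cst|exact: measurable_funD].
Qed.

Lemma cabs_hweight v : 0 < v -> cabs (hweight v) = v `^ (alpha - 1) * (1 + v) `^ (Re s - 1).
Proof. by move=> v0; rewrite cabsM !cabs_rcpow ?addr_gt0 // !ReImE. Qed.

(** A Beta integrand with parameters alpha - gamma c and 1 - Re s - alpha + gamma c; two of the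
    inequalities of [hstrip] say that these are positive. *)
Lemma integrable_hweight c : hstrip c ->
  mu.-integrable D (EFin \o (fun v => v `^ (alpha - gamma * c - 1) * (1 + v) `^ (Re s - 1))).
Proof.
move=> [c0 c1 c2].
have p0 : 0 < alpha - gamma * c by rewrite subr_gt0 mulrC -ltr_pdivlMr.
have q0 : 0 < 1 - Re s - alpha + gamma * c.
  by move: c1; rewrite ltr_pdivrMr // (mulrC c); lra.
have := integrable_beta p0 q0.
by rewrite (_ : - (alpha - gamma * c + (1 - Re s - alpha + gamma * c)) = Re s - 1) //; ring.
Qed.

(** With w = v^gamma, the product w^(q+c) e^(-y w) is bounded, which leaves w^(-c) times the weight.
    The case q = 0 is the integrand of [hfun]; the case q = 1 majorizes its difference quotients in
    y. *)
Lemma cintegrable_hfun_powR c q y : hstrip c -> 0 <= q -> 0 < y ->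
  cintegrable D (fun v => hweight v * ((v `^ gamma) `^ q * expR (- (y * v `^ gamma)))%:C).
Proof.
move=> hc q0 y0; have qc : 0 < q + c by case: hc => c0 _ _; rewrite ltr_wpDl.
have ih := @integrableZl _ _ _ mu D mD (((q + c) / y) `^ (q + c)) _ (integrable_hweight hc).
apply: (cintegrable_le mD (h := fun v => ((q + c) / y) `^ (q + c) *
  (v `^ (alpha - gamma * c - 1) * (1 + v) `^ (Re s - 1)))).
- apply: cmeasurableM; first by apply: cmeasurableS cmeasurable_hweight.
  apply: cmeasurable_real; apply: measurable_funTS; apply: measurable_funM.
    exact: (measurableT_comp (@measurable_powR R q) (@measurable_powR R gamma)).
  by apply: measurable_expRN; apply: measurable_funM => //; exact: measurable_powR.
- exact: ih.
move=> v /mem_set /mem_pos v0; have w0 : 0 < v `^ gamma by rewrite powR_gt0.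
rewrite cabsM cabs_hweight // cabs_real ger0_norm ?mulr_ge0 ?powR_ge0 ?expR_ge0 //.
have -> : (v `^ gamma) `^ q = (v `^ gamma) `^ (q + c) * v `^ (- (gamma * c)).
  rewrite -!powRrM -powRD ?(lt0r_neq0 v0) ?implybT //; congr (_ `^ _); ring.
rewrite (_ : alpha - gamma * c - 1 = (alpha - 1) - gamma * c); last by ring.
rewrite [v `^ (alpha - 1 - _)]powRD ?(lt0r_neq0 v0) ?implybT //.
have := powR_expRN_scale_le qc y0 w0.
set A := v `^ (alpha - 1); set B := (1 + v) `^ _; set C := v `^ (- _).
set E := expR _; set P := _ `^ (q + c); set Q := _ `^ (q + c) => PQ.
rewrite (_ : A * B * (P * C * E) = P * E * (A * C * B)); last by ring.
by rewrite ler_wpM2r // !mulr_ge0 ?powR_ge0.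
Qed.

Lemma cintegrable_hfun c y : hstrip c -> 0 < y ->
  cintegrable D (fun v => hweight v * (expR (- (y * v `^ gamma)))%:C).
Proof.
move=> hc y0; apply: (eq_cintegrable mD _ (cintegrable_hfun_powR hc (lexx 0) y0)) => v _.
by rewrite powRr0 mul1r.
Qed.

(** For |y - x| < x / 2 both exponents stay above (x / 2) v^gamma, so [expRN_lipschitz] bounds the
    difference of the integrands by |y - x| times the integrable function for q = 1 at x / 2. *)
Lemma locally_lipschitz_hfun c x : hstrip c -> 0 < x ->
  locally_lipschitz (fun y => Re (hfun y)) x /\ locally_lipschitz (fun y => Im (hfun y)) x.
Proof.
move=> hc x0; have x2 : 0 < x / 2 by rewrite divr_gt0.
have iL := integrable_cabs mD (cintegrable_hfun_powR hc ler01 x2).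
have key (f : R -> R -> R) : (forall y, 0 < y -> mu.-integrable D (EFin \o f y)) ->
    (forall y v, 0 < v -> `|f y v - f x v| <=
      cabs (hweight v) * `|expR (- (y * v `^ gamma)) - expR (- (x * v `^ gamma))|) ->
    locally_lipschitz (fun y => \int[mu]_(v in D) f y v) x.
  move=> fi fle; exists (\int[mu]_(v in D) cabs (hweight v * ((v `^ gamma) `^ 1 *
    expR (- (x / 2 * v `^ gamma)))%:C)), (x / 2); split=> // y xy.
  have yx2 : x / 2 <= y by move: xy; rewrite ltr_norml; lra.
  have y0 : 0 < y by apply: lt_le_trans yx2.
  have iB := @integrableB _ _ _ mu D mD _ _ (fi y y0) (fi x x0).
  have := @RintegralB _ _ _ mu D _ _ mD (fi y y0) (fi x x0) => /= <-.
  apply: le_trans (@le_normr_Rintegral _ _ _ mu D _ mD iB) _.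
  have iZ := @integrableZl _ _ _ mu D mD `|y - x| _ iL.
  rewrite mulrC; have := @RintegralZl _ _ _ mu D _ `|y - x| mD iL => <-.
  have iA := @integrable_abse _ _ _ mu D _ iB.
  apply: le_Rintegral => //.
  move=> v vD; cbv beta; have v0 : 0 < v by apply: mem_pos; rewrite inE.
  have w0 : 0 < v `^ gamma by rewrite powR_gt0.
  apply: le_trans (fle y v v0) _; rewrite cabsM cabs_real powRr1 ?(ltW w0) //.
  rewrite [`|v `^ gamma * _|]ger0_norm ?mulr_ge0 ?expR_ge0 ?(ltW w0) // mulrCA ler_wpM2l ?cabs_ge0 //.
  apply: le_trans (expRN_lipschitz (k := x / 2 * v `^ gamma) _ _) _.
  - by rewrite ler_pM2r.
  - by rewrite ler_pM2r //; lra.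
  by rewrite -mulrBl normrM (gtr0_norm w0) mulrA.
split; apply: key => [y y0|y v v0].
- by have [] := cintegrable_hfun hc y0.
- move: (hweight v) => w; rewrite !ReM /= !mulr0 !subr0 -mulrBr normrM ler_wpM2r //;
  exact: Re_le_cabs.
- by have [] := cintegrable_hfun hc y0.
- move: (hweight v) => w; rewrite !ImM /= !mulr0 !add0r -mulrBr normrM ler_wpM2r //;
  exact: Im_le_cabs.
Qed.

(** Integrating in y first gives Gamma(t) v^(- gamma t), and what remains in v is a Beta integral
    with parameters alpha - gamma t and 1 - s - alpha + gamma t. Their sum 1 - s is free of t, which
    explains the entry of slope 0 in the denominator of the H function. *)
Lemma mellin_hfun t : hstrip (Re t) ->
  cintegrable D (fun y => hfun y * rcpow y (t - 1)) /\
  cintegral D (fun y => hfun y * rcpow y (t - 1)) =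
  Euler_Gamma t * Euler_Gamma (alpha%:C - gamma%:C * t) *
  Euler_Gamma (1 - s - alpha%:C + gamma%:C * t) / Euler_Gamma (1 - s).
Proof.
move=> ht; have [c0 c1 c2] := ht.
pose k (p : R * R) : R[i] :=
  hweight p.1 * (rcpow p.2 (t - 1) * (expR (- (p.1 `^ gamma * p.2)))%:C).
have mk : cmeasurable setT k.
  apply: cmeasurableM.
    have [hR hI] := cmeasurable_hweight.
    by split; [exact: (measurableT_comp hR measurable_fst)|exact: (measurableT_comp hI measurable_fst)].
  apply: cmeasurableM; first by apply: cmeasurable_rcpow => //; exact: cmeasurable_cst.
  apply: cmeasurable_real; apply: measurable_expRN; apply: measurable_funM => //.
  exact: (measurableT_comp (@measurable_powR R gamma) measurable_fst).
have z0 : 0 < Re (alpha%:C - gamma%:C * t).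
  by rewrite !ReImE /= mul0r subr0 subr_gt0 mulrC -ltr_pdivlMr.
have w0 : 0 < Re (1 - s - alpha%:C + gamma%:C * t).
  by move: c1; rewrite !ReImE /= mul0r subr0 ltr_pdivrMr // (mulrC (Re t)); lra.
have zwE : alpha%:C - gamma%:C * t + (1 - s - alpha%:C + gamma%:C * t) = 1 - s by ring.
have [ib be] := cintegral_beta z0 w0; rewrite zwE in ib be.
have zw0 : 0 < Re (1 - s) by rewrite -zwE ReD addr_gt0.
have outer v : 0 < v -> cintegral D (fun y => k (v, y)) =
    Euler_Gamma t * (rcpow v (alpha%:C - gamma%:C * t - 1) * rcpow (1 + v) (- (1 - s))).
  move=> v0; have w1 : 0 < v `^ gamma by rewrite powR_gt0.
  rewrite /k /= (cintegralZl _ mD (cintegrable_gamma_scale c0 w1)) gamma_scale // /hweight.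
  rewrite rcpow_powR // (_ : alpha%:C - gamma%:C * t - 1 = (alpha%:C - 1) + gamma%:C * - t);
    last by ring.
  by rewrite (rcpowD v (alpha%:C - 1)) opprB; ring.
have inner y : 0 < y -> cintegral D (fun v => k (v, y)) = hfun y * rcpow y (t - 1).
  move=> y0; rewrite /hfun -(cintegralZr _ mD (cintegrable_hfun ht y0)).
  by apply: eq_cintegral => v _; rewrite /k /= (mulrC y); ring.
have fin : (\int[mu]_(v in D) \int[mu]_(y in D) (cabs (k (v, y)))%:E < +oo)%E.
  have ig := @integrableZl _ _ _ mu D mD (rgamma (Re t)) _ (integrable_hweight ht).
  suff -> : (\int[mu]_(v in D) \int[mu]_(y in D) (cabs (k (v, y)))%:E =
      \int[mu]_(v in D) ((rgamma (Re t))%:E * (EFin \o (fun v =>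
        v `^ (alpha - gamma * Re t - 1) * (1 + v) `^ (Re s - 1))%R) v))%E.
    by have /integrable_fin_num := ig; rewrite fin_numElt => /(_ mD) /andP[].
  apply: eq_integral => v /mem_pos v0; have w1 : 0 < v `^ gamma by rewrite powR_gt0.
  have igu := integrable_gamma_scale c0 w1.
  transitivity (\int[mu]_(y in D) ((v `^ (alpha - 1) * (1 + v) `^ (Re s - 1))%:E *
      (EFin \o (fun y => y `^ (Re t - 1) * expR (- (v `^ gamma * y)))%R) y))%E.
    apply: eq_integral => y /mem_pos y0.
    by rewrite /k cabsM cabs_hweight // cabsM cabs_rcpow // cabs_real (ger0_norm (expR_ge0 _)) -EFinM !ReImE.
  rewrite (@integralZl _ _ _ mu D mD _ igu).
  rewrite -[X in (_ * X)%E]fineK; last exact: integrable_fin_num.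
  have := Rintegral_gamma_scale c0 w1; rewrite /Rintegral => ->; rewrite -!EFinM; congr EFin.
  rewrite (_ : alpha - gamma * Re t - 1 = alpha - 1 + gamma * - Re t); last by ring.
  by rewrite -powRrM [v `^ (alpha - 1 + _)]powRD ?(lt0r_neq0 v0) ?implybT //; ring.
have [_ i2 e] := cintegral_fubini mD mD mk fin.
split.
  by apply: (eq_cintegrable mD _ i2) => y /mem_pos y0; exact: inner.
rewrite (_ : cintegral D (fun y => hfun y * _) =
    cintegral D (fun y => cintegral D (fun v => k (v, y)))); last first.
  by apply: eq_cintegral => y /mem_pos y0; rewrite (inner y y0).
rewrite -e (_ : cintegral D _ = Euler_Gamma t *
    cintegral D (fun v => rcpow v (alpha%:C - gamma%:C * t - 1) * rcpow (1 + v) (- (1 - s))));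
      last first.
  rewrite -(cintegralZl _ mD ib); apply: eq_cintegral => v /mem_pos v0; exact: outer.
move: be (Euler_Gamma_neq0 zw0).
move: (Euler_Gamma (1 - s)) (Euler_Gamma t) (Euler_Gamma _) (Euler_Gamma _) (cintegral _ _).
by move=> G1 G2 G3 G4 C be G10; rewrite -mulrA -mulrA [X in _ = _ * X]mulrA -be mulfK.
Qed.

End HFun.

(** * Identification of the H function of a block *)

Section FoxValue.
Variables (alpha beta gamma m : R) (s : R[i]).
Hypotheses (alpha0 : 0 < alpha) (beta0 : 0 < beta) (gamma0 : 0 < gamma) (m0 : 0 < m).

Let p := block_H (gengamma_block alpha beta gamma m) s.

(** Re s < 1 places (Re s + alpha - 1) / gamma below alpha / gamma; the witness is the midpoint of
    the resulting strip. *)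
Lemma hstrip_ex : Re s < 1 -> exists c, hstrip alpha gamma s c.
Proof.
move=> s1; have ag0 : 0 < alpha / gamma by rewrite divr_gt0.
have h : Num.max 0 ((Re s + alpha - 1) / gamma) < alpha / gamma.
  by rewrite gt_max ag0 ltr_pM2r ?invr_gt0 //; lra.
exists (((Num.max 0 ((Re s + alpha - 1) / gamma)) + alpha / gamma) / 2).
split; last by move: (Num.max _ _) (alpha / gamma) h => A B; lra.
  apply: (@le_lt_trans _ _ (Num.max 0 ((Re s + alpha - 1) / gamma)));
    first by rewrite le_max lexx.
  by move: (Num.max _ _) (alpha / gamma) h => A B; lra.
apply: (@le_lt_trans _ _ (Num.max 0 ((Re s + alpha - 1) / gamma)));
  first by rewrite le_max lexx orbT.
by move: (Num.max _ _) (alpha / gamma) h => A B; lra.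
Qed.

(** For each of the three Gamma factors the pole with n = 0 is the one nearest to the line and gives
    one inequality of [hstrip]; the other poles lie farther on the same side. *)
Lemma foxH_contourP c : foxH_contour p c <-> hstrip alpha gamma s c.
Proof.
have gC : gamma%:C != 0 by apply/eqP => -[/eqP]; rewrite gt_eqF.
rewrite /p /foxH_contour /= /affine !rmorphD !rmorphN !rmorph0 !rmorph1 !mul0r !add0r.
split=> [[h1 h2 h3]|[c0 c1 c2]].
  split.
  - have /= := h1 0; apply; exists 0%N; rewrite mulr0 oppr0; ring.
  - have := h2 ((s + alpha%:C - 1) / gamma%:C).
    rewrite -[gamma%:C^-1]rmorphV ?unitfE ?gt_eqF // ReM /= mulr0 subr0 !ReImE /=.
    apply; exists 0%N; rewrite mulr0n oppr0; field; exact: gC.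
  - have := h3 (alpha / gamma)%:C; apply; exists 0%N.
    rewrite mulr0n oppr0 rmorphM fmorphV /=; field; exact: gC.
have Reg t : Re (gamma%:C * t) = gamma * Re t by rewrite ReM /= mul0r subr0.
have Ren n : Re (- n%:R : R[i]) = - n%:R.
  by rewrite ReN; congr (- _); rewrite -(rmorph_nat (real_complex R)).
split=> t [n tn].
- move/(congr1 (@Re _)): tn; rewrite Ren add0r mul1r => ->.
  by apply: le_lt_trans c0; rewrite oppr_le0.
- move/(congr1 (@Re _)): tn; rewrite Ren ReD Reg !ReImE /= => tn.
  apply: le_lt_trans c1; rewrite ler_pdivlMr // (mulrC (Re t)).
  by have : 0 <= n%:R :> R := ler0n _ _; lra.
- move/(congr1 (@Re _)): tn; rewrite Ren ReD ReN Reg !ReImE /= => tn.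
  apply: lt_le_trans c2 _; rewrite ler_pdivrMr // (mulrC (Re t)).
  by have : 0 <= n%:R :> R := ler0n _ _; lra.
Qed.

(** [mellin_inversion] for [hfun] divided by Gamma(alpha / gamma), at the point beta m^gamma: by
    [mellin_hfun] the integrand of the inversion is the integrand that defines the H function, on
    every separating line. *)
Lemma is_foxH_hfun : Re s < 1 ->
  is_foxH p (block_arg (gengamma_block alpha beta gamma m) s)
    (hfun alpha gamma s (beta * m `^ gamma) / Euler_Gamma (alpha / gamma)%:C).
Proof.
move=> s1; have x0 : 0 < beta * m `^ gamma by rewrite mulr_gt0 ?powR_gt0.
have ag0 : 0 < alpha / gamma by rewrite divr_gt0.
have argE : block_arg (gengamma_block alpha beta gamma m) s = (beta * m `^ gamma)%:C.
  rewrite /block_arg /affine /= !rmorph0 !mul0r !add0r rmorph1 cpow_real //.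
  exact: rcpow1.
rewrite argE; split.
- by split => /=; rewrite ?(ltW gamma0) ?ler01.
- by have [c hc] := hstrip_ex s1; exists c; apply/foxH_contourP.
move=> c /foxH_contourP hc; have [c0 c1 c2] := hc.
pose K := (Euler_Gamma (alpha / gamma)%:C)^-1.
(* Set to 0 off the positive half-line, because the inversion theorem asks for measurability on the
   whole line. *)
pose G x : R[i] := if 0 < x then hfun alpha gamma s x * K else 0.
have [ih _] := @mellin_hfun alpha gamma s gamma0 (c%:C) hc.
have iG : cintegrable D (fun x => K * (hfun alpha gamma s x * rcpow x (c%:C - 1))).
  exact: cintegrableZl mD ih.
have GE x : 0 < x -> G x = hfun alpha gamma s x * K by move=> x_0; rewrite /G x_0.
(* The measurability of [hfun] is read off from the integrability of its Mellin integrand, by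
   removing the power of x. *)
have mG : cmeasurable setT G.
  have mh : cmeasurable D G.
    have mr : cmeasurable D (fun x => rcpow x (1 - c%:C)).
      by apply: cmeasurable_rcpow; [exact: measurable_id|exact: cmeasurable_cst].
    have [hR hI] := cmeasurableM mr (cmeasurable_int iG).
    have E x : 0 < x -> rcpow x (1 - c%:C) * (K * (hfun alpha gamma s x * rcpow x (c%:C - 1))) = G x.
      move=> x_0; rewrite GE // (_ : 1 - c%:C = - (c%:C - 1)); last by ring.
      rewrite rcpowN; field; exact: rcpow_neq0.
    split; [apply: eq_measurable_fun hR|apply: eq_measurable_fun hI] => x /mem_pos x_0;
      by rewrite E.
  have [hR hI] := mh.
  split; [have := (measurable_restrictT _ mD).1 hR|have := (measurable_restrictT _ mD).1 hI];
    apply: eq_measurable_fun => x _; rewrite /patch; case: ifPn => //;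
    by rewrite notin_setE /= in_itv /= andbT => /negP /negbTE; rewrite /G => ->.
(* [hfun] is regular on the whole positive half-line; the exceptional point is put at -1, outside
   it. *)
have := @mellin_inversion R G c (- 1) (beta * m `^ gamma) x0.
rewrite GE // => H; apply: eq_line_integral (H _ mG _ _).
- move=> y; set t := c +i* y.
  have ht : hstrip alpha gamma s (Re t) by [].
  have [i e] := mellin_hfun gamma0 ht.
  have -> : cintegral D (fun x => G x * rcpow x (t - 1)) =
      K * cintegral D (fun x => hfun alpha gamma s x * rcpow x (t - 1)).
    rewrite -(cintegralZl _ mD i); apply: eq_cintegral => x /mem_pos x_0.
    by rewrite GE //; ring.
  rewrite e /foxH_integrand /p /= /affine cpow_real // !rmorph0 !rmorph1 !mul0r !add0r mul1r !addr0.
  have -> : (-1)%:C * s + (1 - alpha)%:C + gamma%:C * t = 1 - s - alpha%:C + gamma%:C * t.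
    by rewrite rmorphN rmorphB rmorph1; ring.
  have -> : 1 - (1 - alpha)%:C - gamma%:C * t = alpha%:C - gamma%:C * t.
    by rewrite rmorphB rmorph1; ring.
  have -> : (-1)%:C * s + 1 = 1 - s by rewrite rmorphN rmorph1; ring.
  rewrite !cGammaE /K //.
  + congr (_ * _); rewrite invfM.
    move: (Euler_Gamma t) (Euler_Gamma (1 - s)) (Euler_Gamma (alpha / gamma)%:C).
    move: (Euler_Gamma (alpha%:C - _)) (Euler_Gamma (1 - s - alpha%:C + _)) => A1 A2 A3 A4 A5.
    by move: (A4^-1) (A5^-1) => B4 B5; ring.
  + by rewrite !ReImE /= subr_gt0.
  + by rewrite !ReImE /= mul0r subr0 subr_gt0 mulrC -ltr_pdivlMr.
  + by move: c1; rewrite !ReImE /= mul0r subr0 ltr_pdivrMr // (mulrC c); lra.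
- by apply/eqP => E; move: x0; rewrite -E ltr0N1.
- have := integrable_cabs mD iG; apply: eq_integrable => // x /mem_pos x_0; congr EFin.
  by rewrite GE // !cabsM cabs_rcpow // !ReImE /=; ring.
have KE : K = ((rgamma (alpha / gamma))^-1)%:C by rewrite /K Euler_Gamma_real -fmorphV.
have LL (f g : R -> R) x : 0 < x -> locally_lipschitz f x ->
    (forall y, 0 < y -> g y = f y * (rgamma (alpha / gamma))^-1) -> locally_lipschitz g x.
  move=> x_0 [L [d [d0 fL]]] gE.
  exists (L * (rgamma (alpha / gamma))^-1), (Num.min d x); split; first by rewrite lt_min d0.
  move=> y; rewrite lt_min => /andP[yd yx].
  have y0 : 0 < y by move: yx; rewrite ltr_norml; lra.
  rewrite !gE // -mulrBl normrM mulrAC [X in _ * X]ger0_norm; last first.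
    by rewrite invr_ge0 ltW // rgamma_gt0.
  by rewrite ler_wpM2r ?fL // invr_ge0 ltW // rgamma_gt0.
move=> x x_0 _; have [h1 h2] := locally_lipschitz_hfun gamma0 hc x_0.
by split; [apply: LL x_0 h1 _|apply: LL x_0 h2 _] => y y0; rewrite GE // KE !ReImE /=; ring.
Qed.

End FoxValue.
End FoxHValue.

(** * Densities and multiplicative convolution *)

Section MultiplicativeConvolution.
Variable R : realType.
Local Notation mu := (@lebesgue_measure R).
Local Notation D := (`]0%R, +oo[%classic : set R).
Implicit Types (f g h p q : R -> R) (a b m n x y u : R).

Let mD : measurable D. Proof. exact: measurable_itv. Qed.

Definition lipschitz_on f a b := exists L, forall x y,
  a <= x <= b -> a <= y <= b -> `|f x - f y| <= L * `|x - y|.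

(* Densities on ]m, oo[; the class is closed under mconv. *)
Record mdensity m f : Prop := MDensity {
  mdensity_pos : 0 < m;
  mdensity_measurable : measurable_fun setT f;
  mdensity_ge0 : forall x, 0 <= f x;
  mdensity_supp : forall x, x <= m -> f x = 0;
  mdensity_int : (\int[mu]_(x in D) (f x)%:E = 1)%E;
  mdensity_lipschitz : forall a b, m < a -> lipschitz_on f a b }.

Definition mconv f g x : R :=
  if 0 < x then \int[mu]_(u in D) (u^-1 * (f (x * u^-1) * g u)) else 0.

Lemma measurable_mconv_kernel f g : measurable_fun setT f -> measurable_fun setT g ->
  measurable_fun setT (fun z : R * R => z.2^-1 * (f (z.1 * z.2^-1) * g z.2)).
Proof.
move=> mf mg; have mV : measurable_fun setT (fun z : R * R => z.2^-1).
  exact: measurable_inv measurable_snd.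
apply: measurable_funM => //; apply: measurable_funM;
  last exact: (measurableT_comp mg measurable_snd).
by apply: (measurableT_comp mf); apply: measurable_funM => //; exact: measurable_fst.
Qed.

Lemma measurable_mconv_integrand f g x : measurable_fun setT f -> measurable_fun setT g ->
  measurable_fun setT (fun u => u^-1 * (f (x * u^-1) * g u)).
Proof.
move=> mf mg; have mV : measurable_fun setT (fun u : R => u^-1) by exact: measurable_inv.
by apply: measurable_funM => //; apply: measurable_funM => //; apply: (measurableT_comp mf);
  exact: measurable_funM.
Qed.

(** The substitution u -> x / u is an inversion followed by a dilation, and du / u is invariant
    under both. *)
Lemma mconv_sym f g x : 0 < x -> measurable_fun setT f -> measurable_fun setT g ->
  (forall u, 0 <= f u) -> (forall u, 0 <= g u) ->
  (\int[mu]_(u in D) (u^-1 * (f (x * u^-1) * g u))%:E =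
   \int[mu]_(u in D) (u^-1 * (g (x * u^-1) * f u))%:E)%E.
Proof.
move=> x0 mf mg f0 g0.
have mV : measurable_fun setT (fun u : R => u^-1) by exact: measurable_inv.
pose F u : \bar R := (f (x * u^-1) * g u)%:E; pose G u : \bar R := (g (x * u^-1) * f u)%:E.
have mF : measurable_fun setT F.
  by apply/measurable_EFinP; apply: measurable_funM => //; apply: (measurableT_comp mf);
    exact: measurable_funM.
have mG : measurable_fun setT G.
  by apply/measurable_EFinP; apply: measurable_funM => //; apply: (measurableT_comp mg);
    exact: measurable_funM.
have F0 u : (0 <= F u)%E by rewrite lee_fin mulr_ge0.
have G0 u : (0 <= G u)%E by rewrite lee_fin mulr_ge0.
transitivity (\int[mu]_(u in D) ((u^-1)%:E * F u))%E; first by apply: eq_integral => u _;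
  rewrite EFinM.
rewrite -haar_inv //.
transitivity (\int[mu]_(u in D) ((u^-1)%:E * G u))%E; last by apply: eq_integral => u _;
  rewrite EFinM.
rewrite -(haar_scale x0 mG G0); apply: eq_integral => u /mem_pos u0; congr (_ * _)%E.
by rewrite /F /G invrK invfM mulrA mulfV ?gt_eqF // mul1r mulrC.
Qed.

(** On the support of p one has 1 / u <= 1 / n. This is used twice, for the weight 1 / u and for |x
    / u - y / u|, which gives the constant L / n^2, the mass of p being at most 1. The bounds on q
    are asked only at the points x / u that actually occur. *)
Lemma mconv_part p q n a b L M : 0 < n -> measurable_fun setT p -> measurable_fun setT q ->
  (forall u, 0 <= p u) -> mu.-integrable D (EFin \o p) -> (\int[mu]_(u in D) (p u) <= 1) ->
  (forall u, u <= n -> p u = 0) -> 0 <= L -> 0 <= M ->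
  (forall u x, p u != 0 -> a <= x <= b -> `|q (x * u^-1)| <= M) ->
  (forall u x y, p u != 0 -> a <= x <= b -> a <= y <= b ->
    `|q (x * u^-1) - q (y * u^-1)| <= L * `|x * u^-1 - y * u^-1|) ->
  (forall x, a <= x <= b -> mu.-integrable D (EFin \o (fun u => u^-1 * (q (x * u^-1) * p u)))) /\
  (forall x y, a <= x <= b -> a <= y <= b ->
    `|\int[mu]_(u in D) (u^-1 * (q (x * u^-1) * p u)) -
      \int[mu]_(u in D) (u^-1 * (q (y * u^-1) * p u))| <= L / n ^+ 2 * `|x - y|).
Proof.
move=> n0 mp mq p0 ip p1 pn L0 M0 qM qL.
have Vn u : p u != 0 -> 0 <= u^-1 <= n^-1.
  move=> pu; have nu : n < u by rewrite ltNge; apply: contra pu => /pn ->.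
  have u0 : 0 < u by apply: lt_trans nu.
  by rewrite invr_ge0 (ltW u0) lef_pV2 ?posrE // ltW.
have ix x : a <= x <= b -> mu.-integrable D (EFin \o (fun u => u^-1 * (q (x * u^-1) * p u))).
  move=> xab; apply: le_integrable (@integrableZl _ _ _ mu D mD (M / n) _ ip) => //.
    by apply/measurable_EFinP; apply: measurable_funTS; exact: measurable_mconv_integrand.
  move=> u _; rewrite /= lee_fin; have [->|pu] := eqVneq (p u) 0; first by rewrite !mulr0 normr0.
  have /andP[V0 V1] := Vn u pu.
  rewrite mulrA !normrM !(ger0_norm (p0 _)) ler_wpM2r //.
  rewrite (ger0_norm V0) (ger0_norm M0) mulrC ler_pM ?qM //.
  by rewrite [leRHS]ger0_norm ?invr_ge0 ?(ltW n0).
split=> // x y xab yab.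
have := @RintegralB _ _ _ mu D _ _ mD (ix x xab) (ix y yab) => /= <-.
have iB := @integrableB _ _ _ mu D mD _ _ (ix x xab) (ix y yab).
apply: le_trans (@le_normr_Rintegral _ _ _ mu D _ mD iB) _.
have iA := @integrable_abse _ _ _ mu D _ iB.
have iZ := @integrableZl _ _ _ mu D mD (L / n ^+ 2 * `|x - y|) _ ip.
have C0 : 0 <= L / n ^+ 2 * `|x - y| by rewrite !mulr_ge0 // invr_ge0 exprn_ge0 // ltW.
apply: (@le_trans _ _ (\int[mu]_(u in D) (L / n ^+ 2 * `|x - y| * p u))); last first.
  have := @RintegralZl _ _ _ mu D p (L / n ^+ 2 * `|x - y|) mD ip => ->.
  by rewrite ler_piMr.
apply: le_Rintegral => // u _; cbv beta.
have [->|pu] := eqVneq (p u) 0; first by rewrite !mulr0 subrr normr0.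
have /andP[V0 V1] := Vn u pu.
rewrite -mulrBr -mulrBl mulrA !normrM (ger0_norm (p0 _)) ler_wpM2r // (ger0_norm V0).
have := qL u x y pu xab yab; rewrite -mulrBl normrM (ger0_norm V0).
move: `|_ - q _| `|x - y| (normr_ge0 (x - y)) => Q X X0 QL.
apply: (@le_trans _ _ (u^-1 * (L * (X * u^-1)))); first by rewrite ler_wpM2l.
have -> : u^-1 * (L * (X * u^-1)) = (L * X) * (u^-1 * u^-1) by ring.
have -> : L / n ^+ 2 * X = (L * X) * (n^-1 * n^-1) by rewrite -exprVn; ring.
by rewrite ler_wpM2l ?mulr_ge0 // ler_pM.
Qed.

Definition clip x : R := Num.max 0 (Num.min 1 x).

Lemma clip_ge0 x : 0 <= clip x.
Proof. by rewrite /clip le_max lexx. Qed.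

Lemma clip_le1 x : clip x <= 1.
Proof. by rewrite /clip ge_max ler01 ge_min lexx. Qed.

Lemma clip_le0 x : x <= 0 -> clip x = 0.
Proof.
by move=> x0; apply/eqP; rewrite eq_le clip_ge0 andbT /clip ge_max lexx ge_min x0 orbT.
Qed.

Lemma clip_ge1 x : 1 <= x -> clip x = 1.
Proof. by move=> x1; rewrite /clip min_l // max_r. Qed.

Lemma clip_lipschitz x y : `|clip x - clip y| <= `|x - y|.
Proof.
wlog xy : x y / x <= y.
  by move=> H; have [/H//|/ltW/H] := leP x y; rewrite distrC (distrC y).
have [x0|x0] := leP x 0.
  rewrite (clip_le0 x0) sub0r normrN (ger0_norm (clip_ge0 y)) distrC ger0_norm ?subr_ge0 //.
  have [y0|y0] := leP y 0; first by rewrite clip_le0 // subr_ge0.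
  by apply: (@le_trans _ _ y); [rewrite /clip ge_max (ltW y0) ge_min lexx orbT|rewrite lerDl oppr_ge0].
have [y1|y1] := leP 1 y.
  rewrite (clip_ge1 y1) distrC ger0_norm ?subr_ge0 ?clip_le1 // distrC ger0_norm ?subr_ge0 //.
  have [x1|x1] := leP 1 x; first by rewrite clip_ge1 // subrr subr_ge0.
  by rewrite /clip min_r ?(ltW x1) // max_r ?(ltW x0) // lerD2r.
have y0 : 0 < y by apply: lt_le_trans xy.
have x1 : x < 1 by apply: le_lt_trans y1.
by rewrite /clip !min_r ?(ltW x1) ?(ltW y1) // !max_r ?(ltW x0) ?(ltW y0).
Qed.

Lemma measurable_clip (f : R -> R) : measurable_fun setT f -> measurable_fun setT (fun x => clip (f x)).
Proof. by move=> mf; apply: measurable_maxr => //; apply: measurable_minr. Qed.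

Lemma mdensity_integrable m f : mdensity m f -> mu.-integrable D (EFin \o f).
Proof.
move=> F; apply/integrableP; split.
  by apply/measurable_EFinP; apply: measurable_funTS; exact: mdensity_measurable F.
have -> : (\int[mu]_(x in D) `|(EFin \o f) x| = \int[mu]_(x in D) (f x)%:E)%E.
  by apply: eq_integral => x _; rewrite /= ger0_norm // (mdensity_ge0 F).
by rewrite (mdensity_int F) ltry.
Qed.

Lemma lipschitz_on_bounded f a b : lipschitz_on f a b ->
  exists2 M, 0 <= M & forall x, a <= x <= b -> `|f x| <= M.
Proof.
case=> L fL; exists (`|f a| + `|L| * `|b - a|); first by rewrite addr_ge0 // mulr_ge0.
move=> x /andP[ax xb]; have ab := le_trans ax xb.
rewrite -[f x](subrK (f a)) addrC; apply: le_trans (ler_normD _ _) _; rewrite lerD2l.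
apply: le_trans (fL x a _ _) _; rewrite ?ax ?xb ?lexx ?ab //.
apply: (@le_trans _ _ (`|L| * `|x - a|)); first by rewrite ler_wpM2r // ler_norm.
by rewrite ler_wpM2l // !ger0_norm ?subr_ge0 // lerD2r.
Qed.

(* The kernel is cut off in u at two levels between n and a / m: below the cut f
   is evaluated at x / u in a compact subset of ]m, oo[, above it the
   substitution u -> x / u exchanges the roles of f and g. *)
Lemma mconv_lipschitz m n f g a b : mdensity m f -> mdensity n g -> m * n < a ->
  (forall x, a <= x <= b -> mu.-integrable D (EFin \o (fun u => u^-1 * (f (x * u^-1) * g u)))) /\
  lipschitz_on (mconv f g) a b.
Proof.
move=> F G mna; have m0 := mdensity_pos F; have n0 := mdensity_pos G.
have mf := mdensity_measurable F; have mg := mdensity_measurable G.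
have f0 := mdensity_ge0 F; have g0 := mdensity_ge0 G.
have na : n < a / m by rewrite ltr_pdivlMr // mulrC.
have a0 : 0 < a by apply: lt_trans mna; rewrite mulr_gt0.
(* The levels [k1] < [k2] cut the gap between n and a / m into thirds, and [r] is the slope of a
   cut-off rising from 0 at [k1] to 1 at [k2]. *)
pose r := 3 / (a / m - n); pose k1 := n + r^-1; pose k2 := k1 + r^-1.
have r0 : 0 < r by rewrite divr_gt0 // subr_gt0.
have rV0 : 0 < r^-1 by rewrite invr_gt0.
have rV : r^-1 = (a / m - n) / 3 by rewrite /r invf_div.
have k2a : k2 < a / m by rewrite /k2 /k1 rV; lra.
have k1n : n < k1 by rewrite ltrDl.
have k12 : k1 < k2 by rewrite ltrDl.
have k20 : 0 < k2 by apply: lt_trans k12; apply: lt_trans k1n.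
pose psi u := clip (r * (u - k1)).
have psi0 u : 0 <= psi u by exact: clip_ge0.
have psi1 u : psi u <= 1 by exact: clip_le1.
have psik1 u : u <= k1 -> psi u = 0.
  by move=> uk; apply: clip_le0; rewrite pmulr_rle0 // subr_le0.
have psik2 u : k2 <= u -> psi u = 1.
  by move=> uk; apply: clip_ge1; rewrite mulrC -ler_pdivrMr // div1r lerBrDl.
have psiL u v : `|psi u - psi v| <= r * `|u - v|.
  apply: le_trans (clip_lipschitz _ _) _; rewrite -mulrBr normrM (gtr0_norm r0).
  by rewrite (_ : u - k1 - (v - k1) = u - v) //; ring.
have mpsi : measurable_fun setT psi.
  by apply: measurable_clip; apply: measurable_funM => //; exact: measurable_funB.
(* [g1] lives on n < u < k2, where x / u >= a / k2 > m, so f is Lipschitz at the points met. [g2]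
   vanishes up to k1 > n, so it is Lipschitz up to b / m and can be the evaluated factor after the
   exchange. *)
pose g1 u := g u * (1 - psi u); pose g2 u := g u * psi u.
have mg1 : measurable_fun setT g1 by apply: measurable_funM => //; exact: measurable_funB.
have mg2 : measurable_fun setT g2 by exact: measurable_funM.
have g10 u : 0 <= g1 u by rewrite mulr_ge0 // subr_ge0.
have g20 u : 0 <= g2 u by rewrite mulr_ge0.
have ig := mdensity_integrable G; have if_ := mdensity_integrable F.
have ig1 : mu.-integrable D (EFin \o g1).
  apply: le_integrable ig => //; first by apply/measurable_EFinP; exact: measurable_funTS.
  move=> u _; rewrite /= lee_fin !ger0_norm // ler_piMr //.
  by rewrite gerBl.
have int1 h m' : mdensity m' h -> \int[mu]_(x in D) h x = 1.
  by move=> H; rewrite /Rintegral (mdensity_int H).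
have [L fL] : lipschitz_on f (a / k2) (b / n).
  by apply: (mdensity_lipschitz F); rewrite ltr_pdivlMr // mulrC -ltr_pdivlMr.
have [M M0 fM] := lipschitz_on_bounded (ex_intro _ L fL).
have rng u x : g1 u != 0 -> a <= x <= b -> a / k2 <= x * u^-1 <= b / n.
  move=> gu /andP[ax xb].
  have nu : n < u by rewrite ltNge; apply: contra gu => /(mdensity_supp G); rewrite /g1 => ->;
    rewrite mul0r.
  have uk : u < k2.
    by rewrite ltNge; apply: contra gu => /psik2; rewrite /g1 => ->; rewrite subrr mulr0.
  have u0 : 0 < u by apply: lt_trans nu.
  have x0 : 0 < x by apply: lt_le_trans ax.
  rewrite !ler_pM ?invr_ge0 ?(ltW a0) ?(ltW u0) ?(ltW x0) ?(ltW k20) ?lef_pV2 ?posrE //;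
    exact: ltW.
have p1 : \int[mu]_(u in D) g1 u <= 1.
  by rewrite -(int1 g n G); apply: le_Rintegral => // u _; rewrite ler_piMr // gerBl.
have s1 u : u <= n -> g1 u = 0 by move=> /(mdensity_supp G); rewrite /g1 => ->; rewrite mul0r.
have c1 u x y : g1 u != 0 -> a <= x <= b -> a <= y <= b ->
    `|f (x * u^-1) - f (y * u^-1)| <= `|L| * `|x * u^-1 - y * u^-1|.
  move=> gu xab yab; apply: le_trans (fL _ _ (rng u x gu xab) (rng u y gu yab)) _.
  by rewrite ler_wpM2r // ler_norm.
have [i1 l1] := mconv_part n0 mg1 mf g10 ig1 p1 s1 (normr_ge0 L) M0
  (fun u x gu xab => fM _ (rng u x gu xab)) c1.
have [Lg gL] : lipschitz_on g k1 (b / m) by apply: (mdensity_lipschitz G).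
have [Mg Mg0 gM] := lipschitz_on_bounded (ex_intro _ Lg gL).
pose L2 := `|Lg| + Mg * r.
have L20 : 0 <= L2 by rewrite addr_ge0 // mulr_ge0 // ltW.
have g2k u : u <= k1 -> g2 u = 0 by move=> /psik1; rewrite /g2 => ->; rewrite mulr0.
have rng2 u x : f u != 0 -> a <= x <= b -> x * u^-1 <= b / m.
  move=> fu /andP[ax xb].
  have mu' : m < u by rewrite ltNge; apply: contra fu => /(mdensity_supp F) ->.
  have u0 : 0 < u by apply: lt_trans mu'.
  have x0 : 0 < x by apply: lt_le_trans ax.
  by rewrite ler_pM ?invr_ge0 ?(ltW u0) ?(ltW x0) ?lef_pV2 ?posrE // ltW.
have g2M x : x <= b / m -> `|g2 x| <= Mg.
  move=> xb; have [xk|/ltW xk] := leP x k1; first by rewrite g2k // normr0.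
  rewrite normrM (ger0_norm (psi0 _)); apply: le_trans (_ : `|g x| <= _).
    by rewrite ler_piMr.
  by apply: gM; rewrite xk xb.
(* If the two points lie on different sides of [k1], the vanishing of [psi] at the lower one bounds
   the difference by the Lipschitz constant of [psi]; above [k1] the product rule gives [L2]. *)
have g2L x y : x <= b / m -> y <= b / m -> `|g2 x - g2 y| <= L2 * `|x - y|.
  have H v w : v <= b / m -> k1 <= v -> w <= k1 -> `|g2 v - g2 w| <= L2 * `|v - w|.
    move=> vb kv wk; rewrite (g2k w wk) subr0 /g2 -[psi v]subr0 -(psik1 w wk) normrM.
    apply: (@le_trans _ _ (Mg * (r * `|v - w|))); first by rewrite ler_pM // gM // kv vb.
    by rewrite /L2 mulrA ler_wpM2r // lerDr.
  move=> xb yb; have [xk|/ltW xk] := leP x k1; have [yk|/ltW yk] := leP y k1.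
  - by rewrite !g2k // subrr normr0 mulr_ge0.
  - by rewrite distrC (distrC x); exact: H.
  - exact: H.
  have -> : g2 x - g2 y = (g x - g y) * psi x + g y * (psi x - psi y) by rewrite /g2; ring.
  apply: le_trans (ler_normD _ _) _; rewrite /L2 [leRHS]mulrDl lerD //.
    rewrite normrM (ger0_norm (psi0 _)); apply: le_trans (_ : `|g x - g y| <= _).
      by rewrite ler_piMr.
    apply: le_trans (gL x y _ _) _; rewrite ?xk ?yk //.
    by rewrite ler_wpM2r // ler_norm.
  by rewrite normrM -mulrA ler_pM // gM // yk yb.
have p2 : \int[mu]_(u in D) f u <= 1 by rewrite (int1 f m F).
have [i2 l2] := mconv_part m0 mf mg2 f0 if_ p2 (mdensity_supp F) L20 Mg0
  (fun u x fu xab => g2M _ (rng2 u x fu xab))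
  (fun u x y fu xab yab => g2L _ _ (rng2 u x fu xab) (rng2 u y fu yab)).
have i3 x : a <= x <= b -> mu.-integrable D (EFin \o (fun u => u^-1 * (f (x * u^-1) * g2 u))).
  move=> xab; have x0 : 0 < x by case/andP: xab => ax _; exact: lt_le_trans ax.
  apply/integrableP; split.
    by apply/measurable_EFinP; apply: measurable_funTS; exact: measurable_mconv_integrand.
  have -> : (\int[mu]_(u in D) `|(EFin \o (fun u => u^-1 * (f (x * u^-1) * g2 u))%R) u| =
      \int[mu]_(u in D) (u^-1 * (f (x * u^-1) * g2 u))%:E)%E.
    by apply: eq_integral => u /mem_pos u0; rewrite /= ger0_norm // !mulr_ge0 // invr_ge0 ltW.
  rewrite mconv_sym //; have /integrable_fin_num := i2 x xab.
  by rewrite fin_numElt => /(_ mD) /andP[].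
have e3 x : a <= x <= b -> \int[mu]_(u in D) (u^-1 * (f (x * u^-1) * g2 u)) =
    \int[mu]_(u in D) (u^-1 * (g2 (x * u^-1) * f u)).
  move=> xab; have x0 : 0 < x by case/andP: xab => ax _; exact: lt_le_trans ax.
  by rewrite /Rintegral mconv_sym.
have gE u : g u = g1 u + g2 u by rewrite /g1 /g2; ring.
have kE x : (fun u => u^-1 * (f (x * u^-1) * g u)) =
    (fun u => u^-1 * (f (x * u^-1) * g1 u) + u^-1 * (f (x * u^-1) * g2 u)).
  by apply/funext => u; rewrite gE; ring.
split=> [x xab|].
  by rewrite kE; have := @integrableD _ _ _ mu D mD _ _ (i1 x xab) (i3 x xab).
have mE x : a <= x <= b -> mconv f g x = \int[mu]_(u in D) (u^-1 * (f (x * u^-1) * g1 u)) +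
    \int[mu]_(u in D) (u^-1 * (g2 (x * u^-1) * f u)).
  move=> xab; have x0 : 0 < x by case/andP: xab => ax _; exact: lt_le_trans ax.
  rewrite /mconv x0 kE -(e3 x xab).
  by have := @RintegralD _ _ _ mu D _ _ mD (i1 x xab) (i3 x xab).
exists (`|L| / n ^+ 2 + L2 / m ^+ 2) => x y xab yab; rewrite !mE // opprD addrACA mulrDl.
by apply: le_trans (ler_normD _ _) (lerD (l1 x y xab yab) (l2 x y xab yab)).
Qed.

Lemma mconv_integrable m n f g x : mdensity m f -> mdensity n g -> 0 < x ->
  mu.-integrable D (EFin \o (fun u => u^-1 * (f (x * u^-1) * g u))).
Proof.
move=> F G x0; have [xmn|xmn] := leP x (m * n).
  have := @integrable0 _ _ _ mu D; apply: eq_integrable => // u /mem_pos u0; rewrite /=.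
  have [un|un] := leP u n.
    by rewrite (mdensity_supp G un) !mulr0.
  rewrite (mdensity_supp F) ?mul0r ?mulr0 // ler_pdivrMr //.
  by apply: le_trans xmn _; rewrite ler_pM2l ?ltW // (mdensity_pos F).
(* The midpoint serves as lower end of an interval ending at x and lying above the left end of the
   support. *)
have mna : m * n < (m * n + x) / 2 by lra.
by have [+ _] := mconv_lipschitz x F G mna; apply; rewrite lexx andbT; lra.
Qed.

Lemma mconvE m n f g x : mdensity m f -> mdensity n g -> 0 < x ->
  ((mconv f g x)%:E = \int[mu]_(u in D) (u^-1 * (f (x * u^-1) * g u))%:E)%E.
Proof.
move=> F G x0; rewrite /mconv x0 /Rintegral fineK //.
exact: integrable_fin_num (mconv_integrable F G x0).
Qed.

Lemma mdensity_mconv m n f g : mdensity m f -> mdensity n g -> mdensity (m * n) (mconv f g).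
Proof.
move=> F G; have m0 := mdensity_pos F; have n0 := mdensity_pos G.
have mf := mdensity_measurable F; have mg := mdensity_measurable G.
have f0 := mdensity_ge0 F; have g0 := mdensity_ge0 G.
pose k (z : R * R) : \bar R := (z.2^-1 * (f (z.1 * z.2^-1) * g z.2))%:E.
have mk : measurable_fun setT k by apply/measurable_EFinP; exact: measurable_mconv_kernel.
have k0 x u : D x -> D u -> (0 <= k (x, u))%E.
  by move=> _ /mem_set /mem_pos u0; rewrite lee_fin !mulr_ge0 // invr_ge0 ltW.
split.
- by rewrite mulr_gt0.
- have mc := measurable_tonelli_on mD mD mk k0.
  have mc' : measurable_fun D (mconv f g).
    apply/measurable_EFinP; apply: eq_measurable_fun mc => x /mem_pos x0.
    by rewrite /= (mconvE F G x0).
  have := (measurable_restrictT _ mD).1 mc'; apply: eq_measurable_fun => x _.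
  rewrite /patch; case: ifPn => // /negP xD; rewrite /mconv.
  by case: ifPn => // x0; case: xD; rewrite inE /= in_itv /= andbT.
- move=> x; rewrite /mconv; case: ifPn => // x0; apply: Rintegral_ge0 => u /mem_set /mem_pos u0.
  by rewrite !mulr_ge0 // invr_ge0 ltW.
- move=> x xmn; rewrite /mconv; case: ifPn => // x0; rewrite /Rintegral integral0_eq // => u uD.
  have u0 : 0 < u by apply: mem_pos; rewrite inE.
  have [un|un] := leP u n; first by rewrite (mdensity_supp G un) !mulr0.
  rewrite (mdensity_supp F) ?mul0r ?mulr0 // ler_pdivrMr //.
  by apply: le_trans xmn _; rewrite ler_pM2l // ltW.
- transitivity (\int[mu]_(x in D) \int[mu]_(u in D) k (x, u))%E.
    by apply: eq_integral => x /mem_pos x0; rewrite (mconvE F G x0).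
  rewrite tonelli_on // -[RHS](mdensity_int G); apply: eq_integral => u /mem_pos u0.
  have V0 : 0 < u^-1 by rewrite invr_gt0.
  have mfu : measurable_fun D (fun x => (f (u^-1 * x + 0))%:E).
    apply/measurable_EFinP; apply: measurable_funTS; apply: (measurableT_comp mf).
    by apply: measurable_funD => //; exact: measurable_funM.
  have -> : (\int[mu]_(x in D) k (x, u) =
      (g u)%:E * ((u^-1)%:E * \int[mu]_(x in D) (f (u^-1 * x + 0))%:E))%E.
    rewrite -ge0_integralZl_EFin //; last 2 first.
    - by move=> x _; rewrite lee_fin.
    - by rewrite ltW.
    rewrite -ge0_integralZl_EFin //; last 2 first.
    - by move=> x _; rewrite -EFinM lee_fin mulr_ge0 // ltW.
    - by apply: emeasurable_funM => //; exact: measurable_cst.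
    by apply: eq_integral => x _; rewrite -!EFinM addr0 /k /= (mulrC x); congr EFin; ring.
  rewrite (@ge0_integral_affine _ u^-1 0 V0 (EFin \o f)).
  - by rewrite (mdensity_int F) mule1.
  - by apply/measurable_EFinP; exact: measurable_funTS.
  - by move=> x _; rewrite lee_fin.
- by move=> a b mna; have [] := mconv_lipschitz b F G mna.
Qed.

End MultiplicativeConvolution.

(** * Mellin transforms of densities and convolutions *)

Section MellinDensity.
Variable R : realType.
Local Notation mu := (@lebesgue_measure R).
Local Notation D := (`]0%R, +oo[%classic : set R).
Implicit Types (f g : R -> R) (a b c m n x y u : R) (s : R[i]).

Let mD : measurable D. Proof. exact: measurable_itv. Qed.

Definition mellin f s : R[i] := cintegral D (fun x => (f x)%:C * rcpow x (s - 1)).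

(** On the support x > m > 0, and for c <= 1 this gives x^(c-1) <= m^(c-1). It is here that the
    positive shifts produce a whole half-plane of convergence. *)
Lemma mdensity_integrable_powR m f c : mdensity m f -> c <= 1 ->
  mu.-integrable D (EFin \o (fun x => f x * x `^ (c - 1))).
Proof.
move=> F c1; have m0 := mdensity_pos F.
have ih := @integrableZl _ _ _ mu D mD (m `^ (c - 1)) _ (mdensity_integrable F).
apply: le_integrable ih => //.
  apply/measurable_EFinP; apply: measurable_funTS; apply: measurable_funM.
    exact: mdensity_measurable F.
  exact: measurable_powR.
move=> x _; have f0 := mdensity_ge0 F x; have [xm|xm] := leP x m.
  by rewrite /= (mdensity_supp F xm) mul0r mulr0.
rewrite /= lee_fin !ger0_norm ?mulr_ge0 ?powR_ge0 // mulrC ler_wpM2r //.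
have x0 : 0 < x by apply: lt_trans xm.
have -> : c - 1 = - (1 - c) by ring.
rewrite !powRN lef_pV2 ?posrE ?powR_gt0 //.
by apply: ge0_ler_powR; rewrite ?subr_ge0 ?nnegrE ?(ltW m0) ?(ltW x0) ?(ltW xm).
Qed.

Lemma cintegrable_mellin m f s : mdensity m f -> Re s <= 1 ->
  cintegrable D (fun x => (f x)%:C * rcpow x (s - 1)).
Proof.
move=> F s1; apply: (cintegrable_le mD _ (mdensity_integrable_powR F s1)).
  apply: cmeasurableM.
    by apply: cmeasurable_real; apply: measurable_funTS; exact: mdensity_measurable F.
  by apply: cmeasurable_rcpow; [exact: measurable_id|exact: cmeasurable_cst].
move=> x /mem_set /mem_pos x0.
by rewrite cabsM cabs_real cabs_rcpow // ger0_norm ?(mdensity_ge0 F) // !ReImE.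
Qed.

(** For fixed u the substitution x -> u x separates the kernel into a function of x and a function
    of u; the same computation with moduli justifies Fubini. *)
Lemma mellin_mconv m n f g s : mdensity m f -> mdensity n g -> Re s <= 1 ->
  mellin (mconv f g) s = mellin f s * mellin g s.
Proof.
move=> F G s1; have mf := mdensity_measurable F; have mg := mdensity_measurable G.
have f0 := mdensity_ge0 F; have g0 := mdensity_ge0 G.
pose k (z : R * R) : R[i] :=
  (z.1^-1 * (f (z.2 * z.1^-1) * g z.1))%:C * rcpow z.2 (s - 1).
have mk : cmeasurable setT k.
  apply: cmeasurableM; last first.
    by apply: cmeasurable_rcpow; [exact: measurable_snd|exact: cmeasurable_cst].
  apply: cmeasurable_real.
  have mV : measurable_fun setT (fun z : R * R => z.1^-1) by exact: measurable_inv measurable_fst.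
  apply: measurable_funM => //; apply: measurable_funM;
    last exact: (measurableT_comp mg measurable_fst).
  by apply: (measurableT_comp mf); apply: measurable_funM => //; exact: measurable_snd.
have iF := cintegrable_mellin F s1.
have outer u : 0 < u -> cintegral D (fun x => k (u, x)) = mellin f s * ((g u)%:C * rcpow u (s - 1)).
  move=> u0; have V0 : 0 < u^-1 by rewrite invr_gt0.
  have E := @cintegral_affine R u^-1 0 V0 _ (cmeasurable_int iF).
  have i' := @cintegrable_affine R u^-1 0 V0 _ iF.
  rewrite [mellin f s]/mellin -E.
  have -> : cintegral D (fun x => k (u, x)) = cintegral D (fun x =>
      ((g u)%:C * rcpow u (s - 1) * (u^-1)%:C) * ((f (u^-1 * x + 0))%:C * rcpow (u^-1 * x + 0) (s - 1))).
    apply: eq_cintegral => x /mem_pos x0; rewrite /k /= addr0 (mulrC _ x) rcpow_div // rcpowN.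
    rewrite !rmorphM /=.
    have := rcpow_neq0 u (s - 1).
    move: (rcpow u _) (rcpow x _) (f _)%:C (g u)%:C (u^-1)%:C => A B C E' H A0.
    by field.
  by rewrite (cintegralZl _ mD i'); ring.
have inner x : 0 < x -> cintegral D (fun u => k (u, x)) = (mconv f g x)%:C * rcpow x (s - 1).
  move=> x0; have i := mconv_integrable F G x0.
  have ic : cintegrable D (fun u => (u^-1 * (f (x * u^-1) * g u))%:C).
    by split => //=; exact: integrable0.
  by rewrite /k /= (cintegralZr _ mD ic) cintegral_real /mconv x0.
have fin : (\int[mu]_(u in D) \int[mu]_(x in D) (cabs (k (u, x)))%:E < +oo)%E.
  have iFc := mdensity_integrable_powR F s1; have iGc := mdensity_integrable_powR G s1.
  pose J := \int[mu]_(x in D) (f x * x `^ (Re s - 1)).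
  have ig := @integrableZl _ _ _ mu D mD J _ iGc.
  suff -> : (\int[mu]_(u in D) \int[mu]_(x in D) (cabs (k (u, x)))%:E =
      \int[mu]_(u in D) (J%:E * (EFin \o (fun u => g u * u `^ (Re s - 1))%R) u))%E.
    by have /integrable_fin_num := ig; rewrite fin_numElt => /(_ mD) /andP[].
  apply: eq_integral => u /mem_pos u0; have V0 : 0 < u^-1 by rewrite invr_gt0.
  have i' := @integrable_affine R u^-1 0 V0 _ iFc.
  transitivity (\int[mu]_(x in D) ((g u * u `^ (Re s - 1) * u^-1)%:E *
      (EFin \o (fun x => f x * x `^ (Re s - 1))%R) (u^-1 * x + 0)%R))%E.
    apply: eq_integral => x /mem_pos x0; rewrite /k /= cabsM cabs_rcpow // cabs_real.
    rewrite ger0_norm ?mulr_ge0 ?(ltW V0) // -EFinM addr0; congr EFin; rewrite (mulrC _ x).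
    rewrite powRM ?(ltW x0) ?(ltW V0) // !ReImE /=.
    have -> : u^-1 `^ (Re s - 1) = (u `^ (Re s - 1))^-1.
      by rewrite -[in LHS](powR_inv1 (ltW u0)) -powRrM mulN1r powRN.
    have := powR_gt0 (Re s - 1) u0; move: (u `^ (Re s - 1)) => A A0.
    by field; rewrite !gt_eqF.
  rewrite (@integralZl _ _ _ mu D mD _ i').
  have -> : (\int[mu]_(x in D) (EFin \o (fun x => f x * x `^ (Re s - 1))%R) (u^-1 * x + 0)%R =
      (u * J)%:E)%E.
    have := @integral_affine R u^-1 0 V0 _ (measurable_int _ iFc).
    have iJ : (\int[mu]_(x in D) (EFin \o (fun x => f x * x `^ (Re s - 1))%R) x = J%:E)%E.
      by rewrite /J /Rintegral fineK //; exact: integrable_fin_num.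
    rewrite iJ; have /integrable_fin_num := i' => /(_ mD).
    case: (integral _ _ _) => [r _ | |] //=; rewrite -EFinM => -[<-].
    by rewrite mulVKf // gt_eqF.
  by rewrite /= -!EFinM; congr EFin; field; rewrite gt_eqF.
have [_ _ e] := cintegral_fubini mD mD mk fin.
have iG := cintegrable_mellin G s1.
rewrite [mellin (mconv f g) s]/mellin [mellin g s]/mellin -(cintegralZl _ mD iG).
transitivity (cintegral D (fun x => cintegral D (fun u => k (u, x)))).
  by apply: eq_cintegral => x /mem_pos x0; rewrite (inner x x0).
by rewrite -e; apply: eq_cintegral => u /mem_pos u0; rewrite (outer u u0).
Qed.

(** The second derivative ensures that f' is continuous, hence bounded on the compact interval; the
    mean value theorem then gives the constant. *)
Lemma lipschitz_on_C1 f f' f'' a b :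
  (forall x, a <= x <= b -> is_derive x 1 f (f' x)) ->
  (forall x, a <= x <= b -> is_derive x 1 f' (f'' x)) -> lipschitz_on f a b.
Proof.
move=> df df'.
have ab_ex : exists2 M, 0 <= M & forall x, a <= x <= b -> `|f' x| <= M.
  have [ab|ab] := leP a b; last first.
    by exists 0 => // x /andP[ax xb]; have := le_trans ax xb; rewrite leNgt ab.
  have cf' : {within `[a, b], continuous f'}.
    by apply: derivable_within_continuous => x; rewrite in_itv /= => xab; have [] := df' x xab.
  have [M1 _ h1] := EVT_max ab cf'; have [M2 _ h2] := EVT_min ab cf'.
  exists (`|f' M1| + `|f' M2|); first by rewrite addr_ge0.
  move=> x xab; have := h1 x; have := h2 x; rewrite in_itv /= xab => /(_ isT) l2 /(_ isT) l1.
  rewrite ler_norml; apply/andP; split.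
    by have := ler_norm (- f' M2); have := normr_ge0 (f' M1); rewrite normrN; lra.
  by have := ler_norm (f' M1); have := normr_ge0 (f' M2); lra.
have [M M0 fM] := ab_ex.
exists M => x y xab yab.
wlog xy : x y xab yab / x <= y.
  by move=> H; have [/H|/ltW/H] := leP x y; [exact|rewrite distrC (distrC y); exact].
have [c] : exists2 c, c \in `[x, y]%R & f y - f x = f' c * (y - x).
  have sub v : v \in `[x, y]%R -> a <= v <= b.
    rewrite in_itv /= => /andP[xv vy]; case/andP: xab => ax _; case/andP: yab => _ yb.
    by rewrite (le_trans ax xv) (le_trans vy yb).
  apply: MVT_segment => //.
    by move=> v vi; apply: df; apply: sub; exact: subset_itv_oo_cc vi.
  by apply: derivable_within_continuous => v vi; have [] := df v (sub v vi).
rewrite in_itv /= => /andP[xc cy]; rewrite distrC => ->; rewrite normrM distrC ler_wpM2r //.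
apply: fM; case/andP: xab => ax _; case/andP: yab => _ yb.
by rewrite (le_trans ax xc) (le_trans cy yb).
Qed.

End MellinDensity.

(** * The generalized gamma density *)

Section GenGamma.
Variable R : realType.
Local Notation mu := (@lebesgue_measure R).
Local Notation D := (`]0%R, +oo[%classic : set R).
Variables alpha beta gamma m : R.
Hypotheses (alpha0 : 0 < alpha) (beta0 : 0 < beta) (gamma0 : 0 < gamma) (m0 : 0 < m).
Local Notation f := (gengamma_pdf alpha beta gamma m).
Implicit Types (a b p x v : R) (s : R[i]).

Let mD : measurable D. Proof. exact: measurable_itv. Qed.
Let ag0 : 0 < alpha / gamma. Proof. by rewrite divr_gt0. Qed.

Let C : R := gamma * beta `^ (alpha / gamma) / rgamma (alpha / gamma).
(** A family closed under differentiation up to linear combination: E(p)' = p E(p - 1) - beta gamma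
    E(p + gamma - 1). The derivatives required by [lipschitz_on_C1] are thus explicit. *)
Let E p x : R := (x - m) `^ p * expR (- (beta * (x - m) `^ gamma)).

Let pdfE x : m < x -> f x = C * E (alpha - 1) x.
Proof.
by move=> mx; rewrite /gengamma_pdf mx cGammaE // Euler_Gamma_real /= /C /E !mulrA.
Qed.

Let isd_E p x : m < x -> is_derive x 1 (E p) (p * E (p - 1) x - beta * gamma * E (p + gamma - 1) x).
Proof.
move=> mx; have w0 : 0 < x - m by rewrite subr_gt0.
have dw : is_derive x 1 (fun x => x - m) 1 by apply: isd_eq (isdB (isd_id x) (isd_cst x m)) _;
  rewrite subr0.
have dp q : is_derive x 1 (fun x => (x - m) `^ q) (q * (x - m) `^ (q - 1)).
  by apply: isd_eq (isd_comp (f := fun y => y `^ q) (g := fun x => x - m) (is_derive1_powR q w0) dw) _; rewrite mulr1.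
have de := isd_expR (isdMl (- beta) (dp gamma)).
have -> : E p = (fun x => (x - m) `^ p * expR (- beta * (x - m) `^ gamma)).
  by apply/funext => y; rewrite /E mulNr.
apply: isd_eq (isdM (dp p) de) _; rewrite /E.
rewrite (_ : p + gamma - 1 = p + (gamma - 1)) ?powRD ?(lt0r_neq0 w0) ?implybT //; last by ring.
by rewrite -mulNr; ring.
Qed.

Lemma gengamma_lipschitz a b : m < a -> lipschitz_on f a b.
Proof.
move=> ma; have gt x : a <= x <= b -> m < x by case/andP => ax _; exact: lt_le_trans ax.
have [L fL] : lipschitz_on (fun x => C * E (alpha - 1) x) a b.
  apply: (@lipschitz_on_C1 R _ _ (fun x => C *
      ((alpha - 1) * ((alpha - 1 - 1) * E (alpha - 1 - 1 - 1) x -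
                      beta * gamma * E (alpha - 1 - 1 + gamma - 1) x) -
       beta * gamma * ((alpha - 1 + gamma - 1) * E (alpha - 1 + gamma - 1 - 1) x -
                      beta * gamma * E (alpha - 1 + gamma - 1 + gamma - 1) x)))) => x /gt mx.
    exact: isdMl (isd_E _ mx).
  exact: isdMl (isdB (isdMl _ (isd_E _ mx)) (isdMl _ (isd_E _ mx))).
by exists L => x y xab yab; rewrite !pdfE ?gt //; exact: fL.
Qed.

Lemma integral_D_supp (h : R -> \bar R) (A : set R) c : measurable A -> D `<=` A -> 0 <= c ->
  (forall x, x <= c -> h x = 0%E) ->
  (\int[mu]_(x in A) h x = \int[mu]_(x in `]c, +oo[) h x)%E.
Proof.
move=> mA DA c0 h0; rewrite integral_mkcond [RHS]integral_mkcond; apply: eq_integral => x _.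
rewrite /patch; have [xc|xc] := leP x c; first by rewrite h0 //; do 2 case: ifPn => //.
by rewrite !mem_set //= ?in_itv /= ?xc //; apply: DA; rewrite /= in_itv /= andbT;
  exact: le_lt_trans xc.
Qed.

(** Measurability, sign and total mass are supplied by [is_pdf]; what is added is the support, the
    regularity and the passage from the line to the positive half-line. *)
Lemma mdensity_gengamma : measurable_fun setT f -> (forall x, 0 <= f x) ->
  (\int[mu]_x (f x)%:E = 1)%E -> mdensity m f.
Proof.
move=> mf f0 f1; have fs x : x <= m -> f x = 0 by move=> xm; rewrite /gengamma_pdf ltNge xm.
split=> //; last exact: gengamma_lipschitz.
have h0 x : x <= m -> (f x)%:E = 0%E by move=> /fs ->.
rewrite -[RHS]f1 (@integral_D_supp (EFin \o f) setT m) // ?(ltW m0) //.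
by rewrite (@integral_D_supp (EFin \o f) D m) // ltW.
Qed.

Lemma mellin_gengamma s : mdensity m f -> Re s < 1 ->
  mellin f s = (gamma * beta `^ (alpha / gamma) * m `^ (alpha - 1))%:C *
    (rcpow m s * (hfun alpha gamma s (beta * m `^ gamma) / Euler_Gamma (alpha / gamma)%:C)).
Proof.
move=> F s1; have i := cintegrable_mellin F (ltW s1).
pose k x : R[i] := (f x)%:C * rcpow x (s - 1).
have k0 x : x <= m -> k x = 0 by move=> xm; rewrite /k (mdensity_supp F xm) mul0r.
have mm : measurable (`]m, +oo[%classic : set R) by exact: measurable_itv.
have -> : mellin f s = cintegral `]m, +oo[ k.
  have H (h : R -> R) : (forall x, x <= m -> h x = 0) ->
      \int[mu]_(x in D) h x = \int[mu]_(x in `]m, +oo[) h x.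
    move=> h0; rewrite /Rintegral (@integral_D_supp (EFin \o h) D m) ?(ltW m0) //.
    by move=> x /h0; rewrite /= => ->.
  apply: complexP; [apply: (H (fun x => Re (k x)))|apply: (H (fun x => Im (k x)))];
    by move=> x /k0 ->.
have mk : cmeasurable `]m, +oo[ k.
  apply: cmeasurableS (cmeasurable_int i) => // x.
  by rewrite /= !in_itv /= !andbT; exact: lt_trans.
rewrite -(cintegral_affine (b := m) m0 mk).
have [c hc] := hstrip_ex alpha0 gamma0 s1.
have ih := cintegrable_hfun gamma0 hc (mulr_gt0 beta0 (powR_gt0 gamma m0)).
(* At x = m (1 + v) the density contributes m^(alpha - 1) and the Mellin kernel m^(s - 1); the
   Jacobian m later raises the latter to m^s. *)
have -> : cintegral D (fun v => k (m * v + m)) = cintegral D (fun v =>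
    ((C * m `^ (alpha - 1))%:C * rcpow m (s - 1)) *
    (hweight alpha s v * (expR (- (beta * m `^ gamma * v `^ gamma)))%:C)).
  apply: eq_cintegral => v /mem_pos v0; have v1 : 0 < 1 + v by rewrite addr_gt0.
  rewrite /k (_ : m * v + m = m * (1 + v)); last by ring.
  rewrite pdfE; last by rewrite ltr_pMr // ltrDl.
  rewrite /E (_ : m * (1 + v) - m = m * v); last by ring.
  rewrite !powRM ?(ltW m0) ?(ltW v0) // rcpowM // /hweight mulrA (mulrA beta).
  rewrite (_ : rcpow v (alpha%:C - 1) = (v `^ (alpha - 1))%:C);
    last by rewrite -rcpow_real // rmorphB.
  by rewrite !rmorphM /=; ring.
rewrite (cintegralZl _ mD ih) -/(hfun _ _ _ _) Euler_Gamma_real.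
rewrite (_ : rcpow m s = rcpow m (s - 1) * m%:C); last by rewrite -[m%:C]rcpow1 // -rcpowD subrK.
by rewrite /C !rmorphM fmorphV /=; ring.
Qed.

End GenGamma.

(** * The law of a product *)

Section ProductLaw.
Variables (R : realType) (d : measure_display) (T : measurableType d).
Variable P : probability T R.
Local Notation mu := (@lebesgue_measure R).
Local Notation D := (`]0%R, +oo[%classic : set R).
Implicit Types (X Y : {RV P >-> R}) (f g : R -> R) (A B : set R).

Let mD : measurable D. Proof. exact: measurable_itv. Qed.

Section IntegralPdf.
Variables (Y : {RV P >-> R}) (f : R -> R).
Hypothesis Yf : is_pdf P Y f.

Let mf : measurable_fun setT f. Proof. by case: Yf. Qed.
Let f0 x : 0 <= f x. Proof. by case: Yf. Qed.

Let integral_pdf_indic A : measurable A ->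
  (\int[distribution P Y]_x (\1_A x)%:E = \int[mu]_x ((\1_A x)%:E * (f x)%:E))%E.
Proof.
move=> mA; rewrite integral_indic // setIT.
have [_ _ pdf] := Yf; transitivity (\int[mu]_(x in A) (f x)%:E)%E; first exact: pdf.
rewrite integral_mkcond; apply: eq_integral => x _.
by rewrite patchE indicE; case: ifPn => _; rewrite ?mul1e ?mul0e.
Qed.

Import HBNNSimple.

Let integral_pdf_nnsfun (h : {nnsfun R >-> R}) :
  (\int[distribution P Y]_x (h x)%:E = \int[mu]_x ((h x)%:E * (f x)%:E))%E.
Proof.
under [LHS]eq_integral do rewrite fimfunE -fsumEFin//.
rewrite [LHS]ge0_integral_fsum//; last 2 first.
  - by move=> r; exact/measurable_EFinP/measurableT_comp.
  - by move=> n x _; rewrite EFinM nnfun_muleindic_ge0.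
under [RHS]eq_integral.
  move=> x xD; rewrite fimfunE -fsumEFin// ge0_mule_fsuml; last first.
    by move=> r; rewrite EFinM nnfun_muleindic_ge0.
  over.
rewrite [RHS]ge0_integral_fsum//; last 2 first.
  - move=> r; have mr : measurable (h @^-1` [set r]) by [].
    apply: emeasurable_funM; last exact/measurable_EFinP.
    apply/measurable_EFinP; apply: measurable_funM; first exact: measurable_cst.
    exact: measurable_indic.
  - by move=> n x _; apply: mule_ge0; [rewrite EFinM nnfun_muleindic_ge0|rewrite lee_fin].
apply: eq_fsbigr => r _.
have mr : measurable (h @^-1` [set r]) by [].
have [r0|r0] := ltP r 0.
  have -> : h @^-1` [set r] = set0.
    by apply/seteqP; split=> // x /= hx; move: r0; rewrite -hx ltNge fun_ge0.
  by rewrite !integral0_eq // => x _; rewrite indic0 mulr0 ?mul0e.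
under eq_integral do rewrite EFinM.
rewrite ge0_integralZl_EFin //; last exact/measurable_EFinP/measurable_indic.
rewrite integral_pdf_indic // -ge0_integralZl_EFin //.
- by apply: eq_integral => x _; rewrite EFinM muleA.
- by move=> x _; rewrite mule_ge0 ?lee_fin.
- by apply: emeasurable_funM; [exact/measurable_EFinP/measurable_indic|exact/measurable_EFinP].
Qed.

(** Extension from indicators, where it is the definition of a density, to simple functions by
    linearity and to non-negative measurable functions by monotone convergence. *)
Lemma integral_pdf (h : R -> \bar R) : measurable_fun setT h -> (forall x, 0 <= h x)%E ->
  (\int[distribution P Y]_x h x = \int[mu]_x (h x * (f x)%:E))%E.
Proof.
move=> mh h0; pose h_ := nnsfun_approx measurableT mh.
have hcvg x : ((h_ n x)%:E @[n --> \oo] --> h x)%E by exact: cvg_nnsfun_approx.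
transitivity (lim (\int[distribution P Y]_x (h_ n x)%:E @[n --> \oo])%E).
  rewrite -monotone_convergence //=.
  - by apply: eq_integral => x _; apply/esym/cvg_lim.
  - by move=> n; exact/measurable_EFinP/measurable_funTS.
  - by move=> n x _; rewrite lee_fin.
  - by move=> x _ a b ab; rewrite lee_fin; exact/lefP/nd_nnsfun_approx.
under eq_fun do rewrite integral_pdf_nnsfun.
rewrite -monotone_convergence //=.
- apply: eq_integral => x _; apply: cvg_lim => //.
  by apply: cvgeZr.
- move=> n; apply: emeasurable_funM; last exact/measurable_EFinP.
  by apply/measurable_EFinP; exact: (@measurable_funPT _ _ _ _ (h_ n)).
- by move=> n x _; rewrite mule_ge0 // lee_fin.
- move=> x _ a b ab; apply: lee_wpmul2r; rewrite lee_fin //.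
  by have /lefP := nd_nnsfun_approx measurableT mh ab; apply.
Qed.

End IntegralPdf.
(* E is the event carrying the factors not yet multiplied. *)
Lemma prob_mul_density X Y f g m n (E : set T) (rho : R) : measurable E -> 0 < rho ->
  mdensity m f -> mdensity n g -> is_pdf P Y f -> is_pdf P X g ->
  (forall A B, measurable A -> measurable B ->
     P (Y @^-1` A `&` (X @^-1` B `&` E)) = (P (Y @^-1` A) * (P (X @^-1` B) * rho%:E))%E) ->
  forall A, measurable A ->
    P ((fun w => Y w * X w) @^-1` A `&` E) =
    ((\int[mu]_(x in A) (mconv g f x)%:E) * rho%:E)%E.
Proof.
move=> mE rho0 F G Yf Xg indep A mA.
have mf := mdensity_measurable F; have mg := mdensity_measurable G.
have f0 := mdensity_ge0 F; have g0 := mdensity_ge0 G.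
have mYX : measurable_fun setT (fun w => (Y w, X w)) by exact: measurable_fun_pair.
(* The joint law of Y and X restricted to [E] and divided by [rho] factorizes on rectangles, so by
   uniqueness it is the product of the two laws. The division is why [rho] is taken positive. *)
pose nu := measure_function_pushforward__canonical__measure_function_Measure
  (mrestr P mE) mYX.
pose r : {nonneg R} := NngNum (ltW (etrans (invr_gt0 rho) rho0)).
pose m' : {measure set (R * R) -> \bar R} := mscale r nu.
pose S := (fun z : R * R => z.1 * z.2) @^-1` A.
have mS : measurable S.
  rewrite -[S]setTI; apply: measurable_funM => //.
have m'E S' : m' S' = ((rho^-1)%:E * P ((fun w => (Y w, X w)) @^-1` S' `&` E))%E by [].
have alg (a b : \bar R) : ((rho^-1)%:E * (a * (b * rho%:E)) = a * b)%E.
  rewrite (muleA a) (muleC (a * b)%E) muleA -EFinM.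
  by rewrite mulVf ?gt_eqF // mul1e.
have mprod (A1 B1 : set R) : measurable A1 -> measurable B1 ->
    m' (A1 `*` B1) = (distribution P Y A1 * distribution P X B1)%E.
  move=> mA1 mB1; rewrite m'E.
  rewrite (_ : _ `&` E = Y @^-1` A1 `&` (X @^-1` B1 `&` E)); last first.
    by apply/seteqP; split => w /=; [move=> [[]]|move=> [? []]].
  by rewrite indep // alg.
have meq := @product_measure_unique _ _ _ _ _ (distribution P Y) (distribution P X) m' mprod S mS.
have -> : P ((fun w => Y w * X w) @^-1` A `&` E) = (rho%:E * m' S)%E.
  by rewrite m'E muleA -EFinM mulfV ?gt_eqF // mul1e.
rewrite -meq muleC; congr (_ * _)%E.
have -> : (distribution P Y \x distribution P X)%E S =
    (\int[distribution P Y]_y (distribution P X (xsection S y)))%E by [].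
have mh : measurable_fun setT (fun y => distribution P X (xsection S y)).
  exact: measurable_fun_xsection.
rewrite (integral_pdf Yf mh) //.
have [_ _ pX] := Xg.
have f00 x : x <= m -> f x = 0 by exact: mdensity_supp F x.
have g00 x : x <= n -> g x = 0 by exact: mdensity_supp G x.
have m0 := mdensity_pos F; have n0 := mdensity_pos G.
pose k (z : R * R) : \bar R := (\1_A z.1 * (z.2^-1 * (g (z.1 * z.2^-1) * f z.2)))%:E.
have mk : measurable_fun setT k.
  apply/measurable_EFinP; apply: measurable_funM; last exact: measurable_mconv_kernel.
  by apply: (measurableT_comp _ measurable_fst); exact: measurable_indic.
have k0 z y : D z -> D y -> (0 <= k (z, y))%E.
  by move=> _ /mem_set /mem_pos y0; rewrite lee_fin !mulr_ge0 // invr_ge0 ltW.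
(* For fixed y the section is the set of x with y x in A. The substitution z = y x turns it into A,
   and its Jacobian 1 / y is the weight in [mconv]; non-positive x contribute nothing because g
   vanishes there. *)
have inner y : 0 < y -> (distribution P X (xsection S y) * (f y)%:E = \int[mu]_(z in D) k (z, y))%E.
  move=> y0; have -> : distribution P X (xsection S y) =
      (\int[mu]_(x in xsection S y) (g x)%:E)%E by apply: pX; exact: measurable_xsection.
  rewrite integral_mkcond.
  have mAg : measurable_fun setT (fun z => \1_A z * g (z * y^-1)).
    apply: measurable_funM; first exact: measurable_indic.
    by apply: (measurableT_comp mg); exact: measurable_funM.
  transitivity ((f y)%:E * \int[mu]_(x in D) (\1_A (y * x + 0) * g ((y * x + 0) * y^-1))%:E)%E.
    rewrite muleC; congr (_ * _)%E; rewrite [RHS]integral_mkcond; apply: eq_integral => x _.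
    rewrite !patchE addr0 mulrAC mulfV ?gt_eqF // mul1r.
    have [x0|x0] := leP x 0.
      rewrite (g00 x) ?(le_trans x0 (ltW n0)) // mulr0.
      by do 2 case: ifP => //.
    rewrite [x \in D]mem_set /=; last by rewrite in_itv /= andbT.
    rewrite indicE mem_xsection.
    by rewrite (_ : ((y, x) \in S) = (y * x \in A)) //; case: ifP => _; rewrite ?mul1r ?mul0r.
  have E1 := @ge0_integral_affine R y 0 y0 (fun z => (\1_A z * g (z * y^-1))%:E).
  have mAg' : measurable_fun D (fun z => (\1_A z * g (z * y^-1))%:E).
    by apply/measurable_EFinP; exact: measurable_funTS.
  have Ag0 z : (0 <= (\1_A z * g (z * y^-1))%:E)%E by rewrite lee_fin mulr_ge0.
  transitivity ((f y * y^-1)%:E * \int[mu]_(z in D) (\1_A z * g (z * y^-1))%:E)%E.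
    rewrite -(E1 mAg' (fun z _ => Ag0 z)) muleA -EFinM mulfVK ?gt_eqF //.
  rewrite -ge0_integralZl_EFin //; last by rewrite mulr_ge0 // invr_ge0 ltW.
  by apply: eq_integral => z _; rewrite -EFinM /k /=; congr EFin; ring.
transitivity (\int[mu]_(y in D) \int[mu]_(z in D) k (z, y))%E.
  rewrite [RHS]integral_mkcond; apply: eq_integral => y _.
  rewrite patchE; case: ifPn => [/mem_pos y0|]; first exact: inner.
  rewrite notin_setE /= in_itv /= andbT => /negP; rewrite -leNgt => y0.
  by rewrite (f00 y) ?mule0 // (le_trans y0 (ltW m0)).
rewrite -tonelli_on // integral_mkcond [RHS]integral_mkcond; apply: eq_integral => z _.
rewrite !patchE; case: ifPn => [/mem_pos z0|].
  transitivity ((\1_A z)%:E * (mconv g f z)%:E)%E; last first.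
    by rewrite indicE; case: ifP => _; rewrite ?mul1e ?mul0e.
  rewrite (mconvE G F z0) -ge0_integralZl_EFin //.
  - by move=> y /mem_set /mem_pos y0; rewrite lee_fin !mulr_ge0 // invr_ge0 ltW.
  - by apply/measurable_EFinP; apply: measurable_funTS; exact: measurable_mconv_integrand.
rewrite notin_setE /= in_itv /= andbT => /negP; rewrite -leNgt => z0.
by rewrite /mconv ltNge z0; case: ifP.
Qed.

End ProductLaw.

(** * Density of a finite product *)

Section ProductDensity.
Variables (R : realType) (d : measure_display) (T : measurableType d).
Variable P : probability T R.
Local Notation mu := (@lebesgue_measure R).
Local Notation D := (`]0%R, +oo[%classic : set R).
Variables (N : nat) (X : 'I_N -> {RV P >-> R}) (f_ : 'I_N -> R -> R) (m_ : 'I_N -> R).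
Hypothesis Xf : forall j, is_pdf P (X j) (f_ j).
Hypothesis fm : forall j, mdensity (m_ j) (f_ j).
Hypothesis indep : mutually_independent X.
Implicit Types (r : seq 'I_N) (J : {set 'I_N}) (A : set R) (B : 'I_N -> set R).

Let Y r w : R := \prod_(i <- r) X i w.

Let ev J B : set T := \bigcap_(i in [set i : 'I_N | i \in J]) (X i @^-1` B i).

Lemma measurable_prod_RV r : measurable_fun setT (Y r).
Proof.
rewrite /Y; elim: r => [|j r IH]; first by under eq_fun do rewrite big_nil; exact: measurable_cst.
by under eq_fun do rewrite big_cons; apply: measurable_funM => //.
Qed.

Let measurable_ev J B : (forall j, measurable (B j)) -> measurable (ev J B).
Proof.
move=> mB; apply: fin_bigcap_measurable => [|i _]; first exact: finite_finset.
by rewrite -[X in measurable X]setTI; exact: (measurable_funPT (X i)).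
Qed.

(** A condition on one more variable joins the event without leaving the class of events to which
    the independence hypothesis applies. *)
Let evU1 J B A j : j \notin J ->
  X j @^-1` A `&` ev J B = ev (j |: J) (fun i => if i == j then A else B i).
Proof.
move=> jJ; apply/seteqP; split => w /=.
  move=> [Aj EJ] i /=; rewrite in_setU1; case: eqVneq => [->//|_ /=]; exact: EJ.
move=> H; split; first by have := H j; rewrite /= eqxx in_setU1 eqxx; apply.
move=> i /= iJ; have := H i; rewrite /= in_setU1 iJ orbT => /(_ isT).
by case: eqVneq => // ij; move: jJ; rewrite -ij iJ.
Qed.

Let prodU1 J B A j : j \notin J ->
  (\prod_(i in j |: J) P (X i @^-1` (if i == j then A else B i)) =
   P (X j @^-1` A) * \prod_(i in J) P (X i @^-1` B i))%E.
Proof.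
move=> jJ; rewrite big_setU1 //= eqxx; congr (_ * _)%E; apply: eq_bigr => i iJ.
by case: eqVneq => // ij; move: jJ; rewrite -ij iJ.
Qed.

(** The law of the partial product is computed jointly with an arbitrary event of the other
    variables: this stronger claim is what lets the induction absorb the next factor, since
    independence is given for events only. The list is non-empty because the empty product, the
    constant 1, has no density. *)
Lemma product_density r j : uniq (j :: r) -> exists f : R -> R,
  [/\ mdensity (\prod_(i <- j :: r) m_ i) f,
      forall s, Re s <= 1 -> mellin f s = \prod_(i <- j :: r) mellin (f_ i) s
    & forall J B A, measurable A -> (forall i, measurable (B i)) ->
      {in J, forall i, i \notin j :: r} ->
      P (Y (j :: r) @^-1` A `&` ev J B) =
      ((\int[mu]_(x in A) (f x)%:E) * \prod_(i in J) P (X i @^-1` B i))%E].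
Proof.
elim: r j => [|i r IH] j.
  move=> _; exists (f_ j); split.
  - by rewrite big_seq1; exact: fm.
  - by move=> s _; rewrite big_seq1.
  move=> J B A mA mB Jj; have jJ : j \notin J.
    by apply/negP => /Jj; rewrite inE eqxx.
  have -> : Y [:: j] = X j by apply/funext => w; rewrite /Y big_seq1.
  have [_ _ pX] := Xf j; rewrite -pX // -prodU1 // evU1 //; apply: indep => k.
  by case: ifP.
move=> /[dup] ujr; rewrite [uniq _]/= => /andP[jr uir]; have [f [F Mf law]] := IH i uir.
pose Yr : {RV P >-> R} := mfun_Sub (mem_set (measurable_prod_RV (i :: r))).
have ev0 B : ev finset.set0 B = setT.
  by apply/seteqP; split=> // w _ k /=; rewrite finset.in_set0.
have Yf : is_pdf P Yr f.
  split; [exact: mdensity_measurable F|exact: mdensity_ge0 F|move=> A mA].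
  have := law finset.set0 (fun=> setT) A mA (fun=> measurableT).
  by rewrite ev0 setIT big_set0 mule1; apply => k; rewrite finset.in_set0.
exists (mconv (f_ j) f); split.
- by rewrite big_cons; exact: mdensity_mconv (fm j) F.
- by move=> s s1; rewrite big_cons (mellin_mconv (fm j) F s1) Mf.
move=> J B A mA mB Jjr.
have jJ : j \notin J by apply/negP => /Jjr; rewrite inE eqxx.
have Jir : {in J, forall k, k \notin i :: r}.
  by move=> k /Jjr; rewrite inE negb_or => /andP[].
have PE : P (ev J B) = (\prod_(k in J) P (X k @^-1` B k))%E by exact: indep.
have YE : Y [:: j, i & r] = (fun w => Yr w * X j w).
  by apply/funext => w; rewrite /Y big_cons mulrC.
rewrite YE -PE; have mE := measurable_ev J mB.
have [rho PErho] : exists rho : R, P (ev J B) = rho%:E.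
  by exists (fine (P (ev J B))); rewrite fineK // fin_num_measure.
(* An event of probability 0 makes both sides 0 and is treated apart, since [prob_mul_density]
   normalizes by the probability. *)
have rho0 : 0 <= rho by rewrite -lee_fin -PErho.
rewrite PErho; move: rho0; rewrite le_eqVlt => /predU1P[rho0|rho0].
  rewrite -rho0 mule0; apply/eqP; rewrite eq_le measure_ge0 andbT.
  have <- : P (ev J B) = 0%E by rewrite PErho -rho0.
  apply: le_measure; [rewrite inE|rewrite inE; exact: mE|by move=> w []].
  apply: measurableI; last exact: mE.
  rewrite -[X in measurable X]setTI.
  have mYX : measurable_fun setT (fun w => Yr w * X j w) by exact: measurable_funM.
  exact: mYX.
(* The condition on X j is moved into the event, now indexed by j and J; the induction hypothesis
   applies because j does not occur in the shorter list. *)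
apply: (prob_mul_density mE rho0 F (fm j) Yf (Xf j)) => // A1 B1 mA1 mB1.
rewrite evU1 // -PErho PE -prodU1 //; have [_ _ pY] := Yf; rewrite pY //.
apply: law => // [k|k]; first by case: ifP.
rewrite in_setU1 => /predU1P[->//|]; exact: Jir.
Qed.

End ProductDensity.

Section ComplexLog.
Variable R : realType.
Implicit Types z w : R[i].

Lemma cexp_clog z : z != 0 -> cexp (clog z) = z.
Proof.
move=> z0; have a0 : 0 < cabs z.
  rewrite lt_neqAle cabs_ge0 andbT; apply: contra z0 => /eqP z0.
  by rewrite -normr_eq0 cabs_normc -z0.
have aE : cabs z ^+ 2 = Re z ^+ 2 + Im z ^+ 2 by rewrite sqr_sqrtr // addr_ge0 ?sqr_ge0.
have t1 : -1 <= Re z / cabs z <= 1.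
  by rewrite -ler_norml normrM normfV (gtr0_norm a0) ler_pdivrMr // mul1r Re_le_cabs.
have s2 : 1 - (Re z / cabs z) ^+ 2 = (Im z / cabs z) ^+ 2.
  rewrite !exprMn !exprVn (_ : Im z ^+ 2 = cabs z ^+ 2 - Re z ^+ 2);
    last by rewrite aE addrC addKr.
  by rewrite mulrBl mulfV // expf_neq0 // gt_eqF.
have cs : cos (carg z) = Re z / cabs z.
  by rewrite /carg; case: ifP => _; rewrite ?cosN acosK // in_itv.
have sn : sin (carg z) = Im z / cabs z.
  rewrite /carg; have E : sin (acos (Re z / cabs z)) = `|Im z| / cabs z.
    by rewrite sin_acos // s2 sqrtr_sqr normrM normfV (gtr0_norm a0).
  case: ifP => i0; rewrite ?sinN E; first by rewrite ger0_norm.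
  by rewrite ler0_norm ?mulNr ?opprK //; move/negbT: i0; rewrite -ltNge => /ltW.
apply: complexP; rewrite /cexp /clog /= lnK ?posrE // ?cs ?sn; field; rewrite gt_eqF //.
Qed.

(** In a block the H function has exponent 0 s + 1, and its value is an arbitrary complex number,
    possibly 0 or off the positive axis. *)
Lemma cpow1 z : cpow z 1 = z.
Proof.
rewrite /cpow; case: eqVneq => [->|z0]; first by rewrite oner_eq0.
by rewrite mul1r cexp_clog.
Qed.

End ComplexLog.

(** The bases mu and beta mu^gamma are positive constants, so the only constraint is that the H
    functions have separating lines, that is Re s < 1. A first index, available as N > 0, gives the
    converse. *)
Lemma Ihat_contour_lt1 (R : realType) N (alpha beta gamma mu : 'I_N -> R) c :
  (0 < N)%N -> (forall j, 0 < alpha j) -> (forall j, 0 < beta j) ->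
  (forall j, 0 < gamma j) -> (forall j, 0 < mu j) ->
  Ihat_contour (fun j => gengamma_block (alpha j) (beta j) (gamma j) (mu j)) c <-> c < 1.
Proof.
move=> N0 a0 b0 g0 m0; split=> [H|c1 j s sc].
  have [_ _ [c' /(foxH_contourP _ _ _ _ (g0 _)) [c0 c1 c2]]] := H (Ordinal N0) c%:C erefl.
  by have := lt_trans c1 c2; rewrite ltr_pM2r ?invr_gt0 //=; lra.
have nz (x : R) : 0 < x -> affine 0 x s != 0.
  by move=> x0; rewrite /affine mul0r add0r; apply/eqP => -[/eqP]; rewrite gt_eqF.
split=> /=; [exact: nz|by apply: nz; rewrite mulr_gt0 ?powR_gt0|].
have [c' hc'] := @hstrip_ex _ (alpha j) (gamma j) s (a0 j) (g0 j) (eq_ind_r (fun x => x < 1) c1 sc).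
by exists c'; apply/foxH_contourP.
Qed.

Theorem theorem2 (R : realType) (d : measure_display) (T : measurableType d)
    (P : probability T R) (N : nat) (X : 'I_N -> {RV P >-> R})
    (alpha beta gamma mu : 'I_N -> R)
    (hN : (0 < N)%N)
    (halpha : forall j, 0 < alpha j) (hbeta : forall j, 0 < beta j)
    (hgamma : forall j, 0 < gamma j) (hmu : forall j, 0 < mu j)
    (hX : forall j,
       is_pdf P (X j) (gengamma_pdf (alpha j) (beta j) (gamma j) (mu j)))
    (hindep : mutually_independent X) :
  let B := fun j => gengamma_block (alpha j) (beta j) (gamma j) (mu j) in
  let K := \prod_(j < N)
    (gamma j * beta j `^ (alpha j / gamma j) * mu j `^ (alpha j - 1)) in
  let Y := fun w : T => \prod_(j < N) X j w in
  exists f : R -> R,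
    [/\ is_pdf P Y f,
        exists2 c : R, Ihat_contour B c
          & P.-integrable setT (EFin \o (fun w => Y w `^ (c - 1)))
      & forall c : R, Ihat_contour B c ->
        forall x : R, 0 < x -> x != \prod_(j < N) mu j ->
        exists2 v : R[i], is_Ihat B c x%:C v & (f x)%:C = K%:C * v].

Proof.
move=> B K Y.
pose f_ j := gengamma_pdf (alpha j) (beta j) (gamma j) (mu j).
have fm j : mdensity (mu j) (f_ j).
  have [mf f0 pX] := hX j; apply: mdensity_gengamma => //.
  by have := pX setT measurableT; rewrite preimage_setT probability_setT.
have [f [F Mf law]] : exists f : R -> R,
  [/\ mdensity (\prod_(j < N) mu j) f,
      forall s, Re s <= 1 -> mellin f s = \prod_(j < N) mellin (f_ j) s
    & is_pdf P Y f].
  have := @product_density _ _ _ P N X f_ mu hX fm hindep.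
  (* [product_density] is used for the list of all indices, non-empty since N > 0, and with the
     empty set of remaining conditions. *)
  case E : (enum 'I_N) => [|j r] H.
    have : (0 < size (enum 'I_N))%N by rewrite size_enum_ord.
    by rewrite E.
  have [|f [F Mf law]] := H r j; first by rewrite -E enum_uniq.
  exists f; rewrite -E big_enum in F; split=> //.
    by move=> s s1; rewrite Mf // -E big_enum.
  split; [exact: mdensity_measurable F|exact: mdensity_ge0 F|move=> A mA].
  have := law finset.set0 (fun=> setT) A mA (fun=> measurableT).
  rewrite big_set0 mule1 => <-; last by move=> k; rewrite finset.in_set0.
  congr (P _); rewrite (_ : \bigcap_(_ in _) _ = setT) ?setIT; last first.
    by apply/seteqP; split=> // w _ k /=; rewrite finset.in_set0.
  suff -> : Y = (fun w => \prod_(i <- j :: r) X i w) by [].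
  by apply/funext => w; rewrite /Y -E big_enum.
have M0 := mdensity_pos F.
exists f; split=> //.
  (* At c = 0 the moment is that of 1 / Y, finite because the density of Y is carried by a half-line
     with positive left end. *)
  exists 0; first by apply/Ihat_contour_lt1.
  have mY : measurable_fun setT Y by exact: measurable_prod_RV.
  pose Yr : {RV P >-> R} := mfun_Sub (mem_set mY).
  have mp : measurable_fun setT (fun x : R => (x `^ (0 - 1))%:E).
    by apply/measurable_EFinP; exact: measurable_powR.
  have p0 (x : R) : (0 <= (x `^ (0 - 1))%:E)%E by rewrite lee_fin powR_ge0.
  apply/integrableP; split; first exact: measurableT_comp mp mY.
  have -> : (\int[P]_w `|(EFin \o (fun w => Y w `^ (0 - 1))%R) w| =
      \int[P]_w ((fun x : R => (x `^ (0 - 1))%:E) \o Yr) w)%E.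
    by apply: eq_integral => w _; rewrite /= ger0_norm ?powR_ge0.
  rewrite -ge0_integral_distribution // (@integral_pdf _ _ _ P Yr f law) //.
  have iF := mdensity_integrable_powR F ler01.
  have -> : (\int[lebesgue_measure]_x ((x `^ (0 - 1))%:E * (f x)%:E) =
      \int[lebesgue_measure]_(x in `]0%R, +oo[) (EFin \o (fun x => f x * x `^ (0 - 1))%R) x)%E.
    rewrite [RHS]integral_mkcond; apply: eq_integral => x _; rewrite patchE.
    case: ifPn => [_|]; first by rewrite /= -EFinM mulrC.
    rewrite notin_setE /= in_itv /= andbT => /negP; rewrite -leNgt => x0.
    by rewrite (mdensity_supp F) ?mule0 // (le_trans x0 (ltW M0)).
  have mD : measurable (`]0%R, +oo[%classic : set R) by exact: measurable_itv.
  by have /integrable_fin_num := iF; rewrite fin_numElt => /(_ mD) /andP[].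
move=> c /Ihat_contour_lt1 c1' x x0 xm.
have c1 : c < 1 by exact: c1'.
have K0 : 0 < K.
  by apply: prodr_gt0 => j _; rewrite !mulr_gt0 ?powR_gt0.
have KC : K%:C != 0 by apply/eqP => -[/eqP]; rewrite gt_eqF.
exists ((f x)%:C / K%:C); last by rewrite mulrC divfK.
exists (fun j s => hfun (alpha j) (gamma j) s (beta j * mu j `^ gamma j) /
                   Euler_Gamma (alpha j / gamma j)%:C); split.
  by move=> j s sc; apply: is_foxH_hfun => //; rewrite sc.
have mD : measurable (`]0%R, +oo[%classic : set R) by exact: measurable_itv.
(* Dividing by K beforehand cancels the constants of the individual Mellin transforms, so that the
   transform of [G] is exactly the product of the mu_j^s h_j(s), which is [Upsilon]. *)
pose G y : R[i] := (K^-1)%:C * (f y)%:C.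
have GE : G x = (f x)%:C / K%:C by rewrite /G fmorphV mulrC.
rewrite -GE; apply: eq_line_integral (mellin_inversion (m := \prod_(j < N) mu j) x0 _ _ _ _).
- move=> y; set s := c +i* y; have s1 : Re s < 1 by [].
  have i := cintegrable_mellin F (ltW s1).
  have -> : cintegral `]0, +oo[ (fun x => G x * rcpow x (s - 1)) =
      (K^-1)%:C * cintegral `]0, +oo[ (fun x => (f x)%:C * rcpow x (s - 1)).
    by rewrite -(cintegralZl _ mD i); apply: eq_cintegral => z _; rewrite /G mulrA.
  rewrite -/(mellin f s) (Mf s (ltW s1)) cpow_real //; congr (_ * _).
  under eq_bigr do rewrite (mellin_gengamma (halpha _) (hbeta _) (hgamma _) (hmu _) (fm _) s1).
  rewrite big_split /= -rmorph_prod mulrA -rmorphM mulVf ?gt_eqF // mul1r.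
  apply: eq_bigr => j _; rewrite /= /affine !rmorph0 !rmorph1 !mul0r !add0r !mul1r !addr0.
  by rewrite cexp0 mulr1 cpow_real // cpow1.
- by rewrite eq_sym.
- apply: cmeasurableM; first exact: cmeasurable_cst.
  by apply: cmeasurable_real; exact: mdensity_measurable F.
- have := @integrableZl _ _ _ lebesgue_measure _ mD K^-1 _ (mdensity_integrable_powR F (ltW c1)).
  apply: eq_integrable => // z _; rewrite -EFinM; congr EFin.
  rewrite /G cabsM !cabs_real (ger0_norm (mdensity_ge0 F z)) ger0_norm ?mulrA //.
  by rewrite invr_ge0 ltW.
move=> y y0 yM.
have L : locally_lipschitz f y.
  (* Below the product of the shifts f vanishes near y. Above it, a radius of half the distance
     keeps the whole neighbourhood inside the region of the Lipschitz clause. *)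
  have [yM'|yM'] := ltP y (\prod_(j < N) mu j).
    exists 0, (\prod_(j < N) mu j - y); split; first by rewrite subr_gt0.
    move=> z; rewrite ltr_norml => zy; rewrite mul0r.
    by rewrite !(mdensity_supp F) ?subrr ?normr0 ?(ltW yM') //; lra.
  have yM2 : \prod_(j < N) mu j < y by rewrite lt_neqAle eq_sym yM.
  pose e := (y - \prod_(j < N) mu j) / 2; have e0 : 0 < e by rewrite divr_gt0 // subr_gt0.
  have [L fL] := @mdensity_lipschitz _ _ _ F (y - e) (y + e) ltac:(rewrite /e; lra).
  exists L, e; split=> // z; rewrite ltr_norml => zy; apply: fL; lra.
have LZ (k : R) : locally_lipschitz (fun z => k * f z) y.
  have [L0 [e [e0 fL]]] := L; exists (`|k| * L0), e; split=> // z zy.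
  by rewrite -mulrBr normrM -mulrA ler_wpM2l // fL.
split.
  by rewrite (_ : (fun z => _) = (fun z => K^-1 * f z)) //; apply/funext => z;
    rewrite /G ReM /= mulr0 subr0.
rewrite (_ : (fun z => _) = (fun z => 0 * f z)) //; apply/funext => z.
by rewrite /G ImM /= mulr0 mul0r addr0.
Qed.
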